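(* Assume the minimax problem, the standing assumptions (C1)–(C4) and the Acc-MDA algorithm described in the context, with constrained set $\mathcal{X}\subset\mathbb{R}^{d_1}$ (so that the update for $\mathcal{X}\ne\mathbb{R}^{d_1}$ is used). Let $\{x_t,y_t\}_{t=1}^T$ be generated by the algorithm with $\eta_t=\frac{k}{(m+t)^{1/3}}$ for all $t\ge0$, $c_1\ge\frac{2}{3k^3}+\frac{9\tau^2}{4}$, $c_2\ge\frac{2}{3k^3}+\frac{75L_f^2}{2}$, $k>0$, $m\ge\max\big(2,k^3,(c_1k)^3,(c_2k)^3\big)$, $0<\lambda\le\min\big(\frac{1}{6L_f},\frac{27b\tau}{16}\big)$ and $0<\gamma\le\min\Big(\frac{\lambda\tau}{2L_f}\sqrt{\frac{2b}{8\lambda^2+75\kappa_y^2b}},\frac{m^{1/3}}{2L_gk}\Big)$. Then $$\frac1T\sum_{t=1}^T\mathbb{E}\|G_{\mathcal{X}}(x_t,\nabla F(x_t),\gamma)\|\le\frac1T\sum_{t=1}^T\mathbb{E}[\mathcal{H}_t]\le\frac{2\sqrt{3M''}\,m^{1/6}}{T^{1/2}}+\frac{2\sqrt{3M''}}{T^{1/3}},$$ where $\Delta_1=\|y_1-y^*(x_1)\|^2$ and $$M''=\frac{F(x_1)-F^*}{\gamma k}+\frac{9L_f^2\Delta_1}{k\lambda\tau}+\frac{2m^{1/3}\delta^2}{b\tau^2k^2}+\frac{2(c_1^2+c_2^2)\delta^2k^2}{b\tau^2}\ln(m+T).$$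
   Context: Problem: $\min_{x\in\mathcal{X}}\max_{y\in\mathcal{Y}}f(x,y)$, $f(x,y)=\mathbb{E}_{\xi\sim\mathcal{D}'}[f(x,y;\xi)]$, with $f(\cdot,\cdot;\xi)$ differentiable, $\xi$ a random variable with distribution $\mathcal{D}'$, $\mathcal{X}\subset\mathbb{R}^{d_1}$ compact convex, and $\mathcal{Y}\subset\mathbb{R}^{d_2}$ compact convex or $\mathcal{Y}=\mathbb{R}^{d_2}$. $\|\cdot\|$ is the Euclidean norm; $\mathcal{P}_{\mathcal{X}},\mathcal{P}_{\mathcal{Y}}$ are Euclidean projections. $\nabla_x,\nabla_y$ are partial gradients and $\nabla f=(\nabla_xf,\nabla_yf)$. For a mini-batch $\mathcal{B}=\{\xi_1,\dots,\xi_b\}$, $\nabla_xf(x,y;\mathcal{B})=\frac1b\sum_{i=1}^b\nabla_xf(x,y;\xi_i)$, and likewise for $\nabla_y$. Standing assumptions. (C1) There is $\delta>0$ such that for all $x,y$: $\mathbb{E}\|\nabla_xf(x,y;\xi)-\nabla_xf(x,y)\|^2\le\delta^2$ and $\mathbb{E}\|\nabla_yf(x,y;\xi)-\nabla_yf(x,y)\|^2\le\delta^2$. (C2) $\|\nabla f(x,y;\xi)-\nabla f(x',y';\xi)\|\le L_f\|(x,y)-(x',y')\|$ for all $x,x'\in\mathcal{X}$, $y,y'\in\mathcal{Y}$. (C3) $f$ is $\tau$-strongly concave in $y$ ($\tau>0$): $f(x,y)\le f(x,y')+\langle\nabla_yf(x,y'),y-y'\rangle-\frac\tau2\|y-y'\|^2$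 for $x\in\mathcal{X}$, $y,y'\in\mathcal{Y}$. (C4) $F^*=\inf_{x\in\mathcal{X}}F(x)>-\infty$. Notation: $y^*(x)=\arg\max_{y\in\mathcal{Y}}f(x,y)$, $F(x)=\max_{y\in\mathcal{Y}}f(x,y)=f(x,y^*(x))$, $\kappa_y=L_f/\tau$, $L_g=L_f+L_f^2/\tau$. Acc-MDA algorithm, with parameters $\gamma,\lambda,k,m,c_1,c_2$, batch size $b\geq 1$, horizon $T$, initial $x_1\in\mathcal{X}$, $y_1\in\mathcal{Y}$: draw a mini-batch $\mathcal{B}_1$ of $b$ i.i.d. samples; set $v_1=\nabla_xf(x_1,y_1;\mathcal{B}_1)$, $w_1=\nabla_yf(x_1,y_1;\mathcal{B}_1)$. For $t=1,\dots,T$: $\eta_t=\frac{k}{(m+t)^{1/3}}$; if $\mathcal{X}=\mathbb{R}^{d_1}$, $x_{t+1}=x_t-\gamma\eta_tv_t$; otherwise $\tilde x_{t+1}=\mathcal{P}_{\mathcal{X}}(x_t-\gamma v_t)$, $x_{t+1}=x_t+\eta_t(\tilde x_{t+1}-x_t)$; $\tilde y_{t+1}=\mathcal{P}_{\mathcal{Y}}(y_t+\lambda w_t)$, $y_{t+1}=y_t+\eta_t(\tilde y_{t+1}-y_t)$; $\alpha_{t+1}=c_1\eta_t^2$, $\beta_{t+1}=c_2\eta_t^2$; draw a fresh independent mini-batch $\mathcal{B}_{t+1}$ of $b$ i.i.d. samples; $v_{t+1}=\nabla_xf(x_{t+1},y_{t+1};\mathcal{B}_{t+1})+(1-\alpha_{t+1})[v_t-\nabla_xf(x_t,y_t;\mathcal{B}_{t+1})]$,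 $w_{t+1}=\nabla_yf(x_{t+1},y_{t+1};\mathcal{B}_{t+1})+(1-\beta_{t+1})[w_t-\nabla_yf(x_t,y_t;\mathcal{B}_{t+1})]$. Convergence measures: $\mathcal{H}_t=\frac1\gamma\|\tilde x_{t+1}-x_t\|+\|\nabla_xf(x_t,y_t)-v_t\|+L_f\|y_t-y^*(x_t)\|$ and $G_{\mathcal{X}}(x_t,\nabla F(x_t),\gamma)=\frac1\gamma\big(x_t-\mathcal{P}_{\mathcal{X}}(x_t-\gamma\nabla F(x_t))\big)$. *)

(* Defs.v *)
From HB Require Import structures.
From mathcomp Require Import all_boot all_order all_algebra.
From mathcomp Require Import all_classical all_reals all_analysis.

Set Implicit Arguments.
Unset Strict Implicit.
Unset Printing Implicit Defensive.

Import Order.TTheory GRing.Theory Num.Theory.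
Import numFieldNormedType.Exports.

Local Open Scope classical_set_scope.
Local Open Scope ring_scope.

(* The library norm on 'rV[R]_n is the sup norm, so the Euclidean one is
   defined here; both induce the same topology, hence the library's
   [compact], [open] and [differentiable] are used unchanged. *)
Section euclidean.
Context {R : realType} {n : nat}.
Implicit Types (u v x z : 'rV[R]_n) (C : set 'rV[R]_n) (h : 'rV[R]_n -> R).

Definition dotp u v : R := (u *m v^T) 0 0.

Definition enorm v : R := Num.sqrt (dotp v v).

Definition eproj C z : 'rV[R]_n :=
  get [set p | C p /\ forall q, C q -> enorm (z - p) <= enorm (z - q)].

Definition grad h x : 'rV[R]_n := \row_i 'D_(delta_mx 0 i) h x.

(* [g] is a gradient at [x] of [h] regarded as a function on [C] only:
   h x' = h x + <g, x' - x> + o(|x' - x|) as x' tends to x inside C.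
   If C is convex with nonempty interior and x is in C, such a [g] is unique,
   and it is the ordinary gradient whenever h is differentiable at x. *)
Definition is_grad_on C h x (g : 'rV[R]_n) : Prop :=
  forall e : R, 0 < e -> \forall x' \near within C (nbhs x),
    `|h x' - h x - dotp g (x' - x)| <= e * enorm (x' - x).

Definition grad_on C h x : 'rV[R]_n := get [set g | is_grad_on C h x g].

End euclidean.

Section minimax.
Context {R : realType} {d1 d2 : nat}.
Implicit Types (h : 'rV[R]_d1 -> 'rV[R]_d2 -> R) (Y : set 'rV[R]_d2).

Definition gradx h x y : 'rV[R]_d1 := grad (fun x' => h x' y) x.

Definition grady h x y : 'rV[R]_d2 := grad (h x) y.

Definition gradxy h x y : 'rV[R]_(d1 + d2) := row_mx (gradx h x y) (grady h x y).

Definition ystar Y h x : 'rV[R]_d2 :=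
  get [set y | Y y /\ forall y', Y y' -> h x y' <= h x y].

Definition Fmax Y h x : R := h x (ystar Y h x).

End minimax.

Section stochastic.
Context {R : realType} {d1 d2 : nat} {dXi : measure_display}
  {Xi : measurableType dXi}.
Implicit Types (f : Xi -> 'rV[R]_d1 -> 'rV[R]_d2 -> R) (D : probability Xi R).

Definition fmean D f x y : R := \int[D]_z f z x y.

Definition gradxB f (b : nat) (B : 'I_b -> Xi) x y : 'rV[R]_d1 :=
  b%:R^-1 *: \sum_(i < b) gradx (f (B i)) x y.

Definition gradyB f (b : nat) (B : 'I_b -> Xi) x y : 'rV[R]_d2 :=
  b%:R^-1 *: \sum_(i < b) grady (f (B i)) x y.

Definition mutually_independent {dO : measure_display}
    {Omega : measurableType dO} (P : probability Omega R)
    (I : choiceType) (J : set I) (X : I -> Omega -> Xi) : Prop :=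
  forall (s : seq I) (A : I -> set Xi), uniq s -> [set` s] `<=` J ->
    (forall i, measurable (A i)) ->
    (P (\bigcap_(i in [set` s]) (X i @^-1` A i)) =
     \prod_(i <- s) P (X i @^-1` A i))%E.

(* [xi t i] is the i-th sample of the mini-batch B_t; a run with horizon T
   draws B_1, ..., B_(T+1). *)
Definition iid_batches {dO : measure_display} {Omega : measurableType dO}
    (P : probability Omega R) D (b T : nat)
    (xi : nat -> 'I_b -> {RV P >-> Xi}) : Prop :=
  (forall t i A, (1 <= t <= T.+1)%N -> measurable A ->
     distribution P (xi t i) A = D A) /\
  mutually_independent P [set j : nat * 'I_b | (1 <= j.1 <= T.+1)%N]
    (fun j => xi j.1 j.2).

Definition eta (k m : R) (t : nat) : R := k / (m + t%:R) `^ 3^-1.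

(* One trajectory of the algorithm (constrained update in x), for the
   realization B of the mini-batches; index 0 of the sequences is unused. *)
Record acc_mda f (X : set 'rV[R]_d1) (Y : set 'rV[R]_d2)
    (gam lam k m c1 c2 : R) (b T : nat) (x1 : 'rV[R]_d1) (y1 : 'rV[R]_d2)
    (B : nat -> 'I_b -> Xi)
    (x xt v : nat -> 'rV[R]_d1) (y yt w : nat -> 'rV[R]_d2) : Prop := AccMDA {
  mda_x1 : x 1%N = x1;
  mda_y1 : y 1%N = y1;
  mda_v1 : v 1%N = gradxB f (B 1%N) x1 y1;
  mda_w1 : w 1%N = gradyB f (B 1%N) x1 y1;
  mda_xt : forall t, (1 <= t <= T)%N ->
    xt t.+1 = eproj X (x t - gam *: v t);
  mda_x : forall t, (1 <= t <= T)%N ->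
    x t.+1 = x t + eta k m t *: (xt t.+1 - x t);
  mda_yt : forall t, (1 <= t <= T)%N ->
    yt t.+1 = eproj Y (y t + lam *: w t);
  mda_y : forall t, (1 <= t <= T)%N ->
    y t.+1 = y t + eta k m t *: (yt t.+1 - y t);
  mda_v : forall t, (1 <= t <= T)%N ->
    let alpha := c1 * eta k m t ^+ 2 in
    v t.+1 = gradxB f (B t.+1) (x t.+1) (y t.+1)
      + (1 - alpha) *: (v t - gradxB f (B t.+1) (x t) (y t));
  mda_w : forall t, (1 <= t <= T)%N ->
    let beta := c2 * eta k m t ^+ 2 in
    w t.+1 = gradyB f (B t.+1) (x t.+1) (y t.+1)
      + (1 - beta) *: (w t - gradyB f (B t.+1) (x t) (y t))
}.

End stochastic.

Section measures_of_convergence.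
Context {R : realType} {d1 d2 : nat}.

(* [xt'] stands for the projected point computed from [x] and [v]. *)
Definition Hmeasure (h : 'rV[R]_d1 -> 'rV[R]_d2 -> R) (Y : set 'rV[R]_d2)
    (gam Lf : R) (x xt' v : 'rV[R]_d1) (y : 'rV[R]_d2) : R :=
  gam^-1 * enorm (xt' - x) + enorm (gradx h x y - v)
  + Lf * enorm (y - ystar Y h x).

Definition Gmap (X : set 'rV[R]_d1) (x g : 'rV[R]_d1) (gam : R) : 'rV[R]_d1 :=
  gam^-1 *: (x - eproj X (x - gam *: g)).

End measures_of_convergence.

(* Main.v *)
Require Import Defs.
From HB Require Import structures.
From mathcomp Require Import all_boot all_order all_algebra.
From mathcomp Require Import ring lra.
From mathcomp Require Import all_classical all_reals all_analysis.
From mathcomp Require Import measurable_realfun.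

Set Implicit Arguments.
Unset Strict Implicit.
Unset Printing Implicit Defensive.

Import Order.TTheory GRing.Theory Num.Theory.
Import numFieldNormedType.Exports.

Local Open Scope classical_set_scope.
Local Open Scope ring_scope.

(** The proof is a Lyapunov argument. Let a_n = |y_n - y*(x_n)|^2, let e_n and g_n be the squared
    errors of v_n and w_n as estimates of the partial gradients of f at (x_n, y_n), and let p_n, q_n
    be the squared lengths of the projected moves in x and y. The potential is F(x_n) - F* + C a_n +
    (G / eta_(n-1)) (e_n + g_n), with C = 9 Lf^2 gam / (lam tau) and G = gam / tau^2.

    Four one-step inequalities feed it: a descent inequality for F ([x_step_descent]), a contraction
    of a_n up to the drift of the maximizer ([y_step]), and, in expectation, a recursion for each of
    e_n and g_n ([oracle_step]), in which the old error is damped and the fresh noise has variance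
    of order eta^4 plus the squared displacement of the iterates. The conditions on c1, c2, lam and
    gam are what it takes for these to combine ([lyapunov_step]) into an expected decrease of the
    potential by (gam / 4) eta_n (p_n / gam^2 + Lf^2 a_n + e_n), up to a noise term of order
    eta_n^3. The cubes of the step sizes are k^3 / (m + n), so their sum is logarithmic; telescoping
    and dividing by eta_T gives [lyapunov_sum], where the bracket is 4 M'' (m + T)^(1/3). The square
    of H_t is at most three times the summand, so averaging ([average_le_sqrt]) and splitting a cube
    root ([cube_root_sum_le]) give the rate.

    The inequality between the two measures holds pointwise ([Gmap_le_Hmeasure]): by Danskin's
    theorem ([Fmax_ub], [Fmax_lb]) the gradient of F at x is the x-gradient of f at (x, y*(x)), and
    projections are nonexpansive.

    Much of the work is analytic. Gradients are not assumed to commute with the expectation: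
    unbiasedness follows from the second moment bound (C1) alone, by a uniform integrability
    argument ([integral_derivative0]) resting on a mean value inequality for everywhere
    differentiable functions ([le_integral_derive]). Nor is any iterate assumed measurable:
    measurability is propagated along the algorithm through a Caratheodory lemma
    ([measurable_caratheodory2]). Conditioning on the past is done by integrating out a fresh sample
    against the sigma-algebra generated by the earlier ones ([history_tonelli]). *)

Section euclidean_space.
Context {R : realType} {n : nat}.
Implicit Types (u v w : 'rV[R]_n) (a : R).

(** * Euclidean inner product and norm on row vectors *)

Lemma dotpE u v : dotp u v = \sum_i u 0 i * v 0 i.
Proof. by rewrite /dotp mxE; apply: eq_bigr => i _; rewrite mxE. Qed.

Lemma dotpC u v : dotp u v = dotp v u.
Proof. by rewrite !dotpE; apply: eq_bigr => i _; rewrite mulrC. Qed.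

Lemma dotpDl u v w : dotp (u + v) w = dotp u w + dotp v w.
Proof. by rewrite /dotp mulmxDl mxE. Qed.

Lemma dotpDr u v w : dotp w (u + v) = dotp w u + dotp w v.
Proof. by rewrite dotpC dotpDl ![dotp _ w]dotpC. Qed.

Lemma dotpZl a u v : dotp (a *: u) v = a * dotp u v.
Proof. by rewrite /dotp -scalemxAl mxE. Qed.

Lemma dotpZr a u v : dotp u (a *: v) = a * dotp u v.
Proof. by rewrite dotpC dotpZl dotpC. Qed.

Lemma dotpNl u v : dotp (- u) v = - dotp u v.
Proof. by rewrite -scaleN1r dotpZl mulN1r. Qed.

Lemma dotpNr u v : dotp u (- v) = - dotp u v.
Proof. by rewrite dotpC dotpNl dotpC. Qed.

Lemma dotpBl u v w : dotp (u - v) w = dotp u w - dotp v w.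
Proof. by rewrite dotpDl dotpNl. Qed.

Lemma dotpBr u v w : dotp w (u - v) = dotp w u - dotp w v.
Proof. by rewrite dotpDr dotpNr. Qed.

Lemma dotp0l u : dotp 0 u = 0.
Proof. by rewrite -(scale0r 0) dotpZl mul0r. Qed.

Lemma dotp0r u : dotp u 0 = 0.
Proof. by rewrite dotpC dotp0l. Qed.

Lemma dotp_ge0 u : 0 <= dotp u u.
Proof. by rewrite dotpE sumr_ge0// => i _; rewrite -expr2 sqr_ge0. Qed.

Lemma enorm_ge0 u : 0 <= enorm u.
Proof. exact: sqrtr_ge0. Qed.

Lemma sqr_enorm u : enorm u ^+ 2 = dotp u u.
Proof. by rewrite sqr_sqrtr// dotp_ge0. Qed.

Lemma sqr_enormE u : enorm u ^+ 2 = \sum_i u 0 i ^+ 2.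
Proof. by rewrite sqr_enorm dotpE; apply: eq_bigr => i _; rewrite expr2. Qed.

Lemma enorm0 : enorm (0 : 'rV[R]_n) = 0.
Proof. by rewrite /enorm dotp0l sqrtr0. Qed.

Lemma enormZ a u : enorm (a *: u) = `|a| * enorm u.
Proof. by rewrite /enorm dotpZl dotpZr mulrA -expr2 sqrtrM ?sqr_ge0// sqrtr_sqr. Qed.

Lemma enormN u : enorm (- u) = enorm u.
Proof. by rewrite -scaleN1r enormZ normrN1 mul1r. Qed.

Lemma enormC u v : enorm (u - v) = enorm (v - u).
Proof. by rewrite -enormN opprB. Qed.

Lemma coord_le_enorm u i : `|u 0 i| <= enorm u.
Proof.
rewrite -(ler_pXn2r (n := 2))// ?nnegrE ?enorm_ge0//.
rewrite real_normK ?num_real// sqr_enormE (bigD1 i)//= lerDl.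
by apply: sumr_ge0 => j _; rewrite sqr_ge0.
Qed.

Lemma enorm_eq0 u : enorm u = 0 -> u = 0.
Proof.
move=> u0; apply/rowP => i; rewrite mxE; apply/eqP; rewrite -normr_eq0.
by rewrite eq_le normr_ge0 andbT -u0 coord_le_enorm.
Qed.

(** The square of [enorm v *: u - enorm u *: v] is 2 |u| |v| times the gap |u| |v| - <u, v>, so the
    gap is nonnegative once zero vectors are set aside. *)
Lemma dotp_le u v : dotp u v <= enorm u * enorm v.
Proof.
have [u0|u0] := eqVneq (enorm u) 0.
  by rewrite u0 (enorm_eq0 u0) dotp0l mul0r.
have [v0|v0] := eqVneq (enorm v) 0.
  by rewrite v0 (enorm_eq0 v0) dotp0r mulr0.
have up : 0 < enorm u by rewrite lt_def u0 enorm_ge0.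
have vp : 0 < enorm v by rewrite lt_def v0 enorm_ge0.
have := dotp_ge0 (enorm v *: u - enorm u *: v).
have -> : dotp (enorm v *: u - enorm u *: v) (enorm v *: u - enorm u *: v)
    = 2 * (enorm u * enorm v) * (enorm u * enorm v - dotp u v).
  rewrite !(dotpBl, dotpBr, dotpZl, dotpZr) -!sqr_enorm (dotpC v u); ring.
by rewrite pmulr_rge0 ?subr_ge0// mulr_gt0// mulr_gt0.
Qed.

Lemma normr_dotp_le u v : `|dotp u v| <= enorm u * enorm v.
Proof.
by rewrite ler_norml dotp_le andbT lerNl -dotpNl -(enormN u) dotp_le.
Qed.

Lemma enormD u v : enorm (u + v) <= enorm u + enorm v.
Proof.
rewrite -(ler_pXn2r (n := 2))// ?nnegrE ?addr_ge0 ?enorm_ge0//.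
rewrite sqr_enorm !(dotpDl, dotpDr) (dotpC v u) -!sqr_enorm sqrrD.
have := dotp_le u v; lra.
Qed.

Lemma sqr_enormD u v :
  enorm (u + v) ^+ 2 = enorm u ^+ 2 + 2 * dotp u v + enorm v ^+ 2.
Proof. by rewrite !sqr_enorm !(dotpDl, dotpDr) (dotpC v u); ring. Qed.

Lemma sqr_enormB u v :
  enorm (u - v) ^+ 2 = enorm u ^+ 2 - 2 * dotp u v + enorm v ^+ 2.
Proof. by rewrite sqr_enormD dotpNr enormN; ring. Qed.

Lemma sqr_enormD_le u v :
  enorm (u + v) ^+ 2 <= 2 * enorm u ^+ 2 + 2 * enorm v ^+ 2.
Proof.
by have := sqr_ge0 (enorm (u - v)); rewrite sqr_enormB sqr_enormD; lra.
Qed.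

Lemma dotp_young a u v : 0 < a ->
  dotp u v <= a * enorm u ^+ 2 + enorm v ^+ 2 / (4 * a).
Proof.
move=> a0; have := sqr_ge0 (enorm ((2 * a) *: u - v)).
rewrite sqr_enormB enormZ dotpZl exprMn real_normK ?num_real//.
set U := enorm u ^+ 2; set V := enorm v ^+ 2; set d := dotp u v => h.
have -> : d = (4 * a * d) / (4 * a) by field; rewrite gt_eqF.
rewrite -[leRHS](mulfK (_ : 4 * a != 0)) ?gt_eqF ?mulr_gt0// ler_pM2r ?invr_gt0 ?mulr_gt0//.
have -> : (a * U + V / (4 * a)) * (4 * a) = 4 * a ^+ 2 * U + V by field; rewrite gt_eqF.
lra.
Qed.

Lemma sqr_enormD_young a u v : 0 < a ->
  enorm (u + v) ^+ 2 <= (1 + a) * enorm u ^+ 2 + (1 + a^-1) * enorm v ^+ 2.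
Proof.
move=> a0; rewrite sqr_enormD.
have := @dotp_young (a / 2) u v (divr_gt0 a0 (ltr0n _ 2)).
have -> : enorm v ^+ 2 / (4 * (a / 2)) = a^-1 * enorm v ^+ 2 / 2.
  by field; rewrite gt_eqF.
lra.
Qed.

(** Together with [enorm_le_mx_norm], this translates between Euclidean estimates and the topology,
    which is that of the sup norm. *)
Lemma mx_norm_le_enorm u : `|u| <= enorm u.
Proof.
rewrite [leLHS]mx_normrE; apply: bigmax_le; first exact: enorm_ge0.
by move=> [i j] _ /=; rewrite (ord1 i) coord_le_enorm.
Qed.

Lemma enorm_le_mx_norm u : enorm u <= Num.sqrt n%:R * `|u|.
Proof.
rewrite -(ler_pXn2r (n := 2))// ?nnegrE ?mulr_ge0 ?sqrtr_ge0 ?enorm_ge0//.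
rewrite exprMn (@sqr_sqrtr _ n%:R)// sqr_enormE.
apply: (@le_trans _ _ (\sum_(i < n) `|u| ^+ 2)); last first.
  by rewrite sumr_const card_ord mulr_natl.
apply: ler_sum => i _.
rewrite -[leLHS]real_normK ?num_real// ler_pXn2r ?nnegrE//.
rewrite [leRHS]mx_normrE.
exact: (@le_bigmax_cond _ _ _ 0 (0, i) predT (fun ij => `|u ij.1 ij.2|)).
Qed.

End euclidean_space.

(** * Projection onto a compact convex set or onto the whole space *)

Section projection.
Context {R : realType} {n : nat}.
Implicit Types (u v w p q z : 'rV[R]_n) (a : R) (C : set 'rV[R]_n).

Lemma near_enorm u (e : R) : 0 < e -> \forall v \near u, enorm (v - u) < e.
Proof.
move=> e0; pose c : R := Num.sqrt n%:R + 1.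
have c0 : 0 < c by rewrite ltr_wpDl ?sqrtr_ge0.
have d0 : 0 < c^-1 * e by rewrite mulr_gt0 ?invr_gt0.
have := nbhsx_ballx u _ d0; rewrite -ball_normE; apply: filterS => v /= uv.
apply: (le_lt_trans (enorm_le_mx_norm _)).
apply: (@le_lt_trans _ _ (c * `|v - u|)).
  by rewrite ler_wpM2r// lerDl.
by rewrite -ltr_pdivlMl// distrC.
Qed.

Lemma enorm_lipschitz_continuous (g : 'rV[R]_n -> R) a :
  (forall u v, `|g u - g v| <= a * enorm (u - v)) -> continuous g.
Proof.
move=> gl u; apply/(@cvgrPdist_lt _ _ _ (nbhs u)) => e e0.
have c0 : 0 < `|a| + 1 by rewrite ltr_wpDl.
have d0 : 0 < (`|a| + 1)^-1 * e by rewrite mulr_gt0 ?invr_gt0.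
near=> v; apply: (le_lt_trans (gl _ _)).
apply: (@le_lt_trans _ _ ((`|a| + 1) * enorm (u - v))).
  by rewrite ler_wpM2r ?enorm_ge0// (le_trans (ler_norm a))// lerDl.
by rewrite -ltr_pdivlMl// enormC; near: v; exact: near_enorm.
Unshelve. all: by end_near. Qed.

Lemma enorm_dist u v : `|enorm u - enorm v| <= enorm (u - v).
Proof.
have := enormD (u - v) v; have := enormD (v - u) u.
rewrite !subrK (enormC v u) ler_norml => h1 h2.
by apply/andP; split; lra.
Qed.

Lemma enorm_dist_continuous z : continuous (fun v => enorm (z - v)).
Proof.
apply: (@enorm_lipschitz_continuous _ 1) => u v.
by rewrite mul1r (le_trans (enorm_dist _ _))// opprB addrC addrA subrK enormC.
Qed.

Definition segment_closed C := forall x y (s : R), C x -> C y ->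
  0 <= s <= 1 -> C (x + s *: (y - x)).

Lemma convex_set_segment C : convex_set C -> segment_closed C.
Proof.
move=> cC x y s Cx Cy /andP[s0 s1].
have := cC y x (Itv01 s0 s1) (mem_set Cy) (mem_set Cx).
rewrite inE => h.
have -> : x + s *: (y - x) = s *: y + (1 - s) *: x; last exact: h.
by rewrite scalerBr scalerBl scale1r addrCA.
Qed.

Lemma compact_min_dist C z : C !=set0 -> compact C ->
  exists p, C p /\ forall q, C q -> enorm (z - p) <= enorm (z - q).
Proof.
move=> C0 cC; have [|p pC pmin] := EVT_min_rV C0 cC (f := fun q => enorm (z - q)).
  exact/continuous_subspaceT/enorm_dist_continuous.
by exists p; split=> [|q Cq]; [exact: set_mem | exact/pmin/mem_set].
Qed.

(** Treats the two alternatives for [Y] at once; [X] falls under the first. *)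
Definition projectable C := (compact C /\ convex_set C) \/ C = setT.

Section projectable_theory.
Context (C : set 'rV[R]_n) (C_proj : projectable C) (C_neq0 : C !=set0).

Lemma projectable_segment : segment_closed C.
Proof.
by case: C_proj => [[_ /convex_set_segment//]|->].
Qed.

Lemma eprojP z :
  C (eproj C z) /\ forall q, C q -> enorm (z - eproj C z) <= enorm (z - q).
Proof.
apply: (getPex (P := [set p | C p /\ forall q, C q ->
  enorm (z - p) <= enorm (z - q)])).
case: C_proj => [[cC _]|->]; first exact: compact_min_dist.
by exists z; split=> // q _; rewrite subrr enorm0 enorm_ge0.
Qed.

Lemma eproj_in z : C (eproj C z). Proof. by case: (eprojP z). Qed.

(** The obtuse angle criterion: were the product positive, a short move from the projection towards
    [q] would come strictly closer to [z]. *)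
Lemma eproj_variational z q : C q ->
  dotp (z - eproj C z) (q - eproj C z) <= 0.
Proof.
move=> Cq; have [Cp pmin] := eprojP z; set p := eproj C z in Cp pmin *.
rewrite leNgt; apply/negP => d0; set d := dotp _ _ in d0.
have [/enorm_eq0 qp0|qp0] := eqVneq (enorm (q - p)) 0.
  by move: d0; rewrite /d qp0 dotp0r ltxx.
have N0 : 0 < enorm (q - p) ^+ 2 by rewrite exprn_gt0// lt_def qp0 enorm_ge0.
(* With this [s] the quadratic cost s^2 |q - p|^2 is at most s d, while the linear gain is 2 s d. *)
pose s := Num.min 1 (d / enorm (q - p) ^+ 2).
have s0 : 0 < s by rewrite lt_min ltr01 divr_gt0.
have s1 : s <= 1 by rewrite ge_min lexx.
have sd : s * enorm (q - p) ^+ 2 <= d.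
  by rewrite -ler_pdivlMr// ge_min lexx orbT.
have Cs : C (p + s *: (q - p)).
  by apply: projectable_segment; rewrite // (ltW s0).
have := pmin _ Cs; rewrite -(ler_pXn2r (n := 2)) ?nnegrE ?enorm_ge0//.
rewrite opprD addrA (sqr_enormB (z - p)) dotpZr -/d enormZ gtr0_norm// exprMn.
suff : s * (s * enorm (q - p) ^+ 2) < s * (2 * d) by lra.
by rewrite ltr_pM2l//; lra.
Qed.

(** Sum of two obtuse angle criteria, each projection being tested against the other. *)
Lemma eproj_firmly_nonexpansive z z' :
  enorm (eproj C z - eproj C z') ^+ 2 <= dotp (z - z') (eproj C z - eproj C z').
Proof.
have E p p' : enorm (p - p') ^+ 2 =
    dotp (z - z') (p - p') + (dotp (z - p) (p' - p) + dotp (z' - p') (p - p')).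
  by rewrite sqr_enorm !(dotpBl, dotpBr); ring.
rewrite E gerDl -[leRHS]addr0.
exact: lerD (eproj_variational z (eproj_in z')) (eproj_variational z' (eproj_in z)).
Qed.

Lemma eproj_nonexpansive z z' :
  enorm (eproj C z - eproj C z') <= enorm (z - z').
Proof.
have h := eproj_firmly_nonexpansive z z'.
set d := eproj C z - eproj C z' in h *.
have [->|d0] := eqVneq (enorm d) 0; first exact: enorm_ge0.
have d_gt0 : 0 < enorm d by rewrite lt_def d0 enorm_ge0.
by rewrite -(ler_pM2r d_gt0) -expr2 (le_trans h)// dotp_le.
Qed.

Lemma eproj_id z : C z -> eproj C z = z.
Proof.
move=> Cz; have [_ /(_ _ Cz)] := eprojP z; rewrite subrr enorm0 => h.
by apply/esym/subr0_eq/enorm_eq0/eqP; rewrite eq_le h enorm_ge0.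
Qed.

(** By firm nonexpansiveness the projection ignores whatever is orthogonal to all differences of
    points of [C]. These are exactly the components in which a gradient relative to the set is
    undetermined. *)
Lemma eproj_dotp_eq z z' :
  (forall q q', C q -> C q' -> dotp (z - z') (q - q') = 0) ->
  eproj C z = eproj C z'.
Proof.
move=> zz; have := eproj_firmly_nonexpansive z z'.
rewrite (zz _ _ (eproj_in z) (eproj_in z')) => h.
by apply/subr0_eq/enorm_eq0/eqP; rewrite -(sqrf_eq0 (enorm _)) eq_le sqr_ge0 andbT.
Qed.

End projectable_theory.
End projection.

(** * Mean value inequality for functions differentiable at every point *)

Section mean_value_inequality.
Context {R : realType}.

(** Continuous induction: the supremum of the points reached from [a] is itself reached, by the left
    half of the local hypothesis, and cannot lie below [b], by the right half. *)
Lemma real_induction (Q : R -> R -> Prop) (a b : R) : a <= b ->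
  (forall r s t, Q r s -> Q s t -> Q r t) ->
  (forall s, a <= s <= b -> exists2 d, 0 < d & forall r, a <= r <= b ->
    (s - d < r <= s -> Q r s) /\ (s <= r < s + d -> Q s r)) ->
  Q a b.
Proof.
move=> ab Qtrans Qloc.
pose S := [set s | a <= s <= b /\ Q a s].
have Sa : S a.
  have [|d d0 /(_ a)] := Qloc a; first by rewrite lexx.
  rewrite lexx ab => /(_ isT)[_]; rewrite ltrDl d0 => /(_ isT) Qaa.
  by split=> //; rewrite lexx.
have Sub : ubound S b by move=> s [/andP[]].
have supS : has_sup S by split; [exists a | exists b].
pose c := sup S.
have ac : a <= c by exact: (sup_upper_bound supS).
have cb : c <= b by exact: (ge_sup supS.1).
have [|d d0 Qd] := Qloc c; first by rewrite ac cb.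
have Qac : Q a c.
  have [s [/andP[as_ sb] Qas] cs] := sup_adherent d0 supS.
  apply: (Qtrans _ s) => //; apply: (Qd s _).1; first by rewrite as_ sb.
  by rewrite cs/=; apply: (sup_upper_bound supS); split=> //; rewrite as_ sb.
move: cb; rewrite le_eqVlt => /predU1P[<- //|cb].
pose s := Num.min b (c + d / 2).
have cs : c < s by rewrite lt_min cb ltrDl divr_gt0.
have sb : s <= b by rewrite ge_min lexx.
have as_ : a <= s by rewrite (le_trans ac)// ltW.
suff : S s by move=> /(sup_upper_bound supS); rewrite leNgt cs.
split; first by rewrite as_ sb.
apply: (Qtrans _ c) => //; apply: (Qd s _).2; first by rewrite as_ sb.
by rewrite (ltW cs)/= gt_min ltrD2l ltr_pdivrMr// ltr_pMr// ltr1n orbT.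
Qed.

Lemma is_derive_increment (g : R -> R) (s l e : R) : is_derive s 1 g l ->
  0 < e -> exists2 d, 0 < d & forall r, `|r - s| < d ->
    `|g r - g s - l * (r - s)| <= e * `|r - s|.
Proof.
move=> [dg gl] e0.
move: dg; rewrite /derivable cvg_ex => -[l' gl'].
have ll' : l' = l by rewrite -gl; apply/esym/cvg_lim.
rewrite ll' in gl'; clear l' ll'.
have /cvgrPdist_le/(_ _ e0) := gl'.
rewrite near_withinE => /nbhs_normP[d /= d0 gd].
exists d => // r rs; have [->|rs0] := eqVneq r s.
  by rewrite !subrr mulr0 subr0 normr0 mulr0.
have h0 : r - s != 0 by rewrite subr_eq0.
have /= := gd (r - s); rewrite sub0r normrN => /(_ rs h0).
rewrite scaler1 /shift/= subrK => gle.
have -> : g r - g s - l * (r - s)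
    = - (r - s) * (l - (r - s)^-1 * (g r - g s)) by field.
by rewrite normrM normrN mulrC ler_wpM2r.
Qed.

End mean_value_inequality.

Section mean_value_inequality_integral.
Context {R : realType}.
Local Notation mu := (@lebesgue_measure R).

Section level_sets.
Variables (phi : R -> R) (a b e : R).
Hypotheses (ab : a <= b) (e0 : 0 < e) (phi0 : forall s, 0 <= phi s).
Hypothesis mphi : measurable_fun `[a, b] phi.

Let E (k : nat) := `[a, b] `&` phi @^-1` `[k%:R * e, k.+1%:R * e[.

Let mE k : measurable (E k).
Proof. by apply: mphi. Qed.

Let muE k : (mu (E k) < +oo)%E.
Proof.
apply: (@le_lt_trans _ _ (mu `[a, b])).
  by apply: le_measure; rewrite ?inE; [exact: mE|exact: measurable_itv|move=> s []].
by rewrite lebesgue_measure_itv/=; case: ifPn => _; rewrite ltry.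
Qed.

Let tE : trivIset setT E.
Proof.
apply/trivIsetP => i j _ _ ij; rewrite -subset0 => s [[_ /=]].
rewrite in_itv/= => /andP[i1 i2] [_ /=]; rewrite in_itv/= => /andP[j1 j2].
have := le_lt_trans i1 j2; have := le_lt_trans j1 i2.
rewrite !ltr_pM2r// !ltr_nat !ltnS => ji ij'.
by move: ij; rewrite eqn_leq ji ij'.
Qed.

Let bigcupE : \bigcup_k E k = `[a, b]%classic.
Proof.
apply/seteqP; split=> [s [k _ []]//|s sab].
exists (Num.trunc (phi s / e)) => //; split=> //=.
have /truncn_itv : 0 <= phi s / e by rewrite divr_ge0// ltW.
by rewrite ler_pdivlMr// ltr_pdivrMr// in_itv.
Qed.

(** A form of the Vitali-Caratheodory theorem. Each slice [E k], where phi lies between k e and (k +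
    1) e, is covered by an open [V k] of hardly larger measure, which receives the weight (k + 1) e.
    Openness makes the sum of the weights dominate phi(s) on a whole neighbourhood of each [s], and
    thin slices keep its integral close to that of [phi]. *)
Lemma open_majorant : exists u : R -> \bar R,
  [/\ measurable_fun [set: R] u, (forall s, 0 <= u s)%E,
   (forall s, a <= s <= b -> exists2 d, 0 < d &
      forall r, `|r - s| < d -> ((phi s + e)%:E <= u r)%E) &
   (\int[mu]_(s in `[a, b]) u s <=
      \int[mu]_(s in `[a, b]) (phi s)%:E + (e * (2 * (b - a) + 1))%:E)%E].
Proof.
have c0 k : 0 < k.+1%:R * e by rewrite mulr_gt0.
have ce k : 0 < e / (2 ^ k.+1)%:R / (k.+1%:R * e) :> R.
  by rewrite !divr_gt0// ltr0n expn_gt0.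
(* The excess measure allowed is e / 2^(k+1) divided by the weight of [V k], so all excesses
   together cost at most e. *)
have /choice[V HV] : forall k, exists V : set R,
    [/\ open V, E k `<=` V & (mu (V `\` E k) < (e / (2 ^ k.+1)%:R / (k.+1%:R * e))%:E)%E].
  by move=> k; apply: lebesgue_regularity_outer; [exact: mE|exact: muE|exact: ce].
have mV k : measurable (V k) by apply: open_measurable; case: (HV k).
have m1V k : measurable_fun [set: R] (fun s : R => (\1_(V k) s : R)%:E).
  by apply/measurable_EFinP; exact: measurable_indic.
pose w k s := ((k.+1%:R * e) * \1_(V k) s)%:E : \bar R.
have w0 k s : (0 <= w k s)%E by rewrite lee_fin mulr_ge0// ltW.
have mw k : measurable_fun setT (w k).
  by apply/measurable_EFinP; apply: measurable_funM => //; exact: measurable_indic.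
have msw : measurable_fun setT (fun s => \sum_(k <oo) w k s)%E.
  by apply: ge0_emeasurable_sum.
have sw0 s : (0 <= \sum_(k <oo) w k s)%E by exact: nneseries_ge0.
exists (fun s => \sum_(k <oo) w k s + e%:E)%E; split.
- exact: emeasurable_funD.
- by move=> s; rewrite adde_ge0// lee_fin ltW.
- move=> s sab; have : (\bigcup_k E k) s by rewrite bigcupE/= in_itv.
  move=> [k _ Es]; have [oV /(_ _ Es) Os _] := HV k.
  have /nbhs_normP[d /= d0 dV] := open_nbhs_nbhs (conj oV Os).
  exists d => // r rs; rewrite EFinD leeD2r//.
  have Or : V k r by apply: dV; rewrite /= distrC.
  rewrite (@nneseriesD1 _ (w^~ r) k)//.
  apply: (@le_trans _ _ (w k r)); last by rewrite leeDl// nneseries_ge0.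
  rewrite /w indicE mem_set//= mulr1 lee_fin.
  by case: Es => _ /=; rewrite in_itv/= => /andP[_ /ltW].
rewrite ge0_integralD//=; last 2 first.
- exact: measurable_funTS.
- by move=> s _; rewrite lee_fin ltW.
rewrite integral_cst//= lebesgue_measure_itv/=.
rewrite integral_nneseries//; last first.
  by move=> k; apply: measurable_funS (mw k).
have -> : (e%:E * (if (a%:E < b%:E)%E then b%:E - a%:E else 0) = (e * (b - a))%:E)%E.
  case: ifPn => [_|]; first by rewrite -EFinB -EFinM.
  rewrite lte_fin -leNgt => ba; have -> : b = a by apply/eqP; rewrite eq_le ab ba.
  by rewrite subrr mulr0 mule0.
(* Three sources of error: rounding [phi] up within its slice, the excess of the open covers, and
   the constant e added everywhere. *)
have -> : e * (2 * (b - a) + 1) = e * (b - a) + e + e * (b - a) by ring.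
rewrite !EFinD addeA leeD2r// addeA.
have -> : (\int[mu]_(s in `[a, b]) (phi s)%:E + (e * (b - a))%:E =
    \sum_(k <oo) \int[mu]_(s in E k) (phi s + e)%:E)%E.
  rewrite -ge0_integral_bigcup//; last 2 first.
  - rewrite bigcupE; apply/measurable_EFinP; exact: measurable_funD.
  - by move=> s _; rewrite lee_fin addr_ge0// ltW.
  rewrite bigcupE; under [RHS]eq_integral do rewrite EFinD.
  rewrite ge0_integralD//=; last 3 first.
  - by move=> s _; rewrite lee_fin.
  - by apply/measurable_EFinP.
  - by move=> s _; rewrite lee_fin ltW.
  congr (_ + _)%E; rewrite integral_cst//= lebesgue_measure_itv/=.
  case: ifPn => [_|]; first by rewrite -EFinB -EFinM.
  rewrite lte_fin -leNgt => ba; have -> : b = a by apply/eqP; rewrite eq_le ab ba.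
  by rewrite subrr mulr0 mule0.
apply: le_trans (epsilon_trick _ _ _) => //; last 2 first.
- by move=> k; apply: integral_ge0 => s _; rewrite lee_fin addr_ge0// ltW.
- exact: ltW.
have iw0 k : (0 <= \int[mu]_(s in `[a, b]) w k s)%E by apply: integral_ge0.
apply: lee_nneseries => k; first by move=> _ _; exact: iw0.
move=> _; have [oV EV muV] := HV k.
apply: (@le_trans _ _ ((k.+1%:R * e)%:E * mu (V k))%E).
  rewrite /w; under eq_integral do rewrite EFinM.
  rewrite ge0_integralZl_EFin//; last 2 first.
  - by apply: measurable_funS (m1V k).
  - exact: ltW.
  rewrite integral_indic; [|exact: measurable_itv|exact: mV].
  apply: lee_wpmul2l; first by rewrite lee_fin ltW.
  by apply: measureIl; [exact: mV|exact: measurable_itv].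
have -> : V k = E k `|` (V k `\` E k) by rewrite setDUK.
rewrite measureU; [|exact: mE|by apply: measurableD; [exact: mV|exact: mE]|by rewrite setDIK].
rewrite ge0_muleDr//; apply: leeD.
  rewrite -integral_cst; last exact: mE.
  apply: ge0_le_integral => //=.
  - exact: mE.
  - by move=> s _; rewrite lee_fin ltW.
  - apply/measurable_EFinP; apply: measurable_funD => //.
    by apply: measurable_funS mphi => // s [].
  - move=> s [_ /=]; rewrite in_itv/= lee_fin => /andP[h _].
    by rewrite -natr1 mulrDl mul1r lerD2r.
rewrite -lee_pdivlMl//.
apply: (le_trans (ltW muV)); rewrite -EFinM lee_fin mulrC//.
Qed.

End level_sets.

(** The derivative exists everywhere but may fail to be integrable, so the fundamental theorem of
    calculus does not apply. Near each [s] the increments of [g] from [s] are at most (|g'(s)| + e1)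
    times the length, hence at most the integral of the majorant from [open_majorant];
    [real_induction] chains these local bounds. *)
Lemma le_integral_derive (g g' : R -> R) (a b : R) : a <= b ->
  (forall s, a <= s <= b -> is_derive s 1 g (g' s)) ->
  measurable_fun `[a, b] g' ->
  (`|g b - g a|%:E <= \int[mu]_(s in `[a, b]) `|g' s|%:E)%E.
Proof.
move=> ab dg mg'; apply/lee_addgt0Pr => e e0.
pose e1 := e / (2 * (b - a) + 1).
have D0 : 0 < 2 * (b - a) + 1 by rewrite ltr_wpDl// mulr_ge0// subr_ge0.
have e10 : 0 < e1 by rewrite divr_gt0.
have mng' : measurable_fun `[a, b] (fun s => `|g' s|) by exact: measurableT_comp.
have [//|u [mu_ u0 uloc uint]] := open_majorant ab e10 _ mng'.
have -> : e = e1 * (2 * (b - a) + 1) by rewrite /e1 divfK// gt_eqF.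
apply: le_trans uint.
apply: (@le_trans _ _ (\int[mu]_(s in `]a, b]) u s)%E); last first.
  apply: ge0_subset_integral => //; first exact: measurable_funTS.
  by apply: subset_itvr; rewrite bnd_simp.
have itv r t c : r <= t -> 0 <= c -> (forall s, r < s <= t -> (c%:E <= u s)%E) ->
    ((c * (t - r))%:E <= \int[mu]_(s in `]r, t]) u s)%E.
  move=> rt c0 cu.
  apply: (@le_trans _ _ (\int[mu]_(s in `]r, t]) (cst c%:E s))%E).
    rewrite integral_cst//= lebesgue_measure_itv/= lte_fin; case: ltgtP rt => //.
    by move=> -> _; rewrite subrr mulr0 mule0.
  by apply: ge0_le_integral => //=; exact: measurable_funTS.
(* Half-open intervals let the integrals over adjacent pieces add up, which is the transitivity
   required of [Q]. *)
pose Q r t := r <= t /\ (`|g t - g r|%:E <= \int[mu]_(s in `]r, t]) u s)%E.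
suff [] : Q a b by [].
apply: real_induction => // [r s t [rs Qrs] [st Qst]|s sab].
  split; first exact: le_trans st.
  rewrite (@itv_bndbnd_setU _ _ _ (BRight s))//.
  rewrite ge0_integral_setU//=.
  - have -> : g t - g r = (g s - g r) + (g t - g s) by ring.
    apply: (@le_trans _ _ (`|g s - g r| + `|g t - g s|)%:E).
      by rewrite lee_fin ler_normD.
    by rewrite EFinD leeD.
  - exact: measurable_funTS.
  - apply/disj_setPS => x [] /=; rewrite !in_itv/= => /andP[_ xs] /andP[sx _].
    by rewrite ltNge xs in sx.
have [d1 d10 gd1] := is_derive_increment (dg s sab) e10.
have [d2 d20 ud2] := uloc s sab.
exists (Num.min d1 d2) => [|r rab]; first by rewrite lt_min d10.
have key : `|r - s| < Num.min d1 d2 -> `|g r - g s| <= (`|g' s| + e1) * `|r - s|.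
  rewrite lt_min => /andP[/gd1 rs _].
  have := ler_normD (g r - g s - g' s * (r - s)) (g' s * (r - s)).
  by rewrite subrK normrM => /le_trans; apply; rewrite mulrDl addrC lerD2l.
split=> /andP[h1 h2]; split=> //.
  have rs : `|r - s| < Num.min d1 d2 by rewrite distrC ger0_norm ?subr_ge0//; lra.
  apply: (@le_trans _ _ ((`|g' s| + e1) * (s - r))%:E).
    by rewrite lee_fin distrC (le_trans (key rs))// distrC (@ger0_norm _ (s - r)) ?subr_ge0.
  apply: itv => //; first by rewrite addr_ge0// ltW.
  move=> x /andP[rx xs]; apply: ud2; rewrite distrC ger0_norm ?subr_ge0//.
  apply: (@lt_le_trans _ _ (Num.min d1 d2)); last by rewrite ge_min lexx orbT.
  lra.
have rs : `|r - s| < Num.min d1 d2 by rewrite ger0_norm ?subr_ge0//; lra.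
apply: (@le_trans _ _ ((`|g' s| + e1) * (r - s))%:E).
  by rewrite lee_fin (le_trans (key rs))// (@ger0_norm _ (r - s)) ?subr_ge0.
apply: itv => //; first by rewrite addr_ge0// ltW.
move=> x /andP[rx xs]; apply: ud2; rewrite ger0_norm ?subr_ge0 ?(ltW rx)//.
apply: (@lt_le_trans _ _ (Num.min d1 d2)); last by rewrite ge_min lexx orbT.
lra.
Qed.

End mean_value_inequality_integral.

(** * Measurability of a function evaluated at a random point *)

Section caratheodory.
Context {d} {S : measurableType d} {R : realType}.

Lemma measurable_fun_countable_index (I : countType) (q : S -> I)
    (H : I -> S -> R) :
  (forall i, measurable (q @^-1` [set i])) ->
  (forall i, measurable_fun setT (H i)) ->
  measurable_fun setT (fun s => H (q s) s).
Proof.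
move=> mq mH _ Y mY; rewrite setTI.
rewrite (_ : _ @^-1` _ = \bigcup_n (if @unpickle I n is Some i then
    q @^-1` [set i] `&` H i @^-1` Y else set0)).
  apply: bigcup_measurable => n _; case: unpickle => [i|//].
  by apply: measurableI => //; rewrite -[X in measurable X]setTI; exact: mH.
apply/seteqP; split => [s Ys|s [n _]].
  by exists (pickle (q s)) => //; rewrite pickleK.
by case: unpickle => [i [/= ->]|//].
Qed.

(** Round [Z] down to the grid of mesh 1 / (m + 1). On each of the countably many cells the rounded
    function is [h] at a fixed point, hence measurable, and the rounded values converge. Continuity
    is only asked at [Z s], along sequences converging coordinatewise. *)
Lemma measurable_caratheodory n (Z : S -> 'rV[R]_n) (h : S -> 'rV[R]_n -> R) :
  (forall i, measurable_fun setT (fun s => Z s 0 i)) ->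
  (forall u, measurable_fun setT (h^~ u)) ->
  (forall s (w : nat -> 'rV[R]_n),
     (forall i, (fun m => w m 0 i) @ \oo --> Z s 0 i) ->
     (fun m => h s (w m)) @ \oo --> h s (Z s)) ->
  measurable_fun setT (fun s => h s (Z s)).
Proof.
move=> mZ mh ch.
pose q m s : {ffun 'I_n -> int} := [ffun i => Num.floor (m.+1%:R * Z s 0 i)].
pose pt m (c : {ffun 'I_n -> int}) : 'rV[R]_n := \row_i ((c i)%:~R / m.+1%:R).
apply: (@measurable_fun_cvg _ _ _ _ (fun m s => h s (pt m (q m s)))).
  move=> m; apply: (@measurable_fun_countable_index _ (q m) (fun c s => h s (pt m c))).
    move=> c; rewrite (_ : _ @^-1` _ = \bigcap_(i in [set: 'I_n])
        ((fun s => m.+1%:R * Z s 0 i) @^-1` `[(c i)%:~R, (c i + 1)%:~R[%classic)).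
      apply: fin_bigcap_measurable => // i _.
      rewrite -[X in measurable X]setTI.
      by apply: (measurable_funM (measurable_cst _) (mZ i)) => //; exact: measurable_itv.
    apply/seteqP; split => [s /= <- i _|s cs].
      by rewrite /= ffunE in_itv/= floor_itv.
    apply/ffunP => i; rewrite ffunE; apply: floor_def.
    by have := cs i I; rewrite /= in_itv.
  by move=> c; exact: mh.
move=> s _; apply: ch => i.
have -> : (fun m => pt m (q m s) 0 i)
    = (fun m => (Num.floor (m.+1%:R * Z s 0 i))%:~R / m.+1%:R).
  by apply/funext => m; rewrite mxE ffunE.
apply: (@squeeze_cvgr _ _ _ _ (fun m => Z s 0 i - m.+1%:R^-1) (fun=> Z s 0 i)).
- apply: nearW => m; have /andP[] := floor_itv (m.+1%:R * Z s 0 i).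
  have m0 : 0 < m.+1%:R :> R by [].
  rewrite ler_pdivrMr// ler_pdivlMr// mulrBl mulVf ?gt_eqF// intrD.
  rewrite [Z s 0 i * _]mulrC => -> /ltW h1; rewrite andbT lerBlDr//.
- rewrite -[X in _ --> X]subr0; apply: cvgB; first exact: cvg_cst.
  exact: cvg_harmonic.
- exact: cvg_cst.
Qed.

End caratheodory.

(** * Derivative of a vanishing expectation, from second moments only *)

Lemma absr_le_sqr {R : realFieldType} (K x : R) : 0 < K ->
  `|x| <= K + x ^+ 2 / K.
Proof.
move=> K0; rewrite -[x ^+ 2]real_normK ?num_real//.
rewrite -(ler_pM2r K0) mulrDl divfK ?gt_eqF//.
by have := sqr_ge0 (`|x| - K); have := normr_ge0 x; nra.
Qed.

Lemma integrable_square_le {d} {T : measurableType d} {R : realType}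
    (P : probability T R) (h : T -> R) (C : R) :
  measurable_fun setT h -> (\int[P]_z ((h z) ^+ 2)%:E <= C%:E)%E ->
  P.-integrable setT (EFin \o h).
Proof.
move=> mh hC; apply/integrableP; split; first exact/measurable_EFinP.
apply: (@le_lt_trans _ _ (\int[P]_z (1 + (h z) ^+ 2)%:E)%E).
  apply: ge0_le_integral => //=.
  - by apply/measurable_EFinP; exact: measurableT_comp.
  - apply/measurable_EFinP; apply: measurable_funD => //.
    exact: measurable_funX.
  - move=> z _; rewrite lee_fin; have := absr_le_sqr (h z) ltr01.
    by rewrite divr1.
under eq_integral do rewrite EFinD.
rewrite ge0_integralD//=; last 2 first.
- by move=> z _; rewrite lee_fin sqr_ge0.
- by apply/measurable_EFinP; exact: measurable_funX.
rewrite integral_cst//= probability_setT mule1.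
by rewrite (@le_lt_trans _ _ (1 + C%:E)%E) ?leeD2l// -EFinD ltry.
Qed.

Section mean_zero_derivative.
Context {d} {Xi : measurableType d} {R : realType} (D : probability Xi R).
Variables (g g' : Xi -> R -> R) (a C : R).
Hypothesis a0 : 0 < a.
Hypothesis ig : forall s : R, 0 <= s <= a -> D.-integrable setT (fun z => (g z s)%:E).
Hypothesis g0 : forall s : R, 0 <= s <= a -> \int[D]_z g z s = 0.
Hypothesis dg : forall z (s : R), 0 <= s <= a -> is_derive s 1 (g z) (g' z s).
Hypothesis g'C : forall s : R, 0 <= s <= a ->
  (\int[D]_z ((g' z s) ^+ 2)%:E <= C%:E)%E.
Local Notation mu := (@lebesgue_measure R).

(** Retraction of the line onto [0, b]. It extends functions controlled on an interval to the whole
    line, so that joint measurability and Tonelli's theorem can be used on the full product. *)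
Let clamp (b s : R) : R := Num.max 0 (Num.min b s).

Let clamp_itv (b s : R) : 0 <= b -> 0 <= clamp b s <= b.
Proof. by move=> b0; rewrite /clamp le_max lexx/= ge_max b0 ge_min lexx. Qed.

Let clamp_id (b s : R) : 0 <= s <= b -> clamp b s = s.
Proof. by move=> /andP[s0 sb]; rewrite /clamp (min_idPr sb) (max_idPr s0). Qed.

Let clamp_lip b s t : `|clamp b s - clamp b t| <= `|s - t|.
Proof.
rewrite /clamp !maxEle !minEle.
by repeat case: ifPn; rewrite -?ltNge => *; rewrite ler_norml; apply/andP; split;
  case: (lerP t s) => ?; rewrite ?(@ger0_norm _ (s - t)) ?(@ltr0_norm _ (s - t)) ?subr_ge0 ?subr_lt0//; lra.
Qed.

Let mclamp b : measurable_fun [set: R] (clamp b).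
Proof. by apply: measurable_maxr => //; apply: measurable_minr. Qed.

Let mgc : measurable_fun setT (fun p : Xi * R => g p.1 (clamp a p.2)).
Proof.
rewrite (_ : (fun p : Xi * R => _) = (fun p : Xi * R =>
    g p.1 (clamp a ((\row_(_ < 1) p.2 : 'rV[R]_1) 0 0)))); last first.
  by apply/funext => p; rewrite mxE.
apply: (@measurable_caratheodory _ (Xi * R)%type R 1
  (fun p => \row_(_ < 1) p.2) (fun p v => g p.1 (clamp a (v 0 0)))).
- by move=> i; under eq_fun do rewrite mxE; exact: measurable_snd.
- move=> u; apply: (@measurableT_comp _ _ _ _ _ _ (fun z => g z (clamp a (u 0 0)))) => //.
  by have /integrableP[/measurable_EFinP] := ig (clamp_itv (u 0 0) (ltW a0)).
- move=> [z s] w /(_ 0); rewrite !mxE/= => ws.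
  have cl := clamp_itv s (ltW a0).
  have : {for clamp a s, continuous (g z)}.
    have [dgs _] := dg z cl.
    by apply: differentiable_continuous; apply/derivable1_diffP.
  move=> gcont; apply: (cvg_comp (fun m => clamp a (w m 0 0)) (g z)) gcont.
  apply/cvgrPdist_lt => e e0; have /cvgrPdist_lt/(_ _ e0) := ws.
  by apply: filterS => m; apply: le_lt_trans; exact: clamp_lip.
Qed.

(** Half of the interval: difference quotients at points of [0, b] with increments [c n] at most b
    stay inside [0, a]. *)
Let b : R := a / 2.
Let b0 : 0 < b. Proof. by rewrite divr_gt0. Qed.
Let c (n : nat) : R := b / n.+1%:R.
Let c0 n : 0 < c n. Proof. by rewrite divr_gt0. Qed.
Let cb n : c n <= b.
Proof. by rewrite ler_pdivrMr// ler_peMr ?ler1n// ltW. Qed.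
Let cvg_c : c @ \oo --> 0.
Proof.
by rewrite -(mulr0 b); apply: cvgM; [exact: cvg_cst|exact: cvg_harmonic].
Qed.

Let quotient_cvg z (s : R) : 0 <= s <= b ->
  (fun n => (c n)^-1 * (g z (s + c n) - g z s)) @ \oo --> g' z s.
Proof.
move=> /andP[s0 sb]; apply/cvgrPdist_le => e e0.
have [|r r0 gr] := is_derive_increment (dg z (s := s) _) e0.
  by rewrite s0 (le_trans sb)// ler_pdivrMr// ler_pMr// ler1n.
have /cvgrPdist_lt/(_ _ r0) := cvg_c; apply: filterS => n.
rewrite sub0r normrN => cnr; have := gr (s + c n); rewrite addrAC subrr add0r.
move=> /(_ cnr) h.
have -> : g' z s - (c n)^-1 * (g z (s + c n) - g z s) =
    - ((c n)^-1 * (g z (s + c n) - g z s - g' z s * c n)).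
  by field; rewrite gt_eqF.
rewrite normrN normrM gtr0_norm ?invr_gt0// ler_pdivrMl//.
by move: h; rewrite (gtr0_norm (c0 n)) (mulrC (c n) e).
Qed.

Let G z s := g' z (clamp b s).

Let mG : measurable_fun setT (fun p : Xi * R => G p.1 p.2).
Proof.
apply: (@measurable_fun_cvg _ _ _ _
  (fun n p => (c n)^-1 * (g p.1 (clamp b p.2 + c n) - g p.1 (clamp b p.2)))); last first.
  by move=> [z s] _; apply: quotient_cvg; exact: clamp_itv (ltW b0).
move=> n; apply: measurable_funM => //.
have mb : measurable_fun setT (fun p : Xi * R => clamp b p.2).
  by apply: measurableT_comp.
have aE : a = b + b by rewrite /b; field.
have inE1 s : 0 <= clamp b s + c n <= a.
  have /andP[h1 h2] := clamp_itv s (ltW b0).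
  by rewrite addr_ge0 ?(ltW (c0 n))//= aE lerD.
have inE2 s : 0 <= clamp b s <= a.
  have /andP[h1 h2] := clamp_itv s (ltW b0).
  by rewrite h1/= aE (le_trans h2)// lerDl ltW.
apply: measurable_funB.
  rewrite (_ : (fun p : Xi * R => g p.1 (clamp b p.2 + c n)) =
      (fun p : Xi * R => g p.1 (clamp a p.2)) \o (fun p => (p.1, clamp b p.2 + c n))).
    apply: measurableT_comp => //; apply: measurable_fun_pair => //.
    exact: measurable_funD.
  by apply/funext => p /=; rewrite (clamp_id (inE1 p.2)).
rewrite (_ : (fun p : Xi * R => g p.1 (clamp b p.2)) =
    (fun p : Xi * R => g p.1 (clamp a p.2)) \o (fun p => (p.1, clamp b p.2))).
  by apply: measurableT_comp => //; exact: measurable_fun_pair.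
by apply/funext => p /=; rewrite (clamp_id (inE2 p.2)).
Qed.

Let mGz z : measurable_fun [set: R] (G z).
Proof. exact: (measurableT_comp mG (measurable_pair1 z)). Qed.

Let mG2 z : measurable_fun [set: R] (fun s => (G z s ^+ 2)%:E).
Proof. by apply/measurable_EFinP; exact: measurable_funX. Qed.

Let mG2K (K : R) z : measurable_fun [set: R] (fun s => (G z s ^+ 2 / K)%:E).
Proof.
by apply/measurable_EFinP; apply: measurable_funM => //; exact: measurable_funX.
Qed.

Let q n z := (c n)^-1 * (g z (c n) - g z 0).
(** The average of the squared derivative over [0, c n], divided by K. By Tonelli's theorem its mean
    is at most C / K, uniformly in n. *)
Let psi K n z : \bar R :=
  ((c n)^-1 / K)%:E * \int[mu]_(s in `[0%R, c n]) ((G z s) ^+ 2)%:E.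

(** The mean value inequality bounds the quotient by the average of |G|, and |G| is at most K + G^2
    / K. *)
Let quotient_le K n z : 0 < K -> (`|q n z|%:E <= K%:E + psi K n z)%E.
Proof.
move=> K0; have := @le_integral_derive R (g z) (g' z) 0 (c n) (ltW (c0 n)).
have aE : a = b + b by rewrite /b; field.
have cn := cb n.
move=> h; have {h} : (`|g z (c n) - g z 0|%:E <=
    \int[mu]_(s in `[0%R, c n]) `|G z s|%:E)%E.
  apply: le_trans (h _ _) _.
  - by move=> s /andP[s1 s2]; apply: dg; rewrite s1/= aE (le_trans s2)// (le_trans cn)// lerDl ltW.
  - apply: eq_measurable_fun (measurable_funTS (mGz z)) => s.
    by rewrite inE/= in_itv/= => /andP[s1 s2]; rewrite /G clamp_id// s1 (le_trans s2).
  - rewrite le_eqVlt; apply/predU1P; left; apply: eq_integral => s; rewrite inE/= in_itv/= => /andP[s1 s2].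
    by rewrite /G clamp_id// s1 (le_trans s2).
move=> h; rewrite /q normrM gtr0_norm ?invr_gt0// EFinM lee_pdivrMl//.
apply: (le_trans h).
apply: (@le_trans _ _ (\int[mu]_(s in `[0%R, c n]) (K + G z s ^+ 2 / K)%:E)%E).
  apply: ge0_le_integral => //=.
  - apply: (@measurable_funS _ _ _ _ [set: R]) => //.
    by apply/measurable_EFinP; exact: measurableT_comp.
  - apply: (@measurable_funS _ _ _ _ [set: R]) => //.
    apply/measurable_EFinP; apply: measurable_funD => //.
    by apply/measurable_EFinP; exact: mG2K.
  - by move=> s _; rewrite lee_fin; exact: absr_le_sqr.
under eq_integral do rewrite EFinD.
rewrite ge0_integralD//=; last 3 first.
- by move=> s _; rewrite lee_fin ltW.
- by move=> s _; rewrite lee_fin divr_ge0 ?sqr_ge0// ltW.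
- by apply: measurable_funS (mG2K K z).
rewrite integral_cst//= lebesgue_measure_itv/= lte_fin c0 oppr0 adde0.
rewrite ge0_muleDr; last 2 first.
- by rewrite lee_fin ltW.
- by rewrite mule_ge0 ?lee_fin ?divr_ge0 ?invr_ge0 ?(ltW (c0 n)) ?(ltW K0)//;
    apply: integral_ge0 => s _; rewrite lee_fin sqr_ge0.
rewrite muleC; apply: leeD => //.
rewrite /psi muleA -EFinM mulrA divff ?gt_eqF// mul1r.
rewrite -ge0_integralZl_EFin//.
- by rewrite le_eqVlt; apply/predU1P; left; apply: eq_integral => s _; rewrite -EFinM mulrC.
- by move=> s _; rewrite lee_fin sqr_ge0.
- by apply: measurable_funS (mG2 z).
- by rewrite invr_ge0 ltW.
Qed.

Let phi n (p : Xi * R) := ((G p.1 p.2) ^+ 2 * \1_(`[0, c n]) p.2)%:E.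

Let phi0 n p : (0 <= phi n p)%E.
Proof. by rewrite lee_fin mulr_ge0// sqr_ge0. Qed.

Let mphi n : measurable_fun setT (phi n).
Proof.
apply/measurable_EFinP; apply: measurable_funM; first exact: measurable_funX.
have m1 : measurable_fun [set: R] (\1_(`[0, c n]) : R -> R).
  by apply: measurable_indic; exact: measurable_itv.
exact: (measurableT_comp m1).
Qed.

Let phiE n z : (\int[mu]_s phi n (z, s) =
  \int[mu]_(s in `[0%R, c n]) ((G z s) ^+ 2)%:E)%E.
Proof.
rewrite [RHS]integral_mkcond; apply: eq_integral => s _.
by rewrite /phi /patch indicE/=; case: ifPn; rewrite ?mulr1 ?mulr0.
Qed.

Let mpsi K n : measurable_fun setT (psi K n).
Proof.
rewrite /psi; under eq_fun do rewrite -phiE.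
apply: measurable_funeM.
exact: (measurable_fun_fubini_tonelli_F (m2 := mu) (phi n) (mphi n) (phi0 n)).
Qed.

Let int_psi K n : 0 < K -> (\int[D]_z psi K n z <= (C / K)%:E)%E.
Proof.
move=> K0; rewrite /psi; under eq_integral do rewrite -phiE.
have k0 : 0 <= (c n)^-1 / K by rewrite divr_ge0 ?invr_ge0 ?ltW.
rewrite ge0_integralZl_EFin//; last 2 first.
- by move=> z _; exact: integral_ge0.
- exact: (measurable_fun_fubini_tonelli_F (m2 := mu) (phi n) (mphi n) (phi0 n)).
rewrite (fubini_tonelli (m1 := D) (m2 := mu) (phi n) (mphi n) (phi0 n)).
apply: (@le_trans _ _ (((c n)^-1 / K)%:E * (C * c n)%:E)%E); last first.
  rewrite -EFinM lee_fin le_eqVlt; apply/predU1P; left; field.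
  by rewrite !gt_eqF.
apply: lee_wpmul2l; first by rewrite lee_fin.
apply: (@le_trans _ _ (\int[mu]_(s in `[0%R, c n]) C%:E)%E); last first.
  rewrite integral_cst//= lebesgue_measure_itv/= lte_fin c0 oppr0 adde0.
  by rewrite -EFinM.
have mF : measurable_fun setT (fun s => \int[D]_z phi n (z, s))%E.
  exact: (measurable_fun_fubini_tonelli_G (m1 := D) (phi n) (mphi n) (phi0 n)).
rewrite [leRHS]integral_mkcond; apply: ge0_le_integral => //.
- by move=> s _; exact: integral_ge0.
- by apply/(measurable_restrictT _ _).1.
move=> s _; rewrite /patch; case: ifPn => [|sc].
  rewrite inE/= in_itv/= => /andP[s0 sc].
  have sb : 0 <= s <= b by rewrite s0 (le_trans sc).
  have sa : 0 <= s <= a.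
    by rewrite s0 (le_trans sc)// (le_trans (cb n))// ler_pdivrMr// ler_pMr// ler1n.
  apply: le_trans (g'C sa); rewrite le_eqVlt; apply/predU1P; left.
  apply: eq_integral => z _.
  by rewrite /phi /G/= clamp_id// indicE mem_set ?mulr1//= in_itv/= s0 sc.
rewrite integral0_eq// => z _.
by rewrite /phi/= indicE (negbTE sc) mulr0.
Qed.

Let mq n : measurable_fun setT (q n).
Proof.
apply: measurable_funM => //; apply: measurable_funB.
  have cna : 0 <= c n <= a.
    by rewrite (ltW (c0 n)) (le_trans (cb n))// ler_pdivrMr// ler_pMr// ler1n.
  by have /integrableP[/measurable_EFinP] := ig cna.
have a00 : 0 <= (0 : R) <= a by rewrite lexx ltW.
by have /integrableP[/measurable_EFinP] := ig a00.
Qed.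

Let q_cvg z : q^~ z @ \oo --> g' z 0.
Proof.
have := @quotient_cvg z 0; rewrite lexx (ltW b0) => /(_ isT).
by under eq_fun do rewrite add0r.
Qed.

Lemma measurable_derivative0 : measurable_fun setT (g'^~ 0).
Proof. by apply: (@measurable_fun_cvg _ _ _ _ q) => // z _; exact: q_cvg. Qed.

(** The quotients [q n] have mean zero and converge pointwise to the derivative; what has to be
    shown is uniform integrability, as there is no dominating function. Above the level 2 K the
    difference between quotient and derivative is controlled by tails of total mean at most 2 C / K.
    Dominated convergence applied to the truncated difference removes n, and then K tends to
    infinity. *)
Lemma integral_derivative0 : \int[D]_z g' z 0 = 0.
Proof.
have a00 : 0 <= (0 : R) <= a by rewrite lexx ltW.
have ig' : D.-integrable setT (fun z => (g' z 0)%:E).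
  exact: integrable_square_le measurable_derivative0 (g'C a00).
have iq n : D.-integrable setT (fun z => (q n z)%:E).
  have cna : 0 <= c n <= a.
    by rewrite (ltW (c0 n)) (le_trans (cb n))// ler_pdivrMr// ler_pMr// ler1n.
  apply: (@eq_integrable _ _ _ _ _ _ (fun z => (c n)^-1%:E * ((g z (c n))%:E - (g z 0)%:E))%E) => //.
  by apply: integrableZl => //; apply: integrableB => //; exact: ig.
have G0 (s : R) : 0 <= s <= a -> (\int[D]_z (g z s)%:E = 0)%E.
  move=> sa; rewrite -[LHS]fineK; last exact/integrable_fin_num/ig.
  by rewrite -[fine _]/(Rintegral D setT (g^~ s)) g0.
have cna n : 0 <= c n <= a.
  by rewrite (ltW (c0 n)) (le_trans (cb n))// ler_pdivrMr// ler_pMr// ler1n.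
have q0 n : (\int[D]_z (q n z)%:E = 0)%E.
  under eq_integral do rewrite EFinM EFinB.
  rewrite integralZl//; last by apply: integrableB => //; exact: ig.
  by rewrite integralB_EFin//; [rewrite !G0// sube0 mule0|exact: ig|exact: ig].
have C0 : 0 <= C.
  by rewrite -lee_fin (le_trans _ (g'C a00))// integral_ge0// => z _; rewrite lee_fin sqr_ge0.
have mg' := measurable_derivative0.
have mmin K n : measurable_fun setT (fun z => (Num.min `|q n z - g' z 0| (2 * K))%:E).
  apply/measurable_EFinP; apply: measurable_minr => //.
  by apply: measurableT_comp => //; exact: measurable_funB.
have psi0 K n z : 0 < K -> (0 <= psi K n z)%E.
  move=> K0; apply: mule_ge0; first by rewrite lee_fin divr_ge0 ?invr_ge0 ?ltW.
  by apply: integral_ge0 => s _; rewrite lee_fin sqr_ge0.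
have msq K : measurable_fun setT (fun z => (g' z 0 ^+ 2 / K)%:E).
  by apply/measurable_EFinP; apply: measurable_funM => //; exact: measurable_funX.
have key K n : 0 < K -> (`|\int[D]_z (g' z 0)%:E| <=
    \int[D]_z (Num.min `|q n z - g' z 0| (2 * K))%:E + (2 * C / K)%:E)%E.
  move=> K0.
  have -> : (`|\int[D]_z (g' z 0)%:E| = `|\int[D]_z (q n z - g' z 0)%:E|)%E.
    have qg : (\int[D]_z (q n z - g' z 0)%:E =
        \int[D]_z (q n z)%:E - \int[D]_z (g' z 0)%:E)%E.
      by apply: integralB_EFin => //; exact: iq.
    by rewrite qg q0 sub0e abseN.
  apply: (le_trans (le_abse_integral _ _ _)) => //.
    by apply/measurable_EFinP; exact: measurable_funB.
  have min0 z : (0 <= (Num.min `|q n z - g' z 0| (2 * K))%:E)%E.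
    by rewrite lee_fin le_min normr_ge0 mulr_ge0// ltW.
  have sq0 z : (0 <= (g' z 0 ^+ 2 / K)%:E)%E.
    by rewrite lee_fin divr_ge0 ?sqr_ge0// ltW.
  apply: (@le_trans _ _ (\int[D]_z ((Num.min `|q n z - g' z 0| (2 * K))%:E +
      (psi K n z + (g' z 0 ^+ 2 / K)%:E)))%E).
    apply: ge0_le_integral => //=.
    - by apply/measurable_EFinP; apply: measurableT_comp => //; exact: measurable_funB.
    - by apply: emeasurable_funD => //; apply: emeasurable_funD => //; exact: mpsi.
    (* Below the level 2 K truncation changes nothing. Above it the minimum is 2 K, and each of |q
       n| and |g'| is at most K plus its own tail. *)
    - move=> z _; have [dK|/ltW dK] := leP `|q n z - g' z 0| (2 * K).
        by rewrite leeDl// adde_ge0 ?psi0.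
      apply: (@le_trans _ _ (`|q n z|%:E + `|g' z 0|%:E)%E).
        by rewrite -EFinD lee_fin ler_normB.
      apply: (@le_trans _ _ (K%:E + psi K n z + (K + g' z 0 ^+ 2 / K)%:E)%E).
        by apply: leeD; [exact: quotient_le|rewrite lee_fin absr_le_sqr].
      rewrite EFinD [leLHS]addeACA.
      by rewrite (_ : (2 * K)%:E = (K%:E + K%:E)%E)// -EFinD; congr EFin; ring.
  rewrite ge0_integralD//; last 2 first.
  - by move=> z _; rewrite adde_ge0 ?psi0.
  - by apply: emeasurable_funD => //; exact: mpsi.
  rewrite leeD2l// ge0_integralD//; last by move=> z _; exact: psi0.
  have -> : (2 * C / K)%:E = ((C / K)%:E + (C / K)%:E)%E.
    by rewrite -EFinD; congr EFin; field; rewrite gt_eqF.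
  apply: leeD; first exact: int_psi.
  under eq_integral do rewrite mulrC EFinM.
  rewrite ge0_integralZl_EFin//; last 3 first.
  - by move=> z _; rewrite lee_fin sqr_ge0.
  - by apply/measurable_EFinP; exact: measurable_funX.
  - by rewrite invr_ge0 ltW.
  by rewrite mulrC EFinM lee_wpmul2l ?lee_fin ?invr_ge0 ?(ltW K0)// g'C.
have lim0 K : 0 < K -> (fun n => \int[D]_z (Num.min `|q n z - g' z 0| (2 * K))%:E)%E
    @ \oo --> 0%E.
  move=> K0.
  have [] := @dominated_convergence _ Xi R D setT measurableT
    (fun n z => (Num.min `|q n z - g' z 0| (2 * K))%:E) (cst 0%E)
    (cst (2 * K)%:E : Xi -> \bar R) (mmin K).
  - exact: measurable_cst.
  - apply: aeW => z _; apply/cvg_EFin; first by apply: nearW.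
    apply: (@squeeze_cvgr _ _ _ _ (fun=> 0) (fun n => `|q n z - g' z 0|)).
    + apply: nearW => n; rewrite le_min normr_ge0 mulr_ge0//= ?(ltW K0)//.
      by rewrite ge_min lexx.
    + exact: cvg_cst.
    + have := @q_cvg z; move/cvgrPdist_lt => h; apply/cvgrPdist_lt => e e0.
      have := h _ e0; apply: filterS => n.
      by rewrite sub0r normrN normr_id distrC.
  - exact: finite_measure_integrable_cst.
  - apply: aeW => z n _; rewrite gee0_abs ?lee_fin ?ge_min ?lexx ?orbT//.
    by rewrite le_min normr_ge0 mulr_ge0// ltW.
  by move=> _ _; rewrite integral0.
have le0 K : 0 < K -> (`|\int[D]_z (g' z 0)%:E| <= (2 * C / K)%:E)%E.
  move=> K0; apply: (@lee_cvg_to _ \oo _ _ (fun=> `|\int[D]_z (g' z 0)%:E|%E)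
    (fun n => (\int[D]_z (Num.min `|q n z - g' z 0| (2 * K))%:E + (2 * C / K)%:E)%E)).
  - exact: cvg_cst.
  - rewrite -[X in _ --> X]add0e; apply: cvgeD => //; last exact: cvg_cst.
    exact: lim0.
  - by apply: nearW => n; exact: key.
rewrite /Rintegral; set I := fine _.
have IE : (\int[D]_z (g' z 0)%:E = I%:E)%E.
  by rewrite fineK//; exact: integrable_fin_num.
apply/eqP; rewrite -normr_eq0 eq_le normr_ge0 andbT leNgt; apply/negP => I0.
(* For a nonzero mean I this choice of K would turn |I| <= 2 C / K into 2 C + 1 <= 2 C. *)
have K0 : 0 < (2 * C + 1) / `|I| by rewrite divr_gt0// ltr_wpDl// mulr_ge0.
have := le0 _ K0; rewrite IE lee_fin ler_pdivlMr// mulrCA divff ?gt_eqF// mulr1.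
lra.
Qed.

End mean_zero_derivative.

(** * The information carried by finitely many samples, and independence from it *)

Section history.
Context {R : realType} {dXi : measure_display} {Xi : measurableType dXi}
  (D : probability Xi R) {dO : measure_display} {Omega : measurableType dO}
  (P : probability Omega R) {I : choiceType} (J : set I)
  (X : I -> {RV P >-> Xi}).

Definition cylinders (s : seq I) : set (set Omega) :=
  [set E | exists A : I -> set Xi, (forall i, measurable (A i)) /\
     E = \bigcap_(i in [set` s]) (X i @^-1` A i)].

(** A copy of [Omega] with the sigma-algebra generated by the samples indexed by [s]: being
    determined by the past becomes plain measurability on this type. *)
Definition history (s : seq I) := g_sigma_algebraType (cylinders s).

Lemma cylinders_measurable s : cylinders s `<=` measurable.
Proof.
move=> _ [A [mA ->]]; apply: fin_bigcap_measurable => // i _.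
by rewrite -[X in measurable X]setTI; exact: (measurable_funPT (X i)).
Qed.

Lemma history_measurable s (E : set (history s)) :
  measurable E -> measurable (E : set Omega).
Proof. by apply: smallest_sub; [exact: sigma_algebra_measurable|exact: cylinders_measurable]. Qed.

(** The identity regarded as a random variable, so that its distribution is the restriction of [P]
    to the history. *)
Definition to_history s : Omega -> history s := idfun.

Lemma measurable_to_history s : measurable_fun setT (to_history s).
Proof. by move=> _ E mE; rewrite setTI; exact: (history_measurable mE). Qed.

HB.instance Definition _ s := isMeasurableFun.Build _ _ _ _
  (to_history s) (@measurable_to_history s).

Lemma history_sub s t (E : set Omega) : {subset s <= t} ->
  measurable (E : set (history s)) -> measurable (E : set (history t)).
Proof.
move=> st; apply: smallest_sub; first exact: sigma_algebra_measurable.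
move=> _ [A [mA ->]]; apply: sub_sigma_algebra.
exists (fun i => if i \in s then A i else setT).
split=> [i|]; first by case: ifP.
apply/seteqP; split=> w hw i /= it; last first.
  by have := hw i (st i it); rewrite it.
by case: ifP => // si; exact: hw.
Qed.

Lemma history_measurable_fun_sub s t d' (T : measurableType d') (h : Omega -> T) :
  {subset s <= t} -> measurable_fun setT (h : history s -> T) ->
  measurable_fun setT (h : history t -> T).
Proof.
move=> st mh _ Y mY; rewrite setTI; apply: (history_sub st).
by rewrite -[X in measurable X]setTI; exact: mh.
Qed.

Lemma history_measurable_funW s d' (T : measurableType d') (h : Omega -> T) :
  measurable_fun setT (h : history s -> T) -> measurable_fun setT h.
Proof.
move=> mh _ Y mY; rewrite setTI; apply: (@history_measurable s).
by rewrite -[X in measurable X]setTI; exact: mh.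
Qed.

Lemma history_coord s i : i \in s ->
  measurable_fun setT (X i : history s -> Xi).
Proof.
move=> si _ B mB; rewrite setTI; apply: sub_sigma_algebra.
exists (fun j => if j == i then B else setT); split=> [j|].
  by case: ifP.
apply/seteqP; split=> w /= hw; first by move=> j _ /=; case: eqP => // ->.
by have := hw i si; rewrite /= eqxx.
Qed.

Hypothesis X_indep : mutually_independent P J (fun i => X i : Omega -> Xi).
Hypothesis X_distr : forall i A, J i -> measurable A ->
  distribution P (X i) A = D A.

(** For fixed [B], both sides are finite measures in [E]. They agree on the cylinders, which are
    stable under intersection and contain the whole space, hence on the sigma-algebra they
    generate. *)
Lemma history_indep s j (E : set Omega) (B : set Xi) :
  uniq (j :: s) -> [set` j :: s] `<=` J ->
  measurable (E : set (history s)) -> measurable B ->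
  P (E `&` X j @^-1` B) = (P E * D B)%E.
Proof.
move=> us sJ mE mB.
have mXB : measurable (X j @^-1` B).
  by rewrite -[X in measurable X]setTI; exact: (measurable_funPT (X j)).
have DB0 : (0 <= fine (D B))%R by rewrite fine_ge0.
have DBfin : D B = (fine (D B))%:E by rewrite fineK// fin_num_measure.
have Jj : J j by apply: sJ => /=; rewrite mem_head.
have setTcyl : cylinders s setT.
  exists (fun=> setT); split => //.
  by apply/seteqP; split=> // w _ i _.
suff : mrestr P mXB E = mscale (NngNum DB0) P E.
  by rewrite /mrestr /mscale/= -DBfin muleC.
apply: (@g_sigma_algebra_measure_unique _ R Omega (cylinders s)
  (@cylinders_measurable s) (fun=> setT) (fun=> setTcyl)) mE.
- by apply/seteqP; split=> // w _; exists 0%N.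
- move=> _ _ [A [mA ->]] [A' [mA' ->]].
  exists (fun i => A i `&` A' i); split; first by move=> i; exact: measurableI.
  apply/seteqP; split=> w.
    by move=> [h h'] i si; split; [exact: h|exact: h'].
  by move=> h; split=> i si; have [] := h i si.
- move=> _ [A [mA ->]].
  transitivity (P (\bigcap_(i in [set` s]) (X i @^-1` A i)) * D B)%E; last first.
    by rewrite {1}DBfin muleC.
  rewrite /mrestr.
  have jE : \bigcap_(i in [set` s]) (X i @^-1` A i) `&` X j @^-1` B =
      \bigcap_(i in [set` j :: s]) (X i @^-1` (if i == j then B else A i)).
    apply/seteqP; split=> w.
      move=> [h hB] i /=; rewrite inE; case: eqP => [->//|_ /= si].
      exact: h.
    move=> h; split; last by have := h j; rewrite /= mem_head eqxx; exact.
    move=> i si; have := h i; rewrite /= inE [i \in s]si orbT => /(_ isT).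
    by case: eqP => // ij; move: us; rewrite /= -ij si.
  rewrite -[LHS]/(P (_ `&` _)) jE X_indep//; last by move=> i; case: ifP.
  rewrite big_cons eqxx muleC; congr (_ * _)%E; last exact: X_distr.
  have us' : uniq s by case/andP: us.
  rewrite -X_indep//; last 2 first.
  - by move=> i si; apply: sJ => /=; rewrite inE [i \in s]si orbT.
  - by move=> i; case: ifP.
  congr (P _); apply: eq_bigcapr => i si; case: eqP => // ij.
  by move: us; rewrite /= -ij [i \in s]si.
- move=> _; rewrite -[ltLHS]/(P (_ `&` _)) setTI.
  by rewrite (le_lt_trans (probability_le1 _ _))// ltry.
Qed.

(** The freezing lemma, in place of conditional expectations: by independence the pair of the
    history and the new sample has a product law, so the sample is integrated out with the past held
    fixed. *)
Lemma history_tonelli s j (F : history s * Xi -> \bar R) :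
  uniq (j :: s) -> [set` j :: s] `<=` J ->
  measurable_fun setT F -> (forall u, 0 <= F u)%E ->
  (\int[P]_w F (w, X j w) = \int[P]_w \int[D]_z F (w, z))%E.
Proof.
move=> us sJ mF F0.
pose phi (w : Omega) : history s * Xi := (to_history s w, X j w).
have mphi : measurable_fun setT phi.
  apply: measurable_fun_pair; first exact: measurable_to_history.
  exact: (measurable_funPT (X j)).
pose PS := distribution P (to_history s).
pose phi' := mfun_Sub (mem_set mphi).
have prodE A : measurable A -> (PS \x D)%E A = distribution P phi' A.
  apply: product_measure_unique => B C mB mC.
  exact: (history_indep us sJ mB mC).
transitivity (\int[PS \x D]_u F u)%E.
  rewrite (eq_measure_integral (distribution P phi')); last first.
    by move=> A mA _; exact: prodE.
  by rewrite ge0_integral_distribution.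
rewrite fubini_tonelli1// ge0_integral_distribution//.
- exact: measurable_fun_fubini_tonelli_F.
- by move=> w; apply: integral_ge0 => z _; exact: F0.
Qed.

End history.

(** * Variance of mini-batch averages given the past *)

Lemma integral_shift_sqr {d} {T : measurableType d} {R : realType}
    (D : probability T R) (a : R) (h : T -> R) :
  measurable_fun setT h -> \int[D]_z h z = 0 ->
  (\int[D]_z (h z ^+ 2)%:E < +oo)%E ->
  (\int[D]_z ((a + h z) ^+ 2)%:E = (a ^+ 2)%:E + \int[D]_z (h z ^+ 2)%:E)%E.
Proof.
move=> mh h0 hoo.
have sq0 z : (0 <= (h z ^+ 2)%:E)%E by rewrite lee_fin sqr_ge0.
have msq : measurable_fun setT (fun z => (h z ^+ 2)%:E).
  by apply/measurable_EFinP; exact: measurable_funX.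
have isq : D.-integrable setT (fun z => (h z ^+ 2)%:E).
  apply/integrableP; split => //.
  by under eq_integral do rewrite gee0_abs//.
have ih : D.-integrable setT (fun z => (h z)%:E).
  apply: (@integrable_square_le _ _ _ _ _ (fine (\int[D]_z (h z ^+ 2)%:E)%E)) => //.
  by rewrite fineK// ge0_fin_numE ?integral_ge0.
have h0' : (\int[D]_z (h z)%:E = 0)%E.
  rewrite -[LHS]fineK; last exact/integrable_fin_num.
  by rewrite -[fine _]/(Rintegral D setT h) h0.
have ia : D.-integrable setT (fun z => (a ^+ 2 + 2 * a * h z)%:E).
  apply: (@eq_integrable _ _ _ _ _ _ (fun z => (a ^+ 2)%:E + (2 * a)%:E * (h z)%:E)%E) => //.
  apply: integrableD => //; first exact: finite_measure_integrable_cst.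
  exact: integrableZl.
have -> : (\int[D]_z ((a + h z) ^+ 2)%:E =
    \int[D]_z ((a ^+ 2 + 2 * a * h z)%:E + (h z ^+ 2)%:E))%E.
  by apply: eq_integral => z _; rewrite -EFinD; congr EFin; ring.
rewrite integralD//; congr (_ + _)%E.
have i1 : D.-integrable setT (cst (a ^+ 2)%:E : T -> \bar R).
  exact: finite_measure_integrable_cst.
have i2 : D.-integrable setT (fun z => (2 * a)%:E * (h z)%:E)%E.
  exact: integrableZl.
have -> : (\int[D]_z (a ^+ 2 + 2 * a * h z)%:E =
    \int[D]_z (cst (a ^+ 2)%:E z + (2 * a)%:E * (h z)%:E))%E by [].
rewrite integralD// integralZl// h0' mule0 adde0 integral_cst//=.
by rewrite probability_setT mule1.
Qed.

Lemma integral_shift_sqr_le {d} {T : measurableType d} {R : realType}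
    (D : probability T R) (a : R) (h : T -> R) :
  measurable_fun setT h -> \int[D]_z h z = 0 ->
  (\int[D]_z ((a + h z) ^+ 2)%:E <= (a ^+ 2)%:E + \int[D]_z (h z ^+ 2)%:E)%E.
Proof.
move=> mh h0; have [hoo|hoo] := eqVneq (\int[D]_z (h z ^+ 2)%:E)%E +oo%E.
  by rewrite hoo addey// leey.
by rewrite integral_shift_sqr// ltey.
Qed.

Section batch_variance.
Context {R : realType} {dXi : measure_display} {Xi : measurableType dXi}
  (D : probability Xi R) {dO : measure_display} {Omega : measurableType dO}
  (P : probability Omega R) {I : choiceType} (J : set I)
  (X : I -> {RV P >-> Xi}).
Hypothesis X_indep : mutually_independent P J (fun i => X i : Omega -> Xi).
Hypothesis X_distr : forall i A, J i -> measurable A ->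
  distribution P (X i) A = D A.

Lemma history_pair s j : j \in s -> forall t (h : Omega -> Xi -> R),
  {subset t <= s} ->
  measurable_fun setT (fun u : history X t * Xi => h u.1 u.2) ->
  measurable_fun setT ((fun w => h w (X j w)) : history X s -> R).
Proof.
move=> js t h ts mh.
have mp : measurable_fun setT (fun w : history X s => ((w : history X t), X j w)).
  apply: measurable_fun_pair; last exact: history_coord.
  apply: (history_measurable_fun_sub ts); exact: measurable_id.
exact: (measurableT_comp mh mp).
Qed.

(** Given the past, [A] is a constant and the new term is centered, so the cross term vanishes. Two
    histories occur because [A] may already contain samples of the current batch, while [h] looks
    only at what precedes the batch. *)
Lemma history_step s t j (A : Omega -> R) (h : Omega -> Xi -> R) :
  uniq (j :: s) -> [set` j :: s] `<=` J -> {subset t <= s} ->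
  measurable_fun setT (A : history X s -> R) ->
  measurable_fun setT (fun u : history X t * Xi => h u.1 u.2) ->
  (forall w, \int[D]_z h w z = 0) ->
  (\int[P]_w ((A w + h w (X j w)) ^+ 2)%:E <=
   \int[P]_w (A w ^+ 2)%:E + \int[P]_w \int[D]_z (h w z ^+ 2)%:E)%E.
Proof.
move=> us sJ ts mA mh h0.
have mh' : measurable_fun setT (fun u : history X s * Xi => h u.1 u.2).
  have mp : measurable_fun setT (fun u : history X s * Xi => ((u.1 : history X t), u.2)).
    have mid : measurable_fun setT ((fun w => w) : history X s -> history X t).
      by apply: (history_measurable_fun_sub ts); exact: measurable_id.
    apply: measurable_fun_pair; last exact: measurable_snd.
    exact: (measurableT_comp mid measurable_fst).
  exact: (measurableT_comp mh mp).
have mhw w : measurable_fun setT (h w).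
  exact: (measurableT_comp mh (measurable_pair1 (w : history X t))).
have mA' : measurable_fun setT A := history_measurable_funW mA.
pose F (u : history X s * Xi) := ((A u.1 + h u.1 u.2) ^+ 2)%:E.
have mF : measurable_fun setT F.
  apply/measurable_EFinP; apply: measurable_funX; apply: measurable_funD => //.
  exact: (measurableT_comp (f := (A : history X s -> R))).
have F0 u : (0 <= F u)%E by rewrite lee_fin sqr_ge0.
rewrite (history_tonelli X_indep X_distr us sJ mF F0).
pose H (u : history X s * Xi) := (h u.1 u.2 ^+ 2)%:E.
have mH : measurable_fun setT H.
  by apply/measurable_EFinP; apply: measurable_funX.
have H0 u : (0 <= H u)%E by rewrite lee_fin sqr_ge0.
have mIF : measurable_fun setT (fun w : Omega => \int[D]_z F (w, z))%E.
  apply: (@history_measurable_funW _ _ _ _ _ _ _ X s).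
  exact: (measurable_fun_fubini_tonelli_F (m2 := D) F mF F0).
have mIH : measurable_fun setT (fun w : Omega => \int[D]_z H (w, z))%E.
  apply: (@history_measurable_funW _ _ _ _ _ _ _ X s).
  exact: (measurable_fun_fubini_tonelli_F (m2 := D) H mH H0).
rewrite -ge0_integralD//; last 3 first.
- by move=> w _; rewrite lee_fin sqr_ge0.
- by apply/measurable_EFinP; exact: measurable_funX.
- by move=> w _; apply: integral_ge0 => z _; exact: (H0 (w, z)).
apply: ge0_le_integral => //.
- by move=> w _; apply: integral_ge0 => z _; exact: (F0 (w, z)).
- apply: emeasurable_funD => //.
  by apply/measurable_EFinP; exact: measurable_funX.
- by move=> w _; exact: (integral_shift_sqr_le (A w) (mhw w) (h0 w)).
Qed.

(** Samples are added one at a time: those already added join the history of [A], while [h] stays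
    tied to [s]. *)
Lemma history_batch s js (A : Omega -> R) (h : Omega -> Xi -> R) :
  uniq (js ++ s) -> [set` js ++ s] `<=` J ->
  measurable_fun setT (A : history X s -> R) ->
  measurable_fun setT (fun u : history X s * Xi => h u.1 u.2) ->
  (forall w, \int[D]_z h w z = 0) ->
  measurable_fun setT ((fun w => A w + \sum_(j <- js) h w (X j w)) :
    history X (js ++ s) -> R) /\
  (\int[P]_w ((A w + \sum_(j <- js) h w (X j w)) ^+ 2)%:E <=
   \int[P]_w (A w ^+ 2)%:E +
   (size js)%:R%:E * \int[P]_w \int[D]_z (h w z ^+ 2)%:E)%E.
Proof.
move=> + + mA mh h0; elim: js => [|j js IH] us sJ.
  split; first by under eq_fun do rewrite big_nil addr0.
  by under eq_integral do rewrite big_nil addr0; rewrite mul0e adde0.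
have us' : uniq (js ++ s) by case/andP: us.
have [|mA' le'] := IH us'.
  by move=> i si; apply: sJ; rewrite /= inE [i \in _]si orbT.
have E w : A w + \sum_(i <- j :: js) h w (X i w) =
    (A w + \sum_(i <- js) h w (X i w)) + h w (X j w).
  by rewrite big_cons addrCA addrC.
split.
  under eq_fun do rewrite E.
  apply: measurable_funD.
    by apply: history_measurable_fun_sub mA' => i si; rewrite inE si orbT.
  apply: (history_pair _ (t := s)) => //; first by rewrite inE eqxx.
  by move=> i si; rewrite inE mem_cat si !orbT.
under eq_integral do rewrite E.
have ss : {subset s <= js ++ s} by move=> i si; rewrite mem_cat si orbT.
apply: le_trans (history_step us sJ ss mA' mh h0) _.
have -> : ((size (j :: js))%:R%:E = (size js)%:R%:E + 1 :> \bar R)%E.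
  by rewrite -EFinD natr1.
rewrite ge0_muleDl ?lee_fin// mul1e.
set S := (\int[P]_w \int[D]_z (h w z ^+ 2)%:E)%E in le' *.
by rewrite [leRHS]addeA; apply: leeD.
Qed.

(** Applied to each coordinate, [history_batch] adds b variances, each scaled by 1 / b^2; this is
    the origin of the factor 1 / b. *)
Lemma history_batch_mean n b s (t : 'I_b -> I) (A : Omega -> 'rV[R]_n)
    (h : Omega -> Xi -> 'rV[R]_n) : (0 < b)%N -> injective t ->
  uniq s -> (forall i, t i \notin s) -> (forall i, J (t i)) -> [set` s] `<=` J ->
  (forall c, measurable_fun setT ((fun w => A w 0 c) : history X s -> R)) ->
  (forall c, measurable_fun setT (fun u : history X s * Xi => h u.1 u.2 0 c)) ->
  (forall w c, D.-integrable setT (fun z => (h w z 0 c)%:E)) ->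
  (forall w c, \int[D]_z h w z 0 c = 0) ->
  (\int[P]_w (enorm (A w + b%:R^-1 *: \sum_i h w (X (t i) w)) ^+ 2)%:E <=
   \int[P]_w (enorm (A w) ^+ 2)%:E +
   b%:R^-1%:E * \int[P]_w \int[D]_z (enorm (h w z) ^+ 2)%:E)%E.
Proof.
move=> b0 tinj us ts tJ sJ mA mh ih h0.
pose js := [seq t i | i <- enum 'I_b].
have usj : uniq (js ++ s).
  rewrite cat_uniq us andbT (map_inj_uniq tinj) enum_uniq/=.
  by apply/hasPn => i si; apply/mapP => -[k _ ik]; move: (ts k); rewrite -ik si.
have sjJ : [set` js ++ s] `<=` J.
  move=> i /=; rewrite mem_cat => /orP[/mapP[k _ ->]//|si]; exact: sJ.
have szj : size js = b by rewrite size_map size_enum_ord.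
pose hc c w z := b%:R^-1 * h w z 0 c.
have mhc c : measurable_fun setT (fun u : history X s * Xi => hc c u.1 u.2).
  by apply: measurable_funM.
have mhw c w : measurable_fun setT (fun z => h w z 0 c).
  exact: (measurableT_comp (mh c) (measurable_pair1 (w : history X s))).
have hc0 c w : \int[D]_z hc c w z = 0.
  transitivity (b%:R^-1 * \int[D]_z h w z 0 c); last by rewrite h0 mulr0.
  by apply: RintegralZl => //; exact: ih.
have key c := (history_batch usj sjJ (mA c) (mhc c) (hc0 c)).
have E w : (enorm (A w + b%:R^-1 *: \sum_i h w (X (t i) w)) ^+ 2)%:E =
    (\sum_c ((A w 0 c + \sum_(j <- js) hc c w (X j w)) ^+ 2)%:E)%E.
  rewrite sqr_enormE -sumEFin; apply: eq_bigr => c _; congr ((_ ^+ 2)%:E).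
  rewrite !mxE summxE mulr_sumr /js big_map big_enum/=; congr (_ + _).
under eq_integral do rewrite E.
have mjs c : measurable_fun setT (fun w => ((A w 0 c + \sum_(j <- js) hc c w (X j w)) ^+ 2)%:E).
  apply/measurable_EFinP; apply: measurable_funX.
  exact: history_measurable_funW (key c).1.
rewrite ge0_integral_sum//; last by move=> c w _; rewrite lee_fin sqr_ge0.
have mG c : measurable_fun setT (fun w => \int[D]_z (h w z 0 c ^+ 2)%:E)%E.
  apply: (@history_measurable_funW _ _ _ _ _ _ _ X s).
  apply: (measurable_fun_fubini_tonelli_F (m2 := D)
    (fun u : history X s * Xi => (h u.1 u.2 0 c ^+ 2)%:E)).
    by apply/measurable_EFinP; exact: measurable_funX.
  by move=> u; rewrite lee_fin sqr_ge0.
have G0 c w : (0 <= \int[D]_z (h w z 0 c ^+ 2)%:E)%E.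
  by apply: integral_ge0 => z _; rewrite lee_fin sqr_ge0.
have bV0 : 0 <= b%:R^-1 :> R by rewrite invr_ge0.
apply: (@le_trans _ _ (\sum_c (\int[P]_w (A w 0 c ^+ 2)%:E +
    b%:R^-1%:E * \int[P]_w \int[D]_z (h w z 0 c ^+ 2)%:E))%E).
  apply: lee_sum => c _; apply: (le_trans (key c).2); rewrite leeD2l// szj.
  have -> : (\int[P]_w \int[D]_z (hc c w z ^+ 2)%:E =
      \int[P]_w ((b%:R^-1 ^+ 2)%:E * \int[D]_z (h w z 0 c ^+ 2)%:E))%E.
    apply: eq_integral => w _; rewrite -ge0_integralZl_EFin//.
    - by apply: eq_integral => z _; rewrite /hc exprMn EFinM.
    - by move=> z _; rewrite lee_fin sqr_ge0.
    - by apply/measurable_EFinP; exact: measurable_funX.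
  rewrite (ge0_integralZl_EFin _ measurableT (fun w _ => G0 c w) (mG c) (sqr_ge0 _)).
  rewrite muleA -EFinM expr2 mulrA divff ?mul1r//.
  by rewrite pnatr_eq0 -lt0n.
rewrite big_split/=; apply: leeD.
  rewrite -ge0_integral_sum//; last 2 first.
  - move=> c; apply/measurable_EFinP; apply: measurable_funX.
    exact: history_measurable_funW (mA c).
  - by move=> c w _; rewrite lee_fin sqr_ge0.
  rewrite le_eqVlt; apply/predU1P; left; apply: eq_integral => w _.
  by rewrite sqr_enormE -sumEFin.
rewrite -ge0_sume_distrr; last by move=> c _; apply: integral_ge0.
apply: lee_wpmul2l; first by rewrite lee_fin.
rewrite -ge0_integral_sum//.
rewrite le_eqVlt; apply/predU1P; left; apply: eq_integral => w _.
rewrite -ge0_integral_sum//; last 2 first.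
- by move=> c; apply/measurable_EFinP; exact: measurable_funX.
- by move=> c z _; rewrite lee_fin sqr_ge0.
by apply: eq_integral => z _; rewrite sqr_enormE -sumEFin.
Qed.

End batch_variance.

(** * Partial gradients and derivatives along a line *)

Lemma derive_line {R : realType} {V : normedModType R} (f : V -> R) (u v : V)
    (s : R) : derivable f (u + s *: v) v ->
  is_derive s 1 (fun t => f (u + t *: v)) ('D_v f (u + s *: v)).
Proof.
have E : (fun h : R => h^-1 *: (((fun t => f (u + t *: v)) \o shift s) (h *: (1 : R^o))
      - f (u + s *: v))) =
    (fun h : R => h^-1 *: ((f \o shift (u + s *: v)) (h *: v) - f (u + s *: v))).
  apply/funext => h /=; congr (_ *: (f _ - _)).
  by rewrite [h *: 1]mulr1 scalerDl addrCA.
by move=> df; split; rewrite /derivable /derive E.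
Qed.

Section partial_gradients.
Context {R : realType} {d1 d2 : nat}.
Implicit Types (h : 'rV[R]_d1 -> 'rV[R]_d2 -> R) (x a : 'rV[R]_d1) (y b : 'rV[R]_d2).

Lemma dotp_delta n (u : 'rV[R]_n) i : dotp u (delta_mx 0 i) = u 0 i.
Proof.
rewrite dotpE (bigD1 i)//= mxE !eqxx mulr1 big1 ?addr0// => j ji.
by rewrite mxE (negbTE ji) mulr0.
Qed.

Lemma row_delta_sum n (a : 'rV[R]_n) : a = \sum_i a 0 i *: delta_mx 0 i.
Proof.
apply/rowP => j; rewrite summxE (bigD1 j)//= !mxE !eqxx mulr1 big1 ?addr0// => i ij.
by rewrite !mxE eqxx [j == i]eq_sym (negbTE ij) mulr0.
Qed.

Lemma derive_partial_x h x y a :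
  'D_a (h^~ y) x = 'D_((a, 0) : 'rV[R]_d1 * 'rV[R]_d2) (fun p => h p.1 p.2) (x, y).
Proof.
have E : (fun t : R => t^-1 *: ((h^~ y \o shift x) (t *: a) - h x y)) =
    (fun t => t^-1 *: (((fun p => h p.1 p.2) \o
       shift ((x, y) : 'rV[R]_d1 * 'rV[R]_d2)) (t *: (a, 0)) - h x y)).
  by apply/funext => t /=; rewrite scaler0 add0r.
by rewrite /derive E.
Qed.

Lemma derive_partial_y h x y b :
  'D_b (h x) y = 'D_((0, b) : 'rV[R]_d1 * 'rV[R]_d2) (fun p => h p.1 p.2) (x, y).
Proof.
have E : (fun t : R => t^-1 *: ((h x \o shift y) (t *: b) - h x y)) =
    (fun t => t^-1 *: (((fun p => h p.1 p.2) \o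
       shift ((x, y) : 'rV[R]_d1 * 'rV[R]_d2)) (t *: (0, b)) - h x y)).
  by apply/funext => t /=; rewrite scaler0 add0r.
by rewrite /derive E.
Qed.

(** The differential is linear, so it is determined by the coordinate directions, where it gives the
    entries of [gradx] and [grady]. *)
Lemma diff_gradE h x y a b : differentiable (fun p => h p.1 p.2) (x, y) ->
  'D_((a, b) : 'rV[R]_d1 * 'rV[R]_d2) (fun p => h p.1 p.2) (x, y) =
  dotp (gradx h x y) a + dotp (grady h x y) b.
Proof.
move=> dh; set H := (fun p : 'rV[R]_d1 * 'rV[R]_d2 => h p.1 p.2) in dh *.
have -> : (a, b) = (a, 0) + (0, b) :> 'rV[R]_d1 * 'rV[R]_d2.
  by rewrite [RHS]surjective_pairing/= addr0 add0r.
have dZ k v : 'd H (x, y) (k *: v) = k * 'd H (x, y) v by exact: linearZZ.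
rewrite deriveE// raddfD; congr (_ + _).
  have -> : (a, 0) = \sum_i a 0 i *: (delta_mx 0 i, 0) :> 'rV[R]_d1 * 'rV[R]_d2.
    rewrite [RHS]surjective_pairing; congr (_, _).
      by rewrite (raddf_sum fst)/=; exact: row_delta_sum.
    by rewrite (raddf_sum snd)/= big1// => i _; rewrite scaler0.
  rewrite raddf_sum dotpE; apply: eq_bigr => i _.
  transitivity (a 0 i * 'd H (x, y) (delta_mx 0 i, 0)); first exact: dZ.
  by rewrite -deriveE// -derive_partial_x /gradx /grad mxE mulrC.
have -> : (0, b) = \sum_i b 0 i *: (0, delta_mx 0 i) :> 'rV[R]_d1 * 'rV[R]_d2.
  rewrite [RHS]surjective_pairing; congr (_, _).
    by rewrite (raddf_sum fst)/= big1// => i _; rewrite scaler0.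
  by rewrite (raddf_sum snd)/=; exact: row_delta_sum.
rewrite raddf_sum dotpE; apply: eq_bigr => i _.
transitivity (b 0 i * 'd H (x, y) (0, delta_mx 0 i)); first exact: dZ.
by rewrite -deriveE// -derive_partial_y /grady /grad mxE mulrC.
Qed.

Lemma is_derive_line h x y a b (s : R) :
  differentiable (fun p => h p.1 p.2) (x + s *: a, y + s *: b) ->
  is_derive s 1 (fun t => h (x + t *: a) (y + t *: b))
    (dotp (gradx h (x + s *: a) (y + s *: b)) a +
     dotp (grady h (x + s *: a) (y + s *: b)) b).
Proof.
move=> dh; rewrite -diff_gradE//.
apply: (@derive_line R ('rV[R]_d1 * 'rV[R]_d2)%type (fun p => h p.1 p.2) (x, y) (a, b) s).
exact: diff_derivable.
Qed.

End partial_gradients.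

(** * Scalar inequalities behind the x step and the y step *)

Lemma taylor1_le {R : realType} (phi phi' : R -> R) (K : R) :
  (forall s : R, 0 <= s <= 1 -> is_derive s 1 phi (phi' s)) ->
  (forall s : R, 0 <= s <= 1 -> phi' s - phi' 0 <= K * s) ->
  phi 1 - phi 0 - phi' 0 <= K / 2.
Proof.
move=> dphi phiK.
(* Subtracting the quadratic model leaves a function with nonpositive derivative on [0, 1]. *)
pose psi : R -> R := phi - (phi' 0 \*: (@id R) + (K / 2) \*: ((@id R) ^+ 2)).
have dpsi (s : R) : 0 <= s <= 1 -> is_derive s 1 psi (phi' s - (phi' 0 + K * s)).
  move=> s01; have ds := dphi s s01.
  apply: is_derive_eq; rewrite scaler1 expr1 /GRing.scale/= -[_ *+ 2]mulr_natr.
  by field.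
have [||c c01] := @MVT _ psi (fun s => phi' s - (phi' 0 + K * s)) 0 1 ltr01.
- by move=> s; rewrite in_itv/= => /andP[s0 s1]; apply: dpsi; rewrite !ltW.
- apply: derivable_within_continuous => s; rewrite in_itv/= => s01.
  by have [] := dpsi s s01.
rewrite in_itv/= in c01; have c01' : 0 <= c <= 1 by case/andP: c01 => *; rewrite !ltW.
rewrite /psi !fctE/= subr0 mulr1 -![_ ^+ 2]/(_ * _) /GRing.scale/= !mulr1 !mulr0; by have := phiK c c01'; lra.
Qed.

Lemma x_step_arith {R : realFieldType} (Gd vd gs D T gam : R) : 0 < gam ->
  D + gam * vd <= 0 -> Gd - vd <= gs + D / (4 * gam) -> gs <= T ->
  Gd <= T - D / (2 * gam) - D / (4 * gam).
Proof.
move=> g0 hv.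
have -> : D / (2 * gam) = D / gam / 2 by field; rewrite gt_eqF.
have -> : D / (4 * gam) = D / gam / 4 by field; rewrite gt_eqF.
have : vd <= - (D / gam).
  by rewrite -(ler_pM2l g0) mulrN mulrCA divff ?gt_eqF// mulr1; lra.
lra.
Qed.

(** The letters are those of [y_step_fixed]: with c = y* - y and d the projected move, [A], [Q] and
    [dc] are |c|^2, |d|^2 and <d, c>; [gc], [gd], [wc], [wd] are the products of the true and of the
    estimated gradient with c and d; [hy], [ht], [hs] are the objective at y, at the projected point
    and at y*; and [g] is the squared estimation error. *)
Lemma y_step_arith {R : realFieldType}
    (A Q g gc gd wc wd dc hs ht hy lam tau L eta : R) :
  0 < lam -> 0 < tau -> tau <= L -> 6 * L * lam <= 1 -> 0 <= eta <= 1 -> 0 <= Q ->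
  lam * (wc - wd) <= dc - Q ->
  hs <= hy + gc - tau / 2 * A -> hy + gd - L / 2 * Q <= ht -> ht <= hs ->
  gc - wc <= tau^-1 * g + tau * A / 4 ->
  - (gd - wd) <= tau^-1 * g + tau * Q / 4 ->
  eta ^+ 2 * Q - 2 * (eta * dc) + A <=
    (1 - eta * tau * lam / 2) * A - 3 * eta / 4 * Q + 4 * eta * lam / tau * g.
Proof.
move=> l0 t0 tL Ll /andP[eta0 eta1] Q0 h1 hs1 hs2 hs3.
have : tau / 2 * A <= gc - gd + L / 2 * Q by lra.
rewrite -(ler_pM2l l0) => h2; rewrite -(ler_pM2l l0) => h3; rewrite -(ler_pM2l l0) => h4.
have -> : 4 * eta * lam / tau * g = 4 * eta * lam * (tau^-1 * g) by rewrite mulrA.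
move: h3 h4; set G := tau^-1 * g => h3 h4.
have h5 : - dc <= 2 * lam * G + lam * tau * Q / 4 - lam * tau * A / 4 - Q
   + lam * L / 2 * Q by lra.
have h6 := ler_wpM2l eta0 h5.
have lt6 : lam * tau <= lam * L by rewrite ler_pM2l.
have h7 : eta * Q * (lam * L + lam * tau / 2 + eta) <= eta * Q * (5 / 4).
  by rewrite ler_wpM2l ?mulr_ge0//; lra.
lra.
Qed.

Lemma y_step_arith2 {R : realFieldType} (A B Q G s eta : R) :
  0 <= s <= 1 / 6 -> 0 <= A -> 0 <= eta * Q -> 0 <= G ->
  B <= (1 - s / 2) * A - 3 * eta / 4 * Q + 4 * G ->
  (1 + s / 4) * B <= (1 - s / 4) * A - 3 * eta / 4 * Q + 25 / 6 * G.
Proof.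
move=> /andP[s0 s6] A0 Q0 G0 hB.
have s40 : 0 <= 1 + s / 4 by lra.
apply: (le_trans (ler_wpM2l s40 hB)).
have q1 : 0 <= s * (eta * Q) by rewrite mulr_ge0.
have q2 : 0 <= s * (s * A) by rewrite !mulr_ge0.
have q3 : s * G <= 1 / 6 * G by rewrite ler_wpM2r.
have -> : (1 + s / 4) * ((1 - s / 2) * A - 3 * eta / 4 * Q + 4 * G) =
  (1 - s / 4) * A - s * (s * A) / 8 - 3 * eta / 4 * Q - 3 / 16 * (s * (eta * Q))
  + 4 * G + s * G by field.
lra.
Qed.

(** * Regularity of the inner maximum and the two deterministic steps *)

Section minimax.
Context {R : realType} {d1 d2 : nat}.
Implicit Types (x a : 'rV[R]_d1) (y b : 'rV[R]_d2).
Variables (h : 'rV[R]_d1 -> 'rV[R]_d2 -> R) (X : set 'rV[R]_d1) (Y : set 'rV[R]_d2).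
Variables (L tau : R).
Hypotheses (X_proj : projectable X) (Y_proj : projectable Y).
Hypotheses (X_neq0 : X !=set0) (Y_neq0 : Y !=set0).
Hypotheses (L_gt0 : 0 < L) (tau_gt0 : 0 < tau).
Hypothesis h_diff : forall x y, X x -> Y y ->
  differentiable (fun p => h p.1 p.2) (x, y).
Hypothesis h_lip : forall x x' y y', X x -> X x' -> Y y -> Y y' ->
  enorm (gradxy h x y - gradxy h x' y')
    <= L * enorm (row_mx x y - row_mx x' y').
Hypothesis h_sc : forall x y y', X x -> Y y -> Y y' ->
  h x y <= h x y' + dotp (grady h x y') (y - y') - tau / 2 * enorm (y - y') ^+ 2.

Lemma sqr_enorm_row_mx n m (u : 'rV[R]_n) (v : 'rV[R]_m) :
  enorm (row_mx u v) ^+ 2 = enorm u ^+ 2 + enorm v ^+ 2.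
Proof.
rewrite !sqr_enormE big_split_ord/=; congr (_ + _); apply: eq_bigr => i _.
  by rewrite row_mxEl.
by rewrite row_mxEr.
Qed.

Lemma sqr_grad_lip x x' y y' : X x -> X x' -> Y y -> Y y' ->
  enorm (gradx h x y - gradx h x' y') ^+ 2 + enorm (grady h x y - grady h x' y') ^+ 2
  <= L ^+ 2 * (enorm (x - x') ^+ 2 + enorm (y - y') ^+ 2).
Proof.
move=> Xx Xx' Yy Yy'; have := h_lip Xx Xx' Yy Yy'.
rewrite -(ler_pXn2r (n := 2)) ?nnegrE ?mulr_ge0 ?enorm_ge0 ?(ltW L_gt0)//.
by rewrite /gradxy !opp_row_mx !add_row_mx exprMn !sqr_enorm_row_mx.
Qed.

Lemma gradx_lip_y x y y' : X x -> Y y -> Y y' ->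
  enorm (gradx h x y - gradx h x y') <= L * enorm (y - y').
Proof.
move=> Xx Yy Yy'; have := sqr_grad_lip Xx Xx Yy Yy'.
rewrite subrr enorm0 expr0n add0r -exprMn => le2.
rewrite -(ler_pXn2r (n := 2)) ?nnegrE ?mulr_ge0 ?enorm_ge0 ?(ltW L_gt0)//.
by apply: le_trans le2; rewrite lerDl sqr_ge0.
Qed.

Lemma grady_lip_x x x' y : X x -> X x' -> Y y ->
  enorm (grady h x y - grady h x' y) <= L * enorm (x - x').
Proof.
move=> Xx Xx' Yy; have := sqr_grad_lip Xx Xx' Yy Yy.
rewrite subrr enorm0 expr0n addr0 -exprMn => le2.
rewrite -(ler_pXn2r (n := 2)) ?nnegrE ?mulr_ge0 ?enorm_ge0 ?(ltW L_gt0)//.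
by apply: le_trans le2; rewrite lerDr sqr_ge0.
Qed.

Let Xseg := projectable_segment X_proj.
Let Yseg := projectable_segment Y_proj.

Lemma dotp_row_mx n m (u u' : 'rV[R]_n) (v v' : 'rV[R]_m) :
  dotp (row_mx u v) (row_mx u' v') = dotp u u' + dotp v v'.
Proof.
rewrite !dotpE big_split_ord/=; congr (_ + _); apply: eq_bigr => i _.
  by rewrite !row_mxEl.
by rewrite !row_mxEr.
Qed.

(** The sign [e] yields the upper and the lower quadratic bound from a single argument along the
    segment, which stays in [X] and [Y], where the gradient is Lipschitz. *)
Lemma smooth_le (e : R) x x' y y' : e ^+ 2 = 1 -> X x -> X x' -> Y y -> Y y' ->
  e * (h x' y' - h x y - dotp (gradx h x y) (x' - x) - dotp (grady h x y) (y' - y))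
  <= L / 2 * (enorm (x' - x) ^+ 2 + enorm (y' - y) ^+ 2).
Proof.
move=> e2 Xx Xx' Yy Yy'; set a := x' - x; set b := y' - y.
pose phi : R -> R := e \*: (fun s : R => h (x + s *: a) (y + s *: b) : R^o).
pose phi' (s : R) := e * (dotp (gradx h (x + s *: a) (y + s *: b)) a +
  dotp (grady h (x + s *: a) (y + s *: b)) b).
have XYs (s : R) : 0 <= s <= 1 -> X (x + s *: a) /\ Y (y + s *: b).
  by move=> s01; split; [exact: Xseg|exact: Yseg].
have dphi (s : R) : 0 <= s <= 1 -> is_derive s 1 phi (phi' s).
  move=> /XYs[Xs Ys]; have := is_derive_line (h_diff Xs Ys) => dh.
  exact: is_deriveZ.
have := taylor1_le (K := L * (enorm a ^+ 2 + enorm b ^+ 2)) dphi.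
have phiE s : phi s = e * h (x + s *: a) (y + s *: b) by [].
rewrite !phiE /phi' !scale0r !addr0 !scale1r.
have -> : x + a = x' by rewrite addrC subrK.
have -> : y + b = y' by rewrite addrC subrK.
move=> h1; rewrite [leRHS]mulrAC; apply: le_trans (h1 _); first by lra.
move=> s s01; have [Xs Ys] := XYs s s01; rewrite -mulrBr.
have -> : dotp (gradx h (x + s *: a) (y + s *: b)) a + dotp (grady h (x + s *: a) (y + s *: b)) b
  - (dotp (gradx h x y) a + dotp (grady h x y) b) =
  dotp (gradxy h (x + s *: a) (y + s *: b) - gradxy h x y) (row_mx a b).
  by rewrite dotpBl /gradxy !dotp_row_mx; ring.
rewrite -dotpZl; apply: le_trans (dotp_le _ _) _.
have e1 : `|e| = 1.
  by apply/eqP; rewrite -(@eqrXn2 _ 2)// ?real_normK ?num_real// e2 expr1n.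
rewrite enormZ e1 mul1r -sqr_enorm_row_mx expr2 mulrAC mulrA.
rewrite ler_wpM2r ?enorm_ge0//.
apply: le_trans (h_lip Xs Xx Ys Yy) _; rewrite -mulrA ler_wpM2l ?(ltW L_gt0)//.
rewrite opp_row_mx add_row_mx [x + _]addrC addrK [y + _]addrC addrK.
rewrite -scale_row_mx enormZ ger0_norm; last by case/andP: s01.
by rewrite mulrC.
Qed.

Lemma smooth_ub x x' y y' : X x -> X x' -> Y y -> Y y' ->
  h x' y' <= h x y + dotp (gradx h x y) (x' - x) + dotp (grady h x y) (y' - y)
  + L / 2 * (enorm (x' - x) ^+ 2 + enorm (y' - y) ^+ 2).
Proof.
by move=> Xx Xx' Yy Yy'; have := smooth_le (expr1n _ 2) Xx Xx' Yy Yy'; lra.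
Qed.

Lemma smooth_lb x x' y y' : X x -> X x' -> Y y -> Y y' ->
  h x y + dotp (gradx h x y) (x' - x) + dotp (grady h x y) (y' - y)
  - L / 2 * (enorm (x' - x) ^+ 2 + enorm (y' - y) ^+ 2) <= h x' y'.
Proof.
move=> Xx Xx' Yy Yy'.
have e2 : (-1) ^+ 2 = 1 :> R by rewrite sqrrN expr1n.
by have := smooth_le e2 Xx Xx' Yy Yy'; lra.
Qed.

Lemma continuous_y x : X x -> {within Y, continuous (h x)}.
Proof.
move=> Xx; apply: continuous_in_subspaceT => y; rewrite inE => Yy.
have := differentiable_continuous (h_diff Xx Yy).
move=> hc; apply: (@continuous_comp _ _ _ (fun y => (x, y)) (fun p => h p.1 p.2)) => //.
move=> A [[B C] [/= Bx Cy] BCA]; apply: filterS Cy => y' Cy'.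
by apply: BCA; split=> //=; exact: nbhs_singleton.
Qed.

(** When [Y] is the whole space, strong concavity takes over the role of compactness. *)
Lemma ystarP x : X x ->
  Y (ystar Y h x) /\ forall y, Y y -> h x y <= h x (ystar Y h x).
Proof.
move=> Xx; apply: (getPex (P := [set y | Y y /\ forall y', Y y' -> h x y' <= h x y])).
have [[cY _]|YT] := Y_proj.
  have [y yY ymax] := EVT_max_rV Y_neq0 cY (continuous_y Xx).
  by exists y; split=> [|y' Yy']; [exact: set_mem|exact/ymax/mem_set].
have YY y : Y y by rewrite YT.
(* Strong concavity based at 0 gives h x y <= h x 0 + |g| |y| - (tau / 2) |y|^2, which is at most h
   x 0 once |y| exceeds [r]. A maximum over the ball is therefore global. *)
pose g := grady h x 0; pose r := 2 * enorm g / tau.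
have r0 : 0 <= r by rewrite divr_ge0 ?mulr_ge0 ?enorm_ge0// ltW.
pose B := [set y : 'rV[R]_d2 | enorm y <= r].
have B0 : B 0 by rewrite /B/= enorm0.
have cB : compact B.
  apply: bounded_closed_compact.
    exists r; split; first exact: num_real.
    move=> M rM y /= By; apply: (le_trans (mx_norm_le_enorm y)).
    exact: le_trans By (ltW rM).
  rewrite (_ : B = (fun y => enorm (0 - y)) @^-1` [set t | t <= r]).
    by apply: closed_comp => [y _|]; [exact: enorm_dist_continuous|exact: closed_le].
  by apply/seteqP; split => y; rewrite /B/= sub0r enormN.
have [|y yB ymax] := EVT_max_rV (ex_intro _ _ B0) cB (f := h x).
  by apply: continuous_subspaceW (continuous_y Xx) => y _; exact: YY.
exists y; split=> // y' _; have [y'B|y'B] := pselect (B y').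
  exact/ymax/mem_set.
apply: le_trans (ymax 0 (mem_set B0)).
apply: (le_trans (h_sc Xx (YY y') (YY 0))).
move: y'B; rewrite /B/= => /negP; rewrite -ltNge /r ltr_pdivrMr// => ry.
have := dotp_le g y'; rewrite -/g !subr0; have := enorm_ge0 y'; nra.
Qed.

Let yst x := ystar Y h x.
Let F x := Fmax Y h x.

(** If [d] were positive, a short step towards [y] would gain s d to first order and lose at most
    half of it by smoothness, contradicting maximality. *)
Lemma ystar_optimality x y : X x -> Y y ->
  dotp (grady h x (yst x)) (y - yst x) <= 0.
Proof.
move=> Xx Yy; have [Ys smax] := ystarP Xx; rewrite -/(yst x) in Ys smax.
rewrite leNgt; apply/negP => d0; set d := dotp _ _ in d0.
have [/enorm_eq0 qp0|qp0] := eqVneq (enorm (y - yst x)) 0.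
  by move: d0; rewrite /d qp0 dotp0r ltxx.
have N0 : 0 < L * enorm (y - yst x) ^+ 2.
  by rewrite mulr_gt0// exprn_gt0// lt_def qp0 enorm_ge0.
pose s := Num.min 1 (d / (L * enorm (y - yst x) ^+ 2)).
have s0 : 0 < s by rewrite lt_min ltr01 divr_gt0.
have s1 : s <= 1 by rewrite ge_min lexx.
have sd : s * (L * enorm (y - yst x) ^+ 2) <= d.
  by rewrite -ler_pdivlMr// ge_min lexx orbT.
have Ysy : Y (yst x + s *: (y - yst x)) by apply: Yseg; rewrite // (ltW s0).
have := smooth_lb Xx Xx Ys Ysy; have := smax _ Ysy.
have -> : yst x + s *: (y - yst x) - yst x = s *: (y - yst x).
  by rewrite addrAC subrr add0r.
rewrite subrr dotp0r enorm0 expr0n/= addr0 add0r.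
rewrite dotpZr -/d enormZ gtr0_norm// exprMn.
suff : s * (s * (L * enorm (y - yst x) ^+ 2)) < s * (2 * d) by lra.
by rewrite ltr_pM2l//; lra.
Qed.

Lemma ystar_gap x y : X x -> Y y ->
  h x y <= h x (yst x) - tau / 2 * enorm (y - yst x) ^+ 2.
Proof.
move=> Xx Yy; have [Ys _] := ystarP Xx.
by have := h_sc Xx Yy Ys; have := ystar_optimality Xx Yy; rewrite -/(yst x); lra.
Qed.

(** Quadratic growth and strong concavity at x' bound tau n^2, with n the distance of the two
    maximizers, by the product of the y-gradient at (x', y*(x)) with y*(x') - y*(x). Subtracting the
    optimality condition at x turns this gradient into a difference of norm at most L |x - x'|. *)
Lemma ystar_lip x x' : X x -> X x' ->
  enorm (yst x - yst x') <= L / tau * enorm (x - x').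
Proof.
move=> Xx Xx'; have [Ys _] := ystarP Xx; have [Ys' _] := ystarP Xx'.
rewrite -/(yst x) in Ys; rewrite -/(yst x') in Ys'.
have [->|n0] := eqVneq (enorm (yst x - yst x')) 0.
  by rewrite mulr_ge0 ?enorm_ge0 ?divr_ge0// ltW.
have np : 0 < enorm (yst x - yst x') by rewrite lt_def n0 enorm_ge0.
rewrite mulrAC ler_pdivlMr// -(ler_pM2r np).
have h1 := ystar_gap Xx' Ys; have h2 := h_sc Xx' Ys' Ys.
have h3 := ystar_optimality Xx Ys'.
have h4 := dotp_le (grady h x' (yst x) - grady h x (yst x)) (yst x' - yst x).
have h5 := grady_lip_x Xx' Xx Ys.
rewrite dotpBl in h4; rewrite (enormC (yst x')) in h2 h4; rewrite (enormC x') in h5.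
have h6 : enorm (grady h x' (yst x) - grady h x (yst x)) * enorm (yst x - yst x') <=
  L * enorm (x - x') * enorm (yst x - yst x') by rewrite ler_wpM2r ?enorm_ge0.
have -> : enorm (yst x - yst x') * tau * enorm (yst x - yst x') =
  tau * enorm (yst x - yst x') ^+ 2 by ring.
lra.
Qed.

Let Lg := L + L ^+ 2 / tau.

(** Danskin's theorem with a quadratic remainder. The expansion is made at (x, y*(x')). Passing to
    the gradient at y*(x) costs L n e, with n the distance of the maximizers and e = |x' - x|; the
    loss (tau / 2) n^2 of the suboptimal y*(x') pays for it, up to L^2 e^2 / (2 tau). *)
Lemma Fmax_ub x x' : X x -> X x' ->
  F x' <= F x + dotp (gradx h x (yst x)) (x' - x) + Lg / 2 * enorm (x' - x) ^+ 2.
Proof.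
move=> Xx Xx'; have [Ys _] := ystarP Xx; have [Ys' _] := ystarP Xx'.
rewrite -/(yst x) in Ys; rewrite -/(yst x') in Ys'.
have h1 := smooth_ub Xx Xx' Ys' Ys'; have h2 := ystar_gap Xx Ys'.
rewrite subrr dotp0r enorm0 expr0n/= !addr0 in h1.
have h3 := dotp_le (gradx h x (yst x') - gradx h x (yst x)) (x' - x).
have h4 := gradx_lip_y Xx Ys' Ys.
have h5 : enorm (gradx h x (yst x') - gradx h x (yst x)) * enorm (x' - x) <=
  L * enorm (yst x' - yst x) * enorm (x' - x) by rewrite ler_wpM2r ?enorm_ge0.
rewrite dotpBl in h3.
set n := enorm (yst x' - yst x) in h2 h5; set e := enorm (x' - x) in h1 h3 h5 *.
have h6 : L * n * e - tau / 2 * n ^+ 2 <= L ^+ 2 / tau / 2 * e ^+ 2.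
  rewrite -subr_ge0.
  have -> : L ^+ 2 / tau / 2 * e ^+ 2 - (L * n * e - tau / 2 * n ^+ 2) =
    (L * e - tau * n) ^+ 2 / (2 * tau) by field; rewrite gt_eqF.
  by rewrite divr_ge0 ?sqr_ge0// mulr_ge0// ltW.
rewrite /F /Fmax -/(yst x) -/(yst x') /Lg; lra.
Qed.

Lemma Fmax_lb x x' : X x -> X x' ->
  F x + dotp (gradx h x (yst x)) (x' - x) - L / 2 * enorm (x' - x) ^+ 2 <= F x'.
Proof.
move=> Xx Xx'; have [Ys _] := ystarP Xx; have [_ smax'] := ystarP Xx'.
have := smooth_lb Xx Xx' Ys Ys; have := smax' _ Ys.
rewrite subrr dotp0r enorm0 expr0n/= !addr0 /F /Fmax -/(yst x) -/(yst x'); lra.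
Qed.

Lemma Fmax_is_grad_on x : X x -> is_grad_on X F x (gradx h x (yst x)).
Proof.
move=> Xx e e0; rewrite near_withinE.
have LL : L <= Lg by rewrite lerDl divr_ge0 ?sqr_ge0// ltW.
have Lg0 : 0 < Lg by exact: lt_le_trans LL.
have d0 : 0 < 2 * e / Lg by rewrite divr_gt0// mulr_gt0.
apply: filterS (near_enorm x d0) => x' xx' Xx'.
have h1 := Fmax_ub Xx Xx'; have h2 := Fmax_lb Xx Xx'.
have h3 : Lg / 2 * enorm (x' - x) ^+ 2 <= e * enorm (x' - x).
  rewrite expr2 mulrA ler_wpM2r ?enorm_ge0//.
  by move: xx'; rewrite ltr_pdivlMr//; lra.
have h4 : L / 2 * enorm (x' - x) ^+ 2 <= Lg / 2 * enorm (x' - x) ^+ 2.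
  by rewrite ler_wpM2r ?sqr_ge0// ler_wpM2r.
by rewrite ler_norml; apply/andP; split; lra.
Qed.

(** [X] may have empty interior, so a gradient relative to [X] is determined only along directions
    that stay in [X]. There the two linearizations are compared on arbitrarily short segments. *)
Lemma is_grad_on_unique x (g g' : 'rV[R]_d1) x' : X x -> X x' ->
  is_grad_on X F x g -> is_grad_on X F x g' -> dotp (g - g') (x' - x) = 0.
Proof.
move=> Xx Xx' Fg Fg'.
apply/eqP; rewrite -normr_eq0 eq_le normr_ge0 andbT; apply/ler_addgt0Pr => e e0.
rewrite add0r; pose n := enorm (x' - x).
pose e1 := e / (2 * (n + 1)).
have n0 : 0 <= n := enorm_ge0 _.
have e10 : 0 < e1 by rewrite divr_gt0// mulr_gt0// ltr_wpDl.
have := Fg _ e10; have := Fg' _ e10; rewrite !near_withinE => H' H.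
have HH : nbhs x [set z | (X z -> `|F z - F x - dotp g (z - x)| <= e1 * enorm (z - x)) /\
    (X z -> `|F z - F x - dotp g' (z - x)| <= e1 * enorm (z - x))].
  exact: filterI H H'.
have [r /= r0 rB] := (nbhs_ballP _ _).1 HH.
pose s := Num.min 1 (r / 2 / (n + 1)).
have s0 : 0 < s by rewrite lt_min ltr01 !divr_gt0// ltr_wpDl.
have s1 : s <= 1 by rewrite ge_min lexx.
have Xs : X (x + s *: (x' - x)) by apply: Xseg; rewrite // (ltW s0).
have [] := rB (x + s *: (x' - x)).
  rewrite -ball_normE/= opprD addrA subrr add0r normrN.
  apply: (le_lt_trans (mx_norm_le_enorm _)); rewrite enormZ gtr0_norm// -/n.
  apply: (@le_lt_trans _ _ (r / 2)); last by rewrite ltr_pdivrMr// ltr_pMr// ltr1n.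
  apply: (@le_trans _ _ (s * (n + 1))); first by rewrite ler_wpM2l ?ltW// ltrDl.
  by rewrite -ler_pdivlMr ?ltr_wpDl// ge_min lexx orbT.
move=> /(_ Xs) h1 /(_ Xs) h2.
have E : x + s *: (x' - x) - x = s *: (x' - x) by rewrite addrAC subrr add0r.
rewrite E !dotpZr !enormZ (gtr0_norm s0) -/n in h1 h2.
have h3 : s * `|dotp (g - g') (x' - x)| <= s * (2 * (e1 * n)).
  rewrite -{1}(gtr0_norm s0) -normrM dotpBl.
  set G := F (x + _) in h1 h2.
  have -> : s * (dotp g (x' - x) - dotp g' (x' - x)) =
    (G - F x - s * dotp g' (x' - x)) - (G - F x - s * dotp g (x' - x)) by ring.
  apply: le_trans (ler_normB _ _) _.
  have -> : s * (2 * (e1 * n)) = e1 * (s * n) + e1 * (s * n) by ring.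
  exact: (lerD h2 h1).
rewrite ler_pM2l// in h3; apply: (le_trans h3).
have n1 : 0 < n + 1 by rewrite ltr_wpDl.
have -> : e = 2 * (e1 * (n + 1)) by rewrite /e1; field; rewrite gt_eqF.
by rewrite ler_pM2l// ler_pM2l// lerDl.
Qed.

(** Whichever relative gradient [grad_on] picks, it differs from Danskin's gradient by a vector that
    the projection does not see. *)
Lemma eproj_grad_on x gam : X x ->
  eproj X (x - gam *: grad_on X F x) = eproj X (x - gam *: gradx h x (yst x)).
Proof.
move=> Xx; apply: eproj_dotp_eq => // q q' Xq Xq'.
have gP : is_grad_on X F x (grad_on X F x).
  by apply: (getPex (P := is_grad_on X F x)); exists (gradx h x (yst x)); exact: Fmax_is_grad_on.
have u z (Xz : X z) := is_grad_on_unique Xx Xz gP (Fmax_is_grad_on Xx).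
have -> : x - gam *: grad_on X F x - (x - gam *: gradx h x (yst x)) =
  - gam *: (grad_on X F x - gradx h x (yst x)).
  by rewrite opprB addrC addrA subrK scaleNr -scalerN opprB scalerBr.
rewrite dotpZl; have -> : q - q' = (q - x) - (q' - x) by rewrite opprB addrA subrK.
by rewrite dotpBr !u// subrr mulr0.
Qed.

(** Nonexpansiveness bounds the effect of replacing [v] by the gradient of F by their distance,
    which splits at [gradx h x y] into the estimation error and L |y - y*(x)|. *)
Lemma Gmap_le_Hmeasure x xt v y gam : X x -> Y y -> 0 < gam ->
  xt = eproj X (x - gam *: v) ->
  enorm (Gmap X x (grad_on X F x) gam) <= Hmeasure h Y gam L x xt v y.
Proof.
move=> Xx Yy g0 ->; have [Ys _] := ystarP Xx; rewrite -/(yst x) in Ys.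
rewrite /Gmap /Hmeasure -/(yst x) eproj_grad_on// enormZ gtr0_norm ?invr_gt0//.
set p := eproj X (x - gam *: gradx h x (yst x)); set p' := eproj X (x - gam *: v).
have h1 : enorm (x - p) <= enorm (p' - x) + enorm (p' - p).
  have -> : x - p = (x - p') + (p' - p) by rewrite addrA subrK.
  by rewrite (enormC p' x); exact: enormD.
have h2 : enorm (p' - p) <= gam * enorm (gradx h x (yst x) - v).
  apply: le_trans (eproj_nonexpansive X_proj X_neq0 _ _) _.
  have -> : x - gam *: v - (x - gam *: gradx h x (yst x)) =
    gam *: (gradx h x (yst x) - v).
    by rewrite opprB addrC addrA subrK scalerBr.
  by rewrite enormZ gtr0_norm.
have h3 : enorm (gradx h x (yst x) - v) <= enorm (gradx h x y - v) + L * enorm (y - yst x).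
  have -> : gradx h x (yst x) - v = (gradx h x y - v) + (gradx h x (yst x) - gradx h x y).
    by rewrite [RHS]addrC addrA subrK.
  apply: le_trans (enormD _ _) _; rewrite lerD2l enormC.
  exact: gradx_lip_y.
rewrite -(ler_pM2l g0) mulrA divff ?gt_eqF// mul1r !mulrDr mulrA divff ?gt_eqF// mul1r.
apply: (le_trans h1); rewrite -addrA lerD2l -mulrDr; apply: (le_trans h2).
by rewrite ler_pM2l.
Qed.

(** The obtuse angle criterion contributes -|d|^2 / gam to the quadratic bound on F. One quarter
    absorbs Young's inequality for the gradient error, another the curvature term (by the condition
    on eta gam), and half remains. *)
Lemma x_step_descent x v y gam eta : X x -> Y y -> 0 < gam -> 0 <= eta <= 1 ->
  2 * Lg * eta * gam <= 1 ->
  forall xt, xt = eproj X (x - gam *: v) ->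
  F (x + eta *: (xt - x)) <= F x + eta * (2 * gam * L ^+ 2 * enorm (y - yst x) ^+ 2
    + 2 * gam * enorm (gradx h x y - v) ^+ 2 - enorm (xt - x) ^+ 2 / (2 * gam)).
Proof.
move=> Xx Yy g0 eta01 Lgg xt xtE; have /andP[eta0 eta1] := eta01.
have Xxt : X xt by rewrite xtE; exact: eproj_in.
have [Ys _] := ystarP Xx; rewrite -/(yst x) in Ys.
have := Fmax_ub Xx (Xseg Xx Xxt eta01).
set d := xt - x; have -> : x + eta *: d - x = eta *: d by rewrite addrAC subrr add0r.
rewrite dotpZr enormZ exprMn real_normK ?num_real//.
have := eproj_variational X_proj X_neq0 (x - gam *: v) Xx; rewrite -xtE.
have -> : dotp (x - gam *: v - xt) (x - xt) = enorm d ^+ 2 + gam * dotp v d.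
  rewrite sqr_enorm -(opprB xt x) -/d; have -> : x - gam *: v - xt = - d - gam *: v.
    by rewrite opprB addrAC.
  by rewrite dotpNr dotpBl dotpNl dotpZl opprB opprK addrC.
move=> hv.
have hy := dotp_young (gradx h x (yst x) - v) d g0.
have hs : enorm (gradx h x (yst x) - v) ^+ 2 <=
    2 * enorm (gradx h x y - v) ^+ 2 + 2 * (L ^+ 2 * enorm (y - yst x) ^+ 2).
  have -> : gradx h x (yst x) - v = (gradx h x y - v) + (gradx h x (yst x) - gradx h x y).
    by rewrite [RHS]addrC addrA subrK.
  apply: le_trans (sqr_enormD_le _ _) _; rewrite lerD2l ler_wpM2l// -exprMn.
  rewrite ler_pXn2r ?nnegrE ?mulr_ge0 ?enorm_ge0 ?(ltW L_gt0)// enormC.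
  exact: gradx_lip_y.
rewrite dotpBl in hy; set D := enorm d ^+ 2 in hv hy *.
have D0 : 0 <= D by exact: sqr_ge0.
have hL : Lg / 2 * (eta ^+ 2 * D) <= eta * (D / (4 * gam)).
  have -> : eta * (D / (4 * gam)) = eta * D * 1 / (4 * gam) by rewrite mulr1 mulrA.
  rewrite ler_pdivlMr ?mulr_gt0//.
  have -> : Lg / 2 * (eta ^+ 2 * D) * (4 * gam) = eta * D * (2 * Lg * eta * gam) by field.
  by rewrite ler_wpM2l// mulr_ge0.
move=> hF; apply: (le_trans hF).
have gs : gam * enorm (gradx h x (yst x) - v) ^+ 2 <=
    gam * (2 * enorm (gradx h x y - v) ^+ 2 + 2 * (L ^+ 2 * enorm (y - yst x) ^+ 2)).
  by rewrite ler_pM2l.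
have hd := ler_wpM2l eta0 (x_step_arith g0 hv hy gs).
rewrite -addrA lerD2l; apply: (le_trans (lerD hd hL)); rewrite -mulrDr subrK.
apply: ler_wpM2l => //; rewrite lerD2r le_eqVlt; apply/predU1P; left; ring.
Qed.

(** The two strong concavity inequalities add up to tau |y - y'|^2 <= L |y - y'|^2. *)
Lemma singleton_y x y y' : X x -> L < tau -> Y y -> Y y' -> y = y'.
Proof.
move=> Xx Lt Yy Yy'.
have h1 := h_sc Xx Yy Yy'; have h2 := h_sc Xx Yy' Yy.
have h3 := dotp_le (grady h x y' - grady h x y) (y - y').
have h4 : enorm (grady h x y' - grady h x y) <= L * enorm (y - y').
  have := sqr_grad_lip Xx Xx Yy' Yy.
  rewrite !subrr enorm0 expr0n/= add0r -exprMn => le2.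
  rewrite -(ler_pXn2r (n := 2)) ?nnegrE ?mulr_ge0 ?enorm_ge0 ?(ltW L_gt0)//.
  by rewrite (enormC y y'); apply: le_trans le2; rewrite lerDr sqr_ge0.
have h5 : enorm (grady h x y' - grady h x y) * enorm (y - y') <=
   L * enorm (y - y') * enorm (y - y') by rewrite ler_wpM2r ?enorm_ge0.
rewrite (enormC y') -(opprB y y') dotpNr in h2; rewrite dotpBl in h3.
apply/subr0_eq/enorm_eq0/eqP; rewrite -(sqrf_eq0 (enorm _)) eq_le sqr_ge0 andbT.
rewrite -(ler_pM2l (_ : 0 < tau - L)) ?subr_gt0// mulr0.
lra.
Qed.

(** Progress towards y*(x) with x frozen: the projection inequality tested at y*(x), strong
    concavity, smoothness, and Young's inequality with weight 1 / tau for the gradient error. *)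
Lemma y_step_fixed x y w lam eta : X x -> Y y -> tau <= L -> 0 < lam ->
  0 <= eta <= 1 -> 6 * L * lam <= 1 ->
  forall yt, yt = eproj Y (y + lam *: w) ->
  enorm (y + eta *: (yt - y) - yst x) ^+ 2 <=
    (1 - eta * tau * lam / 2) * enorm (y - yst x) ^+ 2
    - 3 * eta / 4 * enorm (yt - y) ^+ 2
    + 4 * eta * lam / tau * enorm (grady h x y - w) ^+ 2.
Proof.
move=> Xx Yy tL l0 eta01 Ll yt ytE; have /andP[eta0 eta1] := eta01.
have Yyt : Y yt by rewrite ytE; exact: eproj_in.
have [Ys smax] := ystarP Xx; rewrite -/(yst x) in Ys smax.
set c := yst x - y; set d := yt - y.
have h1 : lam * dotp w (c - d) <= dotp d c - enorm d ^+ 2.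
  have := eproj_variational Y_proj Y_neq0 (y + lam *: w) Ys; rewrite -ytE.
  have -> : y + lam *: w - yt = lam *: w - d by rewrite /d opprB [RHS]addrA (addrC y).
  have -> : yst x - yt = c - d by rewrite /c /d opprB addrA subrK.
  rewrite dotpBl dotpZl dotpBr [dotp d (c - d)]dotpBr -sqr_enorm dotpBr; lra.
have h2 := h_sc Xx Ys Yy; have h3 := smooth_lb Xx Xx Yy Yyt.
rewrite -/c -/d subrr dotp0r enorm0 expr0n/= addr0 add0r in h2 h3.
have h4 := smax _ Yyt.
have tV0 : 0 < tau^-1 by rewrite invr_gt0.
have h5 := dotp_young (grady h x y - w) c tV0.
have h6 := dotp_young (grady h x y - w) (- d) tV0.
rewrite enormN in h6.
have -> : y + eta *: d - yst x = eta *: d - c by rewrite /c opprB [RHS]addrA (addrC y).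
rewrite (sqr_enormB (eta *: d)) enormZ exprMn dotpZl real_normK ?num_real// (enormC y) -/c.
set A := enorm c ^+ 2 in h2 h5 *; set Q := enorm d ^+ 2 in h1 h3 h6 *.
set g := enorm _ ^+ 2 in h5 h6 *.
have A0 : 0 <= A by exact: sqr_ge0.
have Q0 : 0 <= Q by exact: sqr_ge0.
have e1 (z : R) : z / (4 * tau^-1) = tau * z / 4 by field; rewrite gt_eqF.
rewrite !e1 dotpNr in h5 h6.
rewrite dotpBl in h5; rewrite dotpBl in h6; rewrite dotpBr in h1.
exact: (y_step_arith l0 tau_gt0 tL Ll eta01 Q0 h1 h2 h3 h4 h5 h6).
Qed.

(** The target moves from y*(x) to y*(x'). With s = eta tau lam, Young's inequality of weight s / 4
    spends half of the contraction 1 - s / 2, and the drift of the target is controlled by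
    [ystar_lip]. *)
Lemma y_step x y w a lam eta : X x -> X a -> Y y -> 0 < lam ->
  0 < eta <= 1 -> 6 * L * lam <= 1 ->
  forall yt, yt = eproj Y (y + lam *: w) ->
  enorm (y + eta *: (yt - y) - yst (x + eta *: (a - x))) ^+ 2 <=
    (1 - eta * tau * lam / 4) * enorm (y - yst x) ^+ 2
    - 3 * eta / 4 * enorm (yt - y) ^+ 2
    + 25 * eta * lam / (6 * tau) * enorm (grady h x y - w) ^+ 2
    + 25 * (L / tau) ^+ 2 * eta / (6 * tau * lam) * enorm (a - x) ^+ 2.
Proof.
move=> Xx Xa Yy l0 /andP[eta0 eta1] Ll yt ytE.
have eta01 : 0 <= eta <= 1 by rewrite (ltW eta0).
have Yyt : Y yt by rewrite ytE; exact: eproj_in.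
set x' := x + eta *: (a - x); have Xx' : X x' by exact: Xseg.
have [Ys _] := ystarP Xx; rewrite -/(yst x) in Ys.
have [Ys' _] := ystarP Xx'; rewrite -/(yst x') in Ys'.
have k0 : 0 <= 25 * (L / tau) ^+ 2 * eta / (6 * tau * lam).
  have t0 := ltW tau_gt0; have l0' := ltW l0; have eta0' := ltW eta0.
  by rewrite divr_ge0// mulr_ge0// mulr_ge0// sqr_ge0.
have k1 : 0 <= 25 * eta * lam / (6 * tau).
  by rewrite divr_ge0// ?mulr_ge0// ltW.
(* If L < tau, then [Y] is a single point and all distances in [Y] vanish. Otherwise tau <= L, and 6
   L lam <= 1 bounds s by 1/6. *)
have [Lt|tL] := ltP L tau.
  rewrite (singleton_y Xx Lt Yyt Yy) subrr scaler0 addr0.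
  rewrite (singleton_y Xx Lt Ys' Yy) (singleton_y Xx Lt Ys Yy) subrr enorm0 expr0n/=.
  by rewrite !mulr0 subr0 add0r addr_ge0// mulr_ge0// sqr_ge0.
have := y_step_fixed Xx Yy tL l0 eta01 Ll ytE.
set y' := y + _; set A := enorm (y - yst x) ^+ 2; set Q := enorm (yt - y) ^+ 2.
set g := enorm (grady h x y - w) ^+ 2; set B := enorm (y' - yst x) ^+ 2 => hB.
have A0 : 0 <= A by exact: sqr_ge0. have Q0 : 0 <= Q by exact: sqr_ge0.
have g0 : 0 <= g by exact: sqr_ge0.
pose s := eta * tau * lam.
have s0 : 0 < s by rewrite !mulr_gt0.
have s6 : s <= 1 / 6.
  have : eta * tau * lam <= 1 * (L * lam).
    by rewrite -mulrA ler_pM// ?mulr_ge0 ?(ltW tau_gt0) ?(ltW l0) ?(ltW eta0)// ler_pM2r.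
  rewrite -/s; lra.
have s4 : 0 < s / 4 by rewrite divr_gt0.
have -> : y' - yst x' = (y' - yst x) + (yst x - yst x') by rewrite addrA subrK.
apply: le_trans (sqr_enormD_young _ _ s4) _; rewrite -/B.
have hB' : (1 + s / 4) * B <= (1 - s / 4) * A - 3 * eta / 4 * Q
    + 25 * eta * lam / (6 * tau) * g.
  have -> : 25 * eta * lam / (6 * tau) * g = 25 / 6 * (eta * lam / tau * g).
    by field; rewrite gt_eqF.
  apply: y_step_arith2 => //.
  - by rewrite (ltW s0).
  - by rewrite mulr_ge0// ltW.
  - by rewrite mulr_ge0// divr_ge0 ?mulr_ge0// ltW.
  - have -> : 4 * (eta * lam / tau * g) = 4 * eta * lam / tau * g.
      by field; rewrite gt_eqF.
    exact: hB.
have hs : (1 + (s / 4)^-1) * enorm (yst x - yst x') ^+ 2 <=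
    25 * (L / tau) ^+ 2 * eta / (6 * tau * lam) * enorm (a - x) ^+ 2.
  have hlip := ystar_lip Xx Xx'.
  rewrite /x' opprD addrA subrr add0r enormN enormZ (gtr0_norm eta0) -/x' in hlip.
  have hl2 : enorm (yst x - yst x') ^+ 2 <= (L / tau * (eta * enorm (a - x))) ^+ 2.
    rewrite ler_pXn2r ?nnegrE ?enorm_ge0//.
    by rewrite mulr_ge0 ?divr_ge0 ?mulr_ge0 ?enorm_ge0 ?(ltW L_gt0) ?(ltW tau_gt0) ?(ltW eta0).
  have s1 : 0 <= 1 + (s / 4)^-1 by rewrite addr_ge0// invr_ge0 ltW.
  apply: (le_trans (ler_wpM2l s1 hl2)); rewrite !exprMn.
  set W := enorm _ ^+ 2; have W0 : 0 <= W by exact: sqr_ge0.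
  have -> : (1 + (s / 4)^-1) * ((L ^+ 2 * tau^-1 ^+ 2) * (eta ^+ 2 * W)) =
    (L ^+ 2 * tau^-1 ^+ 2) * W * ((1 + (s / 4)^-1) * eta ^+ 2) by ring.
  have -> : 25 * (L ^+ 2 * tau^-1 ^+ 2) * eta / (6 * tau * lam) * W =
    (L ^+ 2 * tau^-1 ^+ 2) * W * (25 / 6 * (eta / (tau * lam))).
    by field; rewrite !gt_eqF.
  apply: ler_wpM2l; first by rewrite mulr_ge0// mulr_ge0 ?sqr_ge0.
  (* Since s <= 1/6, the factor s + 4 is at most 25/6, the origin of this constant. *)
  have -> : (1 + (s / 4)^-1) * eta ^+ 2 = (s + 4) * (eta / (tau * lam)).
    by rewrite /s; field; rewrite !gt_eqF.
  apply: ler_wpM2r; first by rewrite divr_ge0 ?mulr_ge0// ltW.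
  lra.
by rewrite -/s; apply: lerD.
Qed.

End minimax.

(** * Stochastic gradients are measurable and unbiased *)

Lemma row_subE {R : realType} n (u v : 'rV[R]_n) c : (u - v) 0 c = u 0 c - v 0 c.
Proof. by rewrite !mxE. Qed.

Lemma Rintegral_prob_cst d (T : measurableType d) {R : realType}
    (P : probability T R) (k : R) : \int[P]_z k = k.
Proof.
by rewrite /Rintegral integral_cst// [X in (_ * X)%E]probability_setT mule1.
Qed.

(** The directional derivative along (a, b) wherever [h] is differentiable. *)
Definition dirgrad {R : realType} {d1 d2 : nat} (h : 'rV[R]_d1 -> 'rV[R]_d2 -> R)
    x y a b : R :=
  dotp (gradx h x y) a + dotp (grady h x y) b.

Section unbiased_gradients.
Context {R : realType} {d1 d2 : nat} {dXi : measure_display}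
  {Xi : measurableType dXi} (D : probability Xi R).
Variables (f : Xi -> 'rV[R]_d1 -> 'rV[R]_d2 -> R).
Variables (U : set ('rV[R]_d1 * 'rV[R]_d2)) (delta : R).
Hypothesis U_open : open U.
Hypothesis f_int : forall u, U u -> D.-integrable setT (fun z => (f z u.1 u.2)%:E).
Hypothesis f_diff : forall z u, U u -> differentiable (fun p => f z p.1 p.2) u.
Hypothesis fmean_diff : forall u, U u -> differentiable (fun p => fmean D f p.1 p.2) u.
Hypothesis C1x : forall u, U u ->
  ('E_D[fun z => (enorm (gradx (f z) u.1 u.2 - gradx (fmean D f) u.1 u.2) ^+ 2)%R]
      <= (delta ^+ 2)%:E)%E.
Hypothesis C1y : forall u, U u ->
  ('E_D[fun z => (enorm (grady (f z) u.1 u.2 - grady (fmean D f) u.1 u.2) ^+ 2)%R]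
      <= (delta ^+ 2)%:E)%E.

Lemma open_segment x y a b : U (x, y) ->
  exists2 r : R, 0 < r & forall s, 0 <= s <= r -> U (x + s *: a, y + s *: b).
Proof.
move=> Uxy; have /nbhs_ballP[r /= r0 rU] := open_nbhs_nbhs (conj U_open Uxy).
pose c := enorm a + enorm b + 1.
have c0 : 0 < c by rewrite ltr_wpDl ?addr_ge0 ?enorm_ge0.
exists (r / 2 / c) => [|s /andP[s0 sr]]; first by rewrite !divr_gt0.
have sc : s * c < r.
  rewrite (@le_lt_trans _ _ (r / 2)) ?ltr_pdivrMr ?ltr_pMr ?ltr1n//.
  by rewrite -ler_pdivlMr.
apply: rU; split; rewrite -ball_normE/= opprD addrA subrr add0r normrN.
  apply: (le_lt_trans (mx_norm_le_enorm _)); rewrite enormZ ger0_norm//.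
  apply: le_lt_trans sc; rewrite ler_wpM2l// /c.
  by rewrite -addrA lerDl addr_ge0 ?enorm_ge0.
apply: (le_lt_trans (mx_norm_le_enorm _)); rewrite enormZ ger0_norm//.
apply: le_lt_trans sc; rewrite ler_wpM2l// /c.
by rewrite [enorm a + _]addrC -addrA lerDl addr_ge0 ?enorm_ge0.
Qed.

Lemma measurable_dirgrad x y a b : U (x, y) ->
  measurable_fun setT (fun z => dirgrad (f z) x y a b).
Proof.
move=> Uxy; have [r r0 rU] := open_segment a b Uxy.
pose g z s := f z (x + s *: a) (y + s *: b).
pose g' z s := dirgrad (f z) (x + s *: a) (y + s *: b) a b.
have -> : (fun z => dirgrad (f z) x y a b) = g'^~ 0.
  by apply/funext => z; rewrite /g' !scale0r !addr0.
apply: (measurable_derivative0 (D := D) (g := g) r0).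
  by move=> s /rU Us; exact: (f_int Us).
by move=> z s /rU Us; apply: is_derive_line; exact: (f_diff z Us).
Qed.

Lemma measurable_gradx u c : U u ->
  measurable_fun setT (fun z => gradx (f z) u.1 u.2 0 c).
Proof.
case: u => x y Uxy; have := measurable_dirgrad (delta_mx 0 c) 0 Uxy.
by rewrite /dirgrad; under eq_fun do rewrite dotp_delta dotp0r addr0.
Qed.

Lemma measurable_grady u c : U u ->
  measurable_fun setT (fun z => grady (f z) u.1 u.2 0 c).
Proof.
case: u => x y Uxy; have := measurable_dirgrad 0 (delta_mx 0 c) Uxy.
by rewrite /dirgrad; under eq_fun do rewrite dotp_delta dotp0r add0r.
Qed.

Lemma measurable_sqr_enorm d (T : measurableType d) n (Z : T -> 'rV[R]_n) :
  (forall c, measurable_fun setT (fun s => Z s 0 c)) ->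
  measurable_fun setT (fun s => enorm (Z s) ^+ 2).
Proof.
move=> mZ; under eq_fun do rewrite sqr_enormE.
by apply: measurable_sum => c; exact: measurable_funX.
Qed.

(** (C1) and Cauchy-Schwarz. The bound does not depend on the base point, as required of the
    constant in [integral_derivative0]. *)
Lemma dirgrad_variance x y a b : U (x, y) ->
  (\int[D]_z ((dirgrad (f z) x y a b - dirgrad (fmean D f) x y a b) ^+ 2)%:E <=
   (2 * delta ^+ 2 * (enorm a ^+ 2 + enorm b ^+ 2))%:E)%E.
Proof.
move=> Uxy.
pose ex z := enorm (gradx (f z) x y - gradx (fmean D f) x y) ^+ 2.
pose ey z := enorm (grady (f z) x y - grady (fmean D f) x y) ^+ 2.
have mex : measurable_fun setT (fun z => (ex z)%:E).
  apply/measurable_EFinP; apply: measurable_sqr_enorm => c.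
  under eq_fun do rewrite row_subE; apply: measurable_funB => //.
  exact: (measurable_gradx c Uxy).
have mey : measurable_fun setT (fun z => (ey z)%:E).
  apply/measurable_EFinP; apply: measurable_sqr_enorm => c.
  under eq_fun do rewrite row_subE; apply: measurable_funB => //.
  exact: (measurable_grady c Uxy).
have ex0 z : (0 <= (ex z)%:E)%E by rewrite lee_fin sqr_ge0.
have ey0 z : (0 <= (ey z)%:E)%E by rewrite lee_fin sqr_ge0.
apply: (@le_trans _ _ (\int[D]_z ((2 * enorm a ^+ 2)%:E * (ex z)%:E +
    (2 * enorm b ^+ 2)%:E * (ey z)%:E))%E).
  apply: ge0_le_integral => //.
  - by move=> z _; rewrite lee_fin sqr_ge0.
  - apply/measurable_EFinP; apply: measurable_funX; apply: measurable_funB => //.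
    exact: measurable_dirgrad.
  - by apply: emeasurable_funD; apply: measurable_funeM.
  move=> z _; rewrite -!EFinM -EFinD lee_fin.
  have -> : dirgrad (f z) x y a b - dirgrad (fmean D f) x y a b =
    dotp (gradx (f z) x y - gradx (fmean D f) x y) a +
    dotp (grady (f z) x y - grady (fmean D f) x y) b.
    by rewrite /dirgrad !dotpBl; ring.
  have sq n (u v : 'rV[R]_n) : dotp u v ^+ 2 <= enorm v ^+ 2 * enorm u ^+ 2.
    rewrite -[leLHS]real_normK ?num_real// -exprMn ler_pXn2r ?nnegrE ?mulr_ge0 ?enorm_ge0//.
    by rewrite mulrC; exact: normr_dotp_le.
  have := sq _ (gradx (f z) x y - gradx (fmean D f) x y) a.
  have := sq _ (grady (f z) x y - grady (fmean D f) x y) b.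
  rewrite -/(ex z) -/(ey z); set p := dotp _ _; set q := dotp _ _ => hp hq.
  by have := sqr_ge0 (p - q); nra.
rewrite ge0_integralD//; last 4 first.
- by move=> z _; rewrite mule_ge0// lee_fin mulr_ge0// sqr_ge0.
- exact: measurable_funeM.
- by move=> z _; rewrite mule_ge0// lee_fin mulr_ge0// sqr_ge0.
- exact: measurable_funeM.
rewrite !ge0_integralZl_EFin ?mulr_ge0 ?enorm_ge0//.
have := C1x Uxy; have := C1y Uxy; rewrite !unlock/= => hy hx.
apply: (@le_trans _ _ ((2 * enorm a ^+ 2)%:E * (delta ^+ 2)%:E +
    (2 * enorm b ^+ 2)%:E * (delta ^+ 2)%:E)%E).
  have ka0 : (0 <= (2 * enorm a ^+ 2)%:E)%E by rewrite lee_fin mulr_ge0// sqr_ge0.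
  have kb0 : (0 <= (2 * enorm b ^+ 2)%:E)%E by rewrite lee_fin mulr_ge0// sqr_ge0.
  by apply: leeD; [exact: lee_wpmul2l hx|exact: lee_wpmul2l hy].
by rewrite -!EFinM -EFinD lee_fin; lra.
Qed.

(** The difference between [f z] and its mean integrates to zero all along a short segment inside
    [U]; by [integral_derivative0] so does its derivative at the starting point. *)
Lemma dirgrad_mean x y a b : U (x, y) ->
  D.-integrable setT (fun z => (dirgrad (f z) x y a b)%:E) /\
  \int[D]_z (dirgrad (f z) x y a b) = dirgrad (fmean D f) x y a b.
Proof.
move=> Uxy; have [r r0 rU] := open_segment a b Uxy.
pose C := 2 * delta ^+ 2 * (enorm a ^+ 2 + enorm b ^+ 2).
pose F s := fmean D f (x + s *: a) (y + s *: b).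
pose g z s := f z (x + s *: a) (y + s *: b) - F s.
pose g' z s := dirgrad (f z) (x + s *: a) (y + s *: b) a b -
  dirgrad (fmean D f) (x + s *: a) (y + s *: b) a b.
have icst (k : R) : D.-integrable setT (fun=> k%:E).
  exact: finite_measure_integrable_cst.
have g'0 : \int[D]_z g' z 0 = 0.
  apply: (@integral_derivative0 _ Xi R D g g' r C) => //.
  - move=> s /rU Us.
    apply: (@eq_integrable _ _ _ _ _ _ (fun z => (f z (x + s *: a) (y + s *: b))%:E - (F s)%:E)%E) => //.
    by apply: integrableB => //; exact: (f_int Us).
  - move=> s /rU Us; have := f_int Us => /= iF; rewrite /g RintegralB//; last exact: icst.
    by rewrite Rintegral_prob_cst subrr.
  - move=> z s /rU Us; apply: is_deriveB; apply: is_derive_line.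
      exact: (f_diff z Us).
    exact: (fmean_diff Us).
  - by move=> s /rU Us; exact: dirgrad_variance.
have E z : g' z 0 = dirgrad (f z) x y a b - dirgrad (fmean D f) x y a b.
  by rewrite /g' !scale0r !addr0.
have ig' : D.-integrable setT (fun z => (dirgrad (f z) x y a b - dirgrad (fmean D f) x y a b)%:E).
  apply: (integrable_square_le (C := C)); last exact: dirgrad_variance.
  by apply: measurable_funB => //; exact: measurable_dirgrad.
have idf : D.-integrable setT (fun z => (dirgrad (f z) x y a b)%:E).
  apply: (@eq_integrable _ _ _ _ _ _ (fun z => (dirgrad (f z) x y a b
    - dirgrad (fmean D f) x y a b)%:E + (dirgrad (fmean D f) x y a b)%:E)%E) => //.
    by move=> z _; rewrite -EFinD subrK.
  exact: integrableD.
split=> //; apply/subr0_eq; rewrite -[RHS]g'0.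
under [RHS]eq_Rintegral do rewrite E.
by rewrite RintegralB//; [rewrite Rintegral_prob_cst|exact: icst].
Qed.

Lemma gradx_mean x y c : U (x, y) ->
  D.-integrable setT (fun z => (gradx (f z) x y 0 c)%:E) /\
  \int[D]_z (gradx (f z) x y 0 c) = gradx (fmean D f) x y 0 c.
Proof.
move=> Uxy; have [] := dirgrad_mean (delta_mx 0 c) 0 Uxy.
rewrite /dirgrad dotp_delta dotp0r addr0.
have E z : dotp (gradx (f z) x y) (delta_mx 0 c) + dotp (grady (f z) x y) 0
    = gradx (f z) x y 0 c by rewrite dotp_delta dotp0r addr0.
by under eq_fun do rewrite E; under eq_Rintegral do rewrite E.
Qed.

Lemma grady_mean x y c : U (x, y) ->
  D.-integrable setT (fun z => (grady (f z) x y 0 c)%:E) /\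
  \int[D]_z (grady (f z) x y 0 c) = grady (fmean D f) x y 0 c.
Proof.
move=> Uxy; have [] := dirgrad_mean 0 (delta_mx 0 c) Uxy.
rewrite /dirgrad dotp_delta dotp0r add0r.
have E z : dotp (gradx (f z) x y) 0 + dotp (grady (f z) x y) (delta_mx 0 c)
    = grady (f z) x y 0 c by rewrite dotp_delta dotp0r add0r.
by under eq_fun do rewrite E; under eq_Rintegral do rewrite E.
Qed.

(** Tested against itself, the difference [V] of the mean gradients becomes an expectation of sample
    derivatives, each at most K |V| by Cauchy-Schwarz. *)
Lemma fmean_grad_lip (L : R) x x' y y' : U (x, y) -> U (x', y') ->
  (forall z, enorm (gradxy (f z) x y - gradxy (f z) x' y')
     <= L * enorm (row_mx x y - row_mx x' y')) ->
  enorm (gradxy (fmean D f) x y - gradxy (fmean D f) x' y')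
     <= L * enorm (row_mx x y - row_mx x' y').
Proof.
move=> Uxy Uxy' hL; set V := gradxy _ x y - _; set K := L * _.
have [->|V0] := eqVneq (enorm V) 0.
  (* Any sample would do: the Lipschitz bound there shows that K is nonnegative. *)
  exact: le_trans (enorm_ge0 _) (hL point).
have Vp : 0 < enorm V by rewrite lt_def V0 enorm_ge0.
rewrite -(ler_pM2r Vp) -expr2 sqr_enorm.
pose a : 'rV[R]_d1 := lsubmx V; pose b : 'rV[R]_d2 := rsubmx V.
have Vab : V = row_mx a b by rewrite hsubmxK.
have E h : dotp (gradxy h x y - gradxy h x' y') V = dirgrad h x y a b - dirgrad h x' y' a b.
  by rewrite dotpBl Vab /gradxy !dotp_row_mx.
rewrite {1}/V E.
have [i1 <-] := dirgrad_mean a b Uxy; have [i2 <-] := dirgrad_mean a b Uxy'.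
rewrite -RintegralB//.
have icst : D.-integrable setT (fun=> (K * enorm V)%:E).
  exact: finite_measure_integrable_cst.
apply: (@le_trans _ _ (\int[D]_z (K * enorm V))).
  apply: le_Rintegral => //.
    by apply: (@eq_integrable _ _ _ _ _ _ (fun z => (dirgrad (f z) x y a b)%:E - (dirgrad (f z) x' y' a b)%:E)%E) => //; exact: integrableB.
  move=> z _; rewrite -E; apply: (le_trans (dotp_le _ _)).
  by rewrite ler_wpM2r ?enorm_ge0// hL.
by rewrite Rintegral_prob_cst.
Qed.

End unbiased_gradients.

(** * Measurability for functions controlled on the constraint sets only *)

Lemma cvg_enorm {R : realType} n (w : nat -> 'rV[R]_n) (z : 'rV[R]_n) :
  (forall c, (fun m => w m 0 c) @ \oo --> z 0 c) ->
  (fun m => enorm (w m - z)) @ \oo --> 0.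
Proof.
move=> wz; apply/cvgrPdist_le => e e0.
pose e' := e / (Num.sqrt n%:R + 1).
have k0 : 0 < Num.sqrt n%:R + 1 :> R by rewrite ltr_wpDl ?sqrtr_ge0.
have e'0 : 0 < e' by rewrite divr_gt0.
have wzc c : \forall m \near \oo, `|z 0 c - w m 0 c| <= e'.
  by have /cvgrPdist_le/(_ _ e'0) := wz c.
have : \forall m \near \oo, forall c, `|z 0 c - w m 0 c| <= e' by exact: filter_forall.
apply: filterS => m wm.
rewrite sub0r normrN ger0_norm ?enorm_ge0//; apply: (le_trans (enorm_le_mx_norm _)).
have h : `|w m - z| <= e'.
  rewrite [leLHS]mx_normrE; apply: bigmax_le; first exact: ltW.
  by move=> [i j] _ /=; rewrite (ord1 i) !mxE distrC wm.
have -> : e = (Num.sqrt n%:R + 1) * e' by rewrite /e' mulrC divfK// gt_eqF.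
by apply: ler_pM => //; rewrite lerDl.
Qed.

(** Composition with the projections extends the function off [X] and [Y] without changing it at the
    random point. The modulus t + t^2 admits Lipschitz maps as well as the value function, whose
    increments have a quadratic part. *)
Lemma measurable_caratheodory2 {d} {S : measurableType d} {R : realType} {n1 n2 : nat}
    (X : set 'rV[R]_n1) (Y : set 'rV[R]_n2)
    (g : S -> 'rV[R]_n1 -> 'rV[R]_n2 -> R)
    (Z : S -> 'rV[R]_n1) (W : S -> 'rV[R]_n2) :
  projectable X -> projectable Y -> (forall s, X (Z s)) -> (forall s, Y (W s)) ->
  (forall c, measurable_fun setT (fun s => Z s 0 c)) ->
  (forall c, measurable_fun setT (fun s => W s 0 c)) ->
  (forall x y, X x -> Y y -> measurable_fun setT (fun s => g s x y)) ->
  (forall s, exists K, forall x y, X x -> Y y ->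
     let t := enorm (x - Z s) + enorm (y - W s) in
     `|g s x y - g s (Z s) (W s)| <= K * (t + t ^+ 2)) ->
  measurable_fun setT (fun s => g s (Z s) (W s)).
Proof.
move=> Xp Yp XZ YW mZ mW mg gK.
have X0 : X !=set0 by exists (Z point).
have Y0 : Y !=set0 by exists (W point).
pose h s (u : 'rV[R]_(n1 + n2)) := g s (eproj X (lsubmx u)) (eproj Y (rsubmx u)).
have -> : (fun s => g s (Z s) (W s)) = (fun s => h s (row_mx (Z s) (W s))).
  by apply/funext => s; rewrite /h row_mxKl row_mxKr !eproj_id.
apply: measurable_caratheodory.
- move=> i; case: (split_ordP i) => j ->.
    by under eq_fun do rewrite row_mxEl; exact: mZ.
  by under eq_fun do rewrite row_mxEr; exact: mW.
- by move=> u; apply: mg; exact: eproj_in.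
move=> s w wz; rewrite /h row_mxKl row_mxKr !eproj_id//.
have [K hK] := gK s.
pose t (m : nat) := enorm (lsubmx (w m) - Z s) + enorm (rsubmx (w m) - W s).
have t_cvg : t @ \oo --> 0.
  rewrite -[0]addr0; apply: cvgD; apply: cvg_enorm => c.
    have := wz (lshift n2 c); rewrite row_mxEl.
    by apply: cvg_trans; apply: near_eq_cvg; apply: nearW => m; rewrite mxE.
  have := wz (rshift n1 c); rewrite row_mxEr.
  by apply: cvg_trans; apply: near_eq_cvg; apply: nearW => m; rewrite mxE.
have tt_cvg : (fun m => `|K| * (t m + t m ^+ 2)) @ \oo --> 0.
  rewrite -[0](mulr0 `|K|); apply: cvgM; first exact: cvg_cst.
  rewrite -[0](addr0 0) -[X in 0 + X](mulr0 0); apply: cvgD => //.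
  exact: cvgM.
have t0 m : 0 <= t m by rewrite addr_ge0 ?enorm_ge0.
apply/cvgrPdist_le => e e0; have /cvgrPdist_le/(_ _ e0) := tt_cvg.
apply: filterS => m; rewrite sub0r normrN ger0_norm; last first.
  by rewrite mulr_ge0// addr_ge0// sqr_ge0.
apply: le_trans; rewrite distrC.
apply: (le_trans (hK _ _ (eproj_in Xp X0 _) (eproj_in Yp Y0 _))) => /=.
set r := enorm _ + enorm _.
have r0 : 0 <= r by rewrite addr_ge0 ?enorm_ge0.
have rt : r <= t m.
  have hx := eproj_nonexpansive Xp X0 (lsubmx (w m)) (Z s).
  have hy := eproj_nonexpansive Yp Y0 (rsubmx (w m)) (W s).
  rewrite (eproj_id Xp X0 (XZ s)) in hx; rewrite (eproj_id Yp Y0 (YW s)) in hy.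
  exact: lerD.
apply: (@le_trans _ _ (`|K| * (r + r ^+ 2))).
  by rewrite ler_wpM2r ?ler_norm// addr_ge0// sqr_ge0.
by rewrite ler_wpM2l// lerD// ler_pXn2r// nnegrE.
Qed.

(** * Integrability and expectations of real random variables *)

Section expectation_lemmas.
Context {d} {T : measurableType d} {R : realType} (P : probability T R).
Implicit Types (h g : T -> R).

Lemma integrable_dominated h g : measurable_fun setT h ->
  (forall o, 0 <= h o <= g o) -> P.-integrable setT (EFin \o g) ->
  P.-integrable setT (EFin \o h).
Proof.
move=> mh hg; apply: le_integrable => //; first exact/measurable_EFinP.
move=> o _ /=; have /andP[h0 hgo] := hg o.
by rewrite lee_fin !ger0_norm// (le_trans h0).
Qed.

Lemma ge0_integrable_fin h (c : R) : measurable_fun setT h -> (forall o, 0 <= h o) ->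
  (\int[P]_o (h o)%:E <= c%:E)%E -> P.-integrable setT (EFin \o h).
Proof.
move=> mh h0 hc; apply/integrableP; split; first exact/measurable_EFinP.
under eq_integral do rewrite /= ger0_norm//.
by apply: le_lt_trans hc _; rewrite ltry.
Qed.

Lemma Rintegral_EFin h : P.-integrable setT (EFin \o h) ->
  (\int[P]_o (h o)%:E = (\int[P]_o h o)%:E)%E.
Proof. by move=> ih; rewrite /Rintegral fineK//; exact: integrable_fin_num. Qed.

(** Four terms cover every inequality of the Lyapunov analysis; shorter combinations are padded with
    a zero coefficient. *)
Lemma integrable_lincomb4 (c0 c1 c2 c3 : R) (f0 f1 f2 f3 : T -> R) :
  P.-integrable setT (EFin \o f0) -> P.-integrable setT (EFin \o f1) ->
  P.-integrable setT (EFin \o f2) -> P.-integrable setT (EFin \o f3) ->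
  P.-integrable setT (EFin \o (fun o => c0 * f0 o + c1 * f1 o + c2 * f2 o + c3 * f3 o))
  /\ \int[P]_o (c0 * f0 o + c1 * f1 o + c2 * f2 o + c3 * f3 o) =
    c0 * \int[P]_o f0 o + c1 * \int[P]_o f1 o + c2 * \int[P]_o f2 o + c3 * \int[P]_o f3 o.
Proof.
have iZ (c : R) (f : T -> R) : P.-integrable setT (EFin \o f) ->
    P.-integrable setT (EFin \o (fun o => c * f o)).
  move=> i; apply: (@eq_integrable _ _ _ _ _ _ (fun o => c%:E * (f o)%:E)%E) => //.
  exact: integrableZl.
have iD (f g : T -> R) : P.-integrable setT (EFin \o f) ->
    P.-integrable setT (EFin \o g) -> P.-integrable setT (EFin \o (fun o => f o + g o)).
  move=> i j; apply: (@eq_integrable _ _ _ _ _ _ (fun o => (f o)%:E + (g o)%:E)%E) => //.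
  exact: integrableD.
move=> i0 i1 i2 i3.
have j0 := iZ c0 _ i0; have j1 := iZ c1 _ i1; have j2 := iZ c2 _ i2; have j3 := iZ c3 _ i3.
have j01 := iD _ _ j0 j1; have j012 := iD _ _ j01 j2; split; first exact: iD.
rewrite (RintegralD _ j012 j3)// (RintegralD _ j01 j2)// (RintegralD _ j0 j1)//.
by rewrite !RintegralZl.
Qed.

Lemma Rintegral_le_lincomb4 (c0 c1 c2 c3 : R) (h f0 f1 f2 f3 : T -> R) :
  P.-integrable setT (EFin \o h) ->
  P.-integrable setT (EFin \o f0) -> P.-integrable setT (EFin \o f1) ->
  P.-integrable setT (EFin \o f2) -> P.-integrable setT (EFin \o f3) ->
  (forall o, h o <= c0 * f0 o + c1 * f1 o + c2 * f2 o + c3 * f3 o) ->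
  \int[P]_o h o <=
    c0 * \int[P]_o f0 o + c1 * \int[P]_o f1 o + c2 * \int[P]_o f2 o + c3 * \int[P]_o f3 o.
Proof.
move=> ih i0 i1 i2 i3 hle.
have [il <-] := integrable_lincomb4 c0 c1 c2 c3 i0 i1 i2 i3.
by apply: le_Rintegral => // o _; exact: hle.
Qed.

Lemma variance_le_sqr h (K : R) : measurable_fun setT h -> (forall o, `|h o| <= K) ->
  (\int[P]_o ((h o - \int[P]_z h z) ^+ 2)%:E <= \int[P]_o (h o ^+ 2)%:E)%E.
Proof.
move=> mh hK; set mean := \int[P]_z h z.
have ih : P.-integrable setT (EFin \o h).
  apply: (@le_integrable _ _ _ _ _ _ _ (cst K%:E)) => //; first exact/measurable_EFinP.
    move=> o _ /=; rewrite lee_fin (le_trans (hK o))// ler_norm//.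
  exact: finite_measure_integrable_cst.
have mhm : measurable_fun setT (fun o => h o - mean) by exact: measurable_funB.
have h0 : \int[P]_o (h o - mean) = 0.
  rewrite RintegralB//; last exact: finite_measure_integrable_cst.
  by rewrite Rintegral_prob_cst subrr.
have fin : (\int[P]_o ((h o - mean) ^+ 2)%:E < +oo)%E.
  apply: (@le_lt_trans _ _ (\int[P]_o ((K + `|mean|) ^+ 2)%:E)%E).
    apply: ge0_le_integral => //.
    - by move=> o _; rewrite lee_fin sqr_ge0.
    - by apply/measurable_EFinP; exact: measurable_funX.
    - move=> o _; rewrite lee_fin -[leLHS]real_normK ?num_real//.
      have hm : `|h o - mean| <= K + `|mean|.
        by rewrite (le_trans (ler_normB _ _))// lerD2r.
      by rewrite ler_pXn2r ?nnegrE// (le_trans _ hm).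
  by rewrite integral_cst//= probability_setT mule1 ltry.
have := integral_shift_sqr mean mhm h0 fin.
under eq_integral do rewrite addrC subrK.
by move=> ->; rewrite leeDr// lee_fin sqr_ge0.
Qed.

Lemma variance_le_sqr_enorm n (V : T -> 'rV[R]_n) (M : 'rV[R]_n) (K : R) :
  (forall c, measurable_fun setT (fun o => V o 0 c)) ->
  (forall o, enorm (V o) <= K) -> (forall c, \int[P]_o V o 0 c = M 0 c) ->
  (\int[P]_o (enorm (V o - M) ^+ 2)%:E <= \int[P]_o (enorm (V o) ^+ 2)%:E)%E.
Proof.
move=> mV VK VM.
under eq_integral do rewrite sqr_enormE -sumEFin.
under [leRHS]eq_integral do rewrite sqr_enormE -sumEFin.
rewrite !ge0_integral_sum//.
- apply: lee_sum => c _; under eq_integral do rewrite row_subE -VM.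
  apply: (variance_le_sqr (K := K)) => // o.
  exact: le_trans (coord_le_enorm _ _) (VK o).
- by move=> c; apply/measurable_EFinP; exact: measurable_funX.
- by move=> c o _; rewrite lee_fin sqr_ge0.
- move=> c; apply/measurable_EFinP; apply: measurable_funX.
  by under eq_fun do rewrite row_subE; exact: measurable_funB.
- by move=> c o _; rewrite lee_fin sqr_ge0.
Qed.

End expectation_lemmas.

(** * The step sizes *)

Section step_size.
Context {R : realType}.
Variables (k m : R).
Hypotheses (k0 : 0 < k) (m2 : 2 <= m) (mk : k ^+ 3 <= m).

Let m0 : 0 < m. Proof. exact: lt_le_trans m2. Qed.
Let mn0 n : 0 < m + n%:R. Proof. by rewrite ltr_wpDr. Qed.

Lemma cube_root_pow (u : R) : 0 <= u -> (u `^ 3^-1) ^+ 3 = u.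
Proof. by move=> u0; rewrite -powR_mulrn ?powR_ge0// -powRrM mulVf// powRr1. Qed.

Lemma le_cube_root (u v : R) : 0 <= u -> 0 <= v -> u ^+ 3 <= v -> u <= v `^ 3^-1.
Proof.
move=> u0 v0 uv; rewrite -(ler_pXn2r (n := 3))// ?nnegrE ?powR_ge0//.
by rewrite cube_root_pow.
Qed.

Lemma eta_gt0 n : 0 < Defs.eta k m n.
Proof. by rewrite divr_gt0// powR_gt0. Qed.

Lemma eta_pow3 n : Defs.eta k m n ^+ 3 = k ^+ 3 / (m + n%:R).
Proof. by rewrite /Defs.eta expr_div_n cube_root_pow// ltW. Qed.

Lemma eta_inv n : (Defs.eta k m n)^-1 = (m + n%:R) `^ 3^-1 / k.
Proof. by rewrite /Defs.eta invf_div. Qed.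

Lemma cube_root_ge n : m `^ 3^-1 <= (m + n%:R) `^ 3^-1.
Proof.
by apply: ge0_ler_powR; rewrite ?nnegrE ?invr_ge0 ?(ltW m0) ?(ltW (mn0 n))// lerDl.
Qed.

Lemma eta_mul_le1 (c : R) n : 0 <= c -> (c * k) ^+ 3 <= m -> c * Defs.eta k m n <= 1.
Proof.
move=> c0 ckm; rewrite /Defs.eta mulrA ler_pdivrMr ?powR_gt0// mul1r.
apply: le_trans (cube_root_ge n); apply: le_cube_root => //.
  by rewrite mulr_ge0// ltW.
exact: ltW.
Qed.

Lemma eta_le1 n : Defs.eta k m n <= 1.
Proof. by rewrite -[leLHS]mul1r eta_mul_le1// mul1r. Qed.

Lemma eta_nincr n p : (n <= p)%N -> Defs.eta k m p <= Defs.eta k m n.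
Proof.
move=> np; rewrite /Defs.eta ler_pM2l// lef_pV2 ?posrE ?powR_gt0//.
by apply: ge0_ler_powR; rewrite ?nnegrE ?invr_ge0 ?(ltW (mn0 _))// lerD2l ler_nat.
Qed.

(** For the cube roots A and B of m + n + 1 and m + n, (A - B) (A^2 + A B + B^2) = 1 makes A - B of
    order 1 / A^2, and k <= B turns this into a multiple of the step size. The term 2 / (3 k^3) in
    the lower bounds on c1 and c2 pays for this growth. *)
Lemma eta_inv_succ n :
  (Defs.eta k m n.+1)^-1 <= (Defs.eta k m n)^-1 + 2 / (3 * k ^+ 3) * Defs.eta k m n.+1.
Proof.
rewrite !eta_inv /Defs.eta; set A := (m + n.+1%:R) `^ 3^-1; set B := (m + n%:R) `^ 3^-1.
have A3 : A ^+ 3 = m + n.+1%:R by rewrite cube_root_pow// ltW.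
have B3 : B ^+ 3 = m + n%:R by rewrite cube_root_pow// ltW.
have kB : k <= B by apply: le_trans (cube_root_ge n); apply: le_cube_root; rewrite // ltW.
have A0 : 0 < A by rewrite powR_gt0.
have B0 : 0 < B by rewrite powR_gt0.
have AB : B <= A.
  by apply: ge0_ler_powR; rewrite ?nnegrE ?invr_ge0 ?(ltW (mn0 _))// lerD2l ler_nat.
have E : (A - B) * (A ^+ 2 + A * B + B ^+ 2) = 1.
  have -> : (A - B) * (A ^+ 2 + A * B + B ^+ 2) = A ^+ 3 - B ^+ 3 by ring.
  by rewrite A3 B3 -natr1; ring.
have h : (A - B) * (A * k) <= 2 / 3.
  apply: (@le_trans _ _ ((A - B) * (A * B))).
    by rewrite ler_wpM2l ?subr_ge0// ler_pM2l.
  have : (A - B) * (A * B) <= (A - B) * (2 / 3 * (A ^+ 2 + A * B + B ^+ 2)).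
    by rewrite ler_wpM2l ?subr_ge0//; nra.
  have -> : (A - B) * (2 / 3 * (A ^+ 2 + A * B + B ^+ 2)) =
    2 / 3 * ((A - B) * (A ^+ 2 + A * B + B ^+ 2)) by ring.
  by rewrite E mulr1.
have -> : A / k = B / k + ((A - B) * (A * k)) / (A * k ^+ 2) by field; rewrite !gt_eqF.
have -> : 2 / (3 * k ^+ 3) * (k / A) = (2 / 3) / (A * k ^+ 2) by field; rewrite !gt_eqF.
by rewrite lerD2l ler_pM2r// invr_gt0 mulr_gt0// exprn_gt0.
Qed.

(** The cubes are k^3 / (m + n), a harmonic sum; ln (1 + u) <= u at u = -1 / (m + n + 1) bounds each
    term by an increment of the logarithm. *)
Lemma sum_eta_pow3 T : \sum_(1 <= n < T.+1) Defs.eta k m n ^+ 3 <= k ^+ 3 * ln (m + T%:R).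
Proof.
have k30 : 0 < k ^+ 3 by exact: exprn_gt0.
elim: T => [|T IH].
  by rewrite big_geq// addr0 mulr_ge0 ?(ltW k30)// ln_ge0// (le_trans _ m2)// ler1n.
rewrite big_nat_recr//= eta_pow3.
apply: (le_trans (lerD IH (lexx _))); rewrite -mulrDr ler_pM2l//.
have q0 : 0 < (m + T%:R) / (m + T.+1%:R) by rewrite divr_gt0.
have : ln ((m + T%:R) / (m + T.+1%:R)) <= - (m + T.+1%:R)^-1.
  have -> : (m + T%:R) / (m + T.+1%:R) = 1 + (- (m + T.+1%:R)^-1).
    by rewrite -[T.+1%:R]natr1; field; rewrite natr1 gt_eqF.
  apply: le_ln1Dx; rewrite ltrN2 invf_lt1//.
  by rewrite (lt_le_trans _ (lerD m2 (ler0n R T.+1)))// addr0 ltr1n.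
by rewrite ln_div ?posrE//; lra.
Qed.

End step_size.

(** * Decrease of the Lyapunov function for real sequences *)

Section lyapunov_real.
Context {R : realType}.

(** [ie] and [ie0] are the inverses of the present and the previous step size. After division by eta
    the damping al / eta = c eta outweighs the growth of 1 / eta and leaves th eta, while the noise
    drops from order eta^4 to eta^3. *)
Lemma error_step (e e' al c th b k eta ie ie0 N W : R) :
  0 < b -> 0 <= e -> 0 <= N -> 0 <= W -> 0 < eta -> eta * ie = 1 ->
  ie <= ie0 + 2 / (3 * k ^+ 3) * eta ->
  2 / (3 * k ^+ 3) + th <= c -> al = c * eta ^+ 2 -> 0 <= al <= 1 ->
  e' <= (1 - al) ^+ 2 * e + b^-1 * (2 * al ^+ 2 * N + 2 * (1 - al) ^+ 2 * W) ->
  ie * e' <= (ie0 - th * eta) * e + b^-1 * (2 * c ^+ 2 * eta ^+ 3 * N + 2 * (ie * W)).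
Proof.
move=> b0 e0 N0 W0 eta0 eie hie hc alE /andP[al0 al1] he'.
have ie_gt0 : 0 < ie.
  by rewrite -(pmulr_rgt0 _ eta0) eie.
have bV0 : 0 <= b^-1 by rewrite invr_ge0 ltW.
have al2 : (1 - al) ^+ 2 <= 1 - al.
  by rewrite expr2 -[leRHS]mulr1 ler_wpM2l ?subr_ge0// gerBl.
(* As 0 <= al <= 1, the square of 1 - al is at most 1 - al in front of [e] and at most 1 in front of
   [W]. *)
have h1 : e' <= (1 - al) * e + b^-1 * (2 * al ^+ 2 * N + 2 * W).
  apply: (le_trans he'); apply: lerD; first by rewrite ler_wpM2r.
  rewrite ler_wpM2l// lerD2l ler_wpM2r// -[leRHS]mulr1 ler_wpM2l//.
  by rewrite (le_trans al2)// gerBl.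
have h2 := ler_wpM2l (ltW ie_gt0) h1.
apply: (le_trans h2); rewrite mulrDr; apply: lerD.
  rewrite mulrA ler_wpM2r//.
  have -> : ie * (1 - al) = ie - c * eta * (eta * ie) by rewrite alE; ring.
  rewrite eie mulr1; have : (2 / (3 * k ^+ 3) + th) * eta <= c * eta.
    by rewrite ler_wpM2r// ltW.
  by move: hie; lra.
rewrite le_eqVlt; apply/predU1P; left.
have -> : ie * (b^-1 * (2 * al ^+ 2 * N + 2 * W)) =
  b^-1 * (2 * c ^+ 2 * eta ^+ 3 * N * (eta * ie) + 2 * (ie * W)) by rewrite alE; ring.
by rewrite eie mulr1.
Qed.

(** Linear bookkeeping in which products are atoms: [ra], [re], [ep] stand for gam eta L^2 a, gam
    eta e and eta p / gam. The terms in [g] cancel, and 9/4 - 2 = 1/4 of [ra] and of [re]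
    survives. *)
Lemma lyapunov_combine (F F' ca ca' Ge Gg Ge0 Gg0 T1 T2 B1 B2 B3 B4 ra re ep p q g
    lhs rhs : R) :
  F' <= F + 2 * ra + 2 * re - 1 / 2 * ep ->
  ca' <= ca - 9 / 4 * ra - 27 / 4 * B3 * q + 75 / 2 * B4 * g + 75 / 2 * B2 * p ->
  Ge <= Ge0 - 9 / 4 * re + T1 + 2 * B1 * (p + q) ->
  Gg <= Gg0 - 75 / 2 * B4 * g + T2 + 2 * B1 * (p + q) ->
  4 * B1 * q <= 27 / 4 * B3 * q ->
  (75 / 2 * B2 + 4 * B1) * p <= 1 / 4 * ep ->
  lhs = F' + ca' + (Ge + Gg) + (1 / 4 * ep + 1 / 4 * ra + 1 / 4 * re) ->
  rhs = F + ca + (Ge0 + Gg0) + (T1 + T2) ->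
  lhs <= rhs.
Proof. by move=> h1 h2 h3 h4 h5 h6 -> ->; lra. Qed.

(** The weights are fixed by cancellation: C tau lam / 4 and G (9 tau^2 / 4) exceed by gam / 4 the
    terms 2 gam L^2 and 2 gam of the x step, and G (75 L^2 / 2) equals C (25 lam / (6 tau)). The
    displacements q and p are absorbed by the upper bounds on [lam] and [gam]. *)
Lemma lyapunov_step (F F' a a' e e' g g' p q b k eta ie ie0 c1 c2 lam gam tau L N : R) :
  0 < b -> 0 < lam -> 0 < gam -> 0 < tau -> 0 < L -> 0 < eta -> eta * ie = 1 ->
  0 <= a -> 0 <= e -> 0 <= g -> 0 <= p -> 0 <= q -> 0 <= N ->
  ie <= ie0 + 2 / (3 * k ^+ 3) * eta ->
  2 / (3 * k ^+ 3) + 9 * tau ^+ 2 / 4 <= c1 ->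
  2 / (3 * k ^+ 3) + 75 * L ^+ 2 / 2 <= c2 ->
  0 <= c1 * eta ^+ 2 <= 1 -> 0 <= c2 * eta ^+ 2 <= 1 ->
  lam <= 27 * b * tau / 16 ->
  gam <= lam * tau / (2 * L)
    * Num.sqrt (2 * b / (8 * lam ^+ 2 + 75 * (L / tau) ^+ 2 * b)) ->
  F' <= F + eta * (2 * gam * L ^+ 2 * a + 2 * gam * e - p / (2 * gam)) ->
  a' <= (1 - eta * tau * lam / 4) * a - 3 * eta / 4 * q
    + 25 * eta * lam / (6 * tau) * g
    + 25 * (L / tau) ^+ 2 * eta / (6 * tau * lam) * p ->
  e' <= (1 - c1 * eta ^+ 2) ^+ 2 * e + b^-1 * (2 * (c1 * eta ^+ 2) ^+ 2 * N
    + 2 * (1 - c1 * eta ^+ 2) ^+ 2 * (L ^+ 2 * eta ^+ 2 * (p + q))) ->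
  g' <= (1 - c2 * eta ^+ 2) ^+ 2 * g + b^-1 * (2 * (c2 * eta ^+ 2) ^+ 2 * N
    + 2 * (1 - c2 * eta ^+ 2) ^+ 2 * (L ^+ 2 * eta ^+ 2 * (p + q))) ->
  forall C G, C = 9 * L ^+ 2 * gam / (lam * tau) -> G = gam / tau ^+ 2 ->
  F' + C * a' + G * (ie * (e' + g'))
    + gam / 4 * eta * (p / gam ^+ 2 + L ^+ 2 * a + e)
  <= F + C * a + G * (ie0 * (e + g))
    + 2 * G * (c1 ^+ 2 + c2 ^+ 2) * N / b * eta ^+ 3.
Proof.
move=> b0 l0 g0 t0 L0 eta0 eie a0 e0 gg0 p0 q0 N0 hie hc1 hc2 al1 al2 hlam hgam
  hF ha he hg C G CE GE.
have W0 : 0 <= L ^+ 2 * eta ^+ 2 * (p + q).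
  by rewrite mulr_ge0 ?addr_ge0// mulr_ge0 ?sqr_ge0.
have he2 := error_step b0 e0 N0 W0 eta0 eie hie hc1 erefl al1 he.
have hg2 := error_step b0 gg0 N0 W0 eta0 eie hie hc2 erefl al2 hg.
have C0 : 0 < C by rewrite CE divr_gt0 ?mulr_gt0// exprn_gt0.
have G0 : 0 < G by rewrite GE divr_gt0// exprn_gt0.
have WE : ie * (L ^+ 2 * eta ^+ 2 * (p + q)) = L ^+ 2 * eta * (p + q).
  by rewrite -[RHS]mulr1 -eie; ring.
rewrite WE in he2 hg2.
pose r := gam * eta; have r0 : 0 < r by rewrite mulr_gt0.
pose S := (L / tau) ^+ 2; have S0 : 0 < S by rewrite exprn_gt0// divr_gt0.
have ha2 : C * a' <= C * a - 9 / 4 * (r * L ^+ 2 * a) - 27 / 4 * (L ^+ 2 * r / (lam * tau)) * q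
    + 75 / 2 * (S * r) * g + 75 / 2 * (S ^+ 2 * r / lam ^+ 2) * p.
  apply: le_trans (ler_wpM2l (ltW C0) ha) _.
  rewrite le_eqVlt; apply/predU1P; left; rewrite CE /S /r; field.
  by rewrite !gt_eqF.
have he3 : G * (ie * e') <= G * ie0 * e - 9 / 4 * (r * e) +
    2 * G * c1 ^+ 2 * N / b * eta ^+ 3 + 2 * (S * r / b) * (p + q).
  apply: le_trans (ler_wpM2l (ltW G0) he2) _.
  rewrite le_eqVlt; apply/predU1P; left; rewrite GE /S /r; field.
  by rewrite !gt_eqF.
have hg3 : G * (ie * g') <= G * ie0 * g - 75 / 2 * (S * r) * g +
    2 * G * c2 ^+ 2 * N / b * eta ^+ 3 + 2 * (S * r / b) * (p + q).
  apply: le_trans (ler_wpM2l (ltW G0) hg2) _.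
  rewrite le_eqVlt; apply/predU1P; left; rewrite GE /S /r; field.
  by rewrite !gt_eqF.
have hF2 : F' <= F + 2 * (r * L ^+ 2 * a) + 2 * (r * e) - 1 / 2 * (eta / gam * p).
  apply: (le_trans hF); rewrite le_eqVlt; apply/predU1P; left; rewrite /r; field.
  by rewrite gt_eqF.
(* Amounts to 16 lam <= 27 b tau. *)
have hq : 4 * (S * r / b) * q <= 27 / 4 * (L ^+ 2 * r / (lam * tau)) * q.
  rewrite ler_wpM2r//.
  have -> : 4 * (S * r / b) = (4 * lam / (b * tau)) * (L ^+ 2 * r / (lam * tau)).
    by rewrite /S; field; rewrite !gt_eqF.
  apply: ler_wpM2r; first by rewrite divr_ge0 ?mulr_ge0 ?sqr_ge0// ltW.
  by rewrite ler_pdivrMr ?mulr_gt0//; move: hlam; lra.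
(* Amounts to the square of [hgam]. *)
have hp : (75 / 2 * (S ^+ 2 * r / lam ^+ 2) + 4 * (S * r / b)) * p <= 1 / 4 * (eta / gam * p).
  rewrite [leRHS]mulrA ler_wpM2r//.
  have Q0 : 0 < 8 * lam ^+ 2 + 75 * S * b.
    by apply: addr_gt0; [rewrite mulr_gt0// exprn_gt0|rewrite mulr_gt0// mulr_gt0].
  have gam2 : gam ^+ 2 <= lam ^+ 2 / (4 * S) * (2 * b / (8 * lam ^+ 2 + 75 * S * b)).
    have -> : lam ^+ 2 / (4 * S) * (2 * b / (8 * lam ^+ 2 + 75 * S * b)) =
      (lam * tau / (2 * L) * Num.sqrt (2 * b / (8 * lam ^+ 2 + 75 * S * b))) ^+ 2.
      rewrite exprMn sqr_sqrtr; last by rewrite divr_ge0 ?mulr_ge0// ltW.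
      by congr (_ * _); rewrite /S; field; rewrite !gt_eqF.
    rewrite ler_pXn2r ?nnegrE ?(ltW g0)//.
    by rewrite mulr_ge0 ?sqrtr_ge0// divr_ge0 ?mulr_ge0// ltW.
  have -> : 75 / 2 * (S ^+ 2 * r / lam ^+ 2) + 4 * (S * r / b) =
     gam ^+ 2 * (S * (75 * S * b + 8 * lam ^+ 2) / (2 * b * lam ^+ 2) * (eta / gam)).
    by rewrite /r; field; rewrite !gt_eqF.
  have -> : 1 / 4 * (eta / gam) =
    lam ^+ 2 / (4 * S) * (2 * b / (8 * lam ^+ 2 + 75 * S * b)) *
    (S * (75 * S * b + 8 * lam ^+ 2) / (2 * b * lam ^+ 2) * (eta / gam)).
    by field; rewrite ?(gt_eqF Q0) ?gt_eqF.
  have K1 : 0 <= S * (75 * S * b + 8 * lam ^+ 2).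
    by rewrite mulr_ge0 ?(ltW S0)// addrC ltW.
  have K2 : 0 <= 2 * b * lam ^+ 2 by rewrite mulr_ge0 ?sqr_ge0// mulr_ge0// ltW.
  have K3 : 0 <= eta / gam by rewrite divr_ge0// ltW.
  by apply: ler_wpM2r => //; rewrite mulr_ge0// divr_ge0.
have -> : gam / 4 * eta * (p / gam ^+ 2 + L ^+ 2 * a + e) =
   1 / 4 * (eta / gam * p) + 1 / 4 * (r * L ^+ 2 * a) + 1 / 4 * (r * e).
  by rewrite /r; field; rewrite gt_eqF.
have -> : 2 * G * (c1 ^+ 2 + c2 ^+ 2) * N / b * eta ^+ 3 =
  2 * G * c1 ^+ 2 * N / b * eta ^+ 3 + 2 * G * c2 ^+ 2 * N / b * eta ^+ 3.
  by field; rewrite gt_eqF.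
apply: (lyapunov_combine (Ge := G * (ie * e')) (Gg := G * (ie * g'))
  hF2 ha2 he3 hg3 hq hp); ring.
Qed.

End lyapunov_real.

(** Telescoping [lyapunov_step] bounds the sum weighted by the step sizes. These do not increase, so
    eta_T factors out, and dividing by it brings in (m + T)^(1/3) / k. *)
Lemma lyapunov_sum {R : realType} (F a e g p q : nat -> R) (T : nat)
    (b k m c1 c2 lam gam tau L delta : R) :
  0 < b -> 0 < lam -> 0 < gam -> 0 < tau -> 0 < L ->
  0 < k -> 2 <= m -> k ^+ 3 <= m -> (c1 * k) ^+ 3 <= m -> (c2 * k) ^+ 3 <= m ->
  2 / (3 * k ^+ 3) + 9 * tau ^+ 2 / 4 <= c1 ->
  2 / (3 * k ^+ 3) + 75 * L ^+ 2 / 2 <= c2 ->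
  lam <= 27 * b * tau / 16 ->
  gam <= lam * tau / (2 * L)
    * Num.sqrt (2 * b / (8 * lam ^+ 2 + 75 * (L / tau) ^+ 2 * b)) ->
  (forall n, (1 <= n <= T.+1)%N -> 0 <= F n) ->
  (forall n, [/\ 0 <= a n, 0 <= e n & 0 <= g n]) ->
  (forall n, 0 <= p n) -> (forall n, 0 <= q n) ->
  e 1%N <= delta ^+ 2 / b -> g 1%N <= delta ^+ 2 / b ->
  (forall n, (1 <= n <= T)%N -> let eta := Defs.eta k m n in
    [/\ F n.+1 <= F n + eta * (2 * gam * L ^+ 2 * a n + 2 * gam * e n - p n / (2 * gam)),
        a n.+1 <= (1 - eta * tau * lam / 4) * a n - 3 * eta / 4 * q n
          + 25 * eta * lam / (6 * tau) * g n
          + 25 * (L / tau) ^+ 2 * eta / (6 * tau * lam) * p n,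
        e n.+1 <= (1 - c1 * eta ^+ 2) ^+ 2 * e n
          + b^-1 * (2 * (c1 * eta ^+ 2) ^+ 2 * delta ^+ 2
          + 2 * (1 - c1 * eta ^+ 2) ^+ 2 * (L ^+ 2 * eta ^+ 2 * (p n + q n))) &
        g n.+1 <= (1 - c2 * eta ^+ 2) ^+ 2 * g n
          + b^-1 * (2 * (c2 * eta ^+ 2) ^+ 2 * delta ^+ 2
          + 2 * (1 - c2 * eta ^+ 2) ^+ 2 * (L ^+ 2 * eta ^+ 2 * (p n + q n)))]) ->
  \sum_(1 <= n < T.+1) (p n / gam ^+ 2 + L ^+ 2 * a n + e n) <=
  4 * (F 1%N / (gam * k) + 9 * L ^+ 2 * a 1%N / (k * lam * tau)
    + 2 * m `^ 3^-1 * delta ^+ 2 / (b * tau ^+ 2 * k ^+ 2)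
    + 2 * (c1 ^+ 2 + c2 ^+ 2) * delta ^+ 2 * k ^+ 2 / (b * tau ^+ 2) * ln (m + T%:R))
  * (m + T%:R) `^ 3^-1.
Proof.
move=> b0 l0 g0 t0 L0 k0 m2 mk mc1 mc2 hc1 hc2 hlam hgam Fpos pos p0 q0 e1 g1 step.
set eta := Defs.eta k m in step *.
have c10 : 0 <= c1.
  by apply: le_trans hc1; rewrite addr_ge0// divr_ge0 ?mulr_ge0 ?exprn_ge0// ltW.
have c20 : 0 <= c2.
  by apply: le_trans hc2; rewrite addr_ge0// divr_ge0 ?mulr_ge0 ?exprn_ge0// ltW.
have eta0 n : 0 < eta n := eta_gt0 k0 m2 n.
have eta1 n : eta n <= 1 := eta_le1 k0 m2 mk n.
have al01 c n : 0 <= c -> (c * k) ^+ 3 <= m -> 0 <= c * eta n ^+ 2 <= 1.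
  move=> c0 ck; rewrite mulr_ge0 ?sqr_ge0//= expr2 mulrA.
  have ce := eta_mul_le1 k0 m2 n c0 ck.
  by rewrite -[leRHS]mulr1; apply: ler_pM => //; [rewrite mulr_ge0// ltW|exact: ltW].
pose C := 9 * L ^+ 2 * gam / (lam * tau); pose G := gam / tau ^+ 2.
(* The shifted index puts 1 / eta_0 = m^(1/3) / k at n = 1, whence the third term of the bound. *)
pose phi n := F n + C * a n + G * ((eta n.-1)^-1 * (e n + g n)).
pose K := 2 * G * (c1 ^+ 2 + c2 ^+ 2) * delta ^+ 2 / b.
pose s n := p n / gam ^+ 2 + L ^+ 2 * a n + e n.
have C0 : 0 <= C by rewrite divr_ge0 ?mulr_ge0 ?sqr_ge0// ltW.
have G0 : 0 < G by rewrite divr_gt0// exprn_gt0.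
have K0 : 0 <= K by rewrite divr_ge0 ?(ltW b0)// mulr_ge0 ?sqr_ge0// mulr_ge0 ?addr_ge0 ?sqr_ge0// mulr_ge0// ltW.
have s0 n : 0 <= s n.
  have [an en _] := pos n; apply: addr_ge0 => //.
  by apply: addr_ge0; [rewrite divr_ge0// sqr_ge0|rewrite mulr_ge0// sqr_ge0].
have tele n : (n <= T)%N -> phi n.+1 + \sum_(1 <= i < n.+1) gam / 4 * eta i * s i <=
    phi 1%N + K * \sum_(1 <= i < n.+1) eta i ^+ 3.
  elim: n => [|n IH] nT; first by rewrite !big_geq// mulr0.
  rewrite !(big_nat_recr n.+1)// [K * _]mulrDr /=.
  have [h1 h2 h3 h4] := step n.+1 nT.
  have [a0 e0 g00] := pos n.+1.
  have h : phi n.+2 + gam / 4 * eta n.+1 * s n.+1 <= phi n.+1 + K * eta n.+1 ^+ 3 := lyapunov_step b0 l0 g0 t0 L0 (eta0 n.+1) (mulfV (lt0r_neq0 (eta0 n.+1)))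
    a0 e0 g00 (p0 n.+1) (q0 n.+1) (sqr_ge0 delta) (eta_inv_succ k0 m2 mk n) hc1 hc2
    (al01 _ _ c10 mc1) (al01 _ _ c20 mc2) hlam hgam h1 h2 h3 h4 erefl erefl.
  have {}IH := IH (ltnW nT); move: IH h; clear; clearbody phi K s eta; lra.
have {}tele := tele T (leqnn T).
have phi0 : 0 <= phi T.+1.
  have F0 := Fpos T.+1 (leqnn _); have [a0 e0 g00] := pos T.+1; rewrite /phi addr_ge0 ?addr_ge0 ?(mulr_ge0 C0)//.
  by rewrite mulr_ge0 ?(ltW G0)// mulr_ge0 ?addr_ge0 ?invr_ge0 ?(ltW (eta0 _)).
have low : gam / 4 * eta T * \sum_(1 <= i < T.+1) s i <= \sum_(1 <= i < T.+1) gam / 4 * eta i * s i.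
  rewrite mulr_sumr; apply: ler_sum_nat => i /andP[_ iT].
  by rewrite ler_wpM2r// ler_pM2l ?divr_gt0//; exact: eta_nincr.
have sume := sum_eta_pow3 k0 m2 T.
have phi1 : phi 1%N <= F 1%N + C * a 1%N + G * (m `^ 3^-1 / k * (2 * delta ^+ 2 / b)).
  rewrite /phi lerD2l ler_pM2l//= /eta eta_inv addr0 ler_wpM2l//.
    by rewrite divr_ge0 ?powR_ge0// ltW.
  by move: e1 g1; lra.
have m0 : 0 < m by exact: lt_le_trans m2.
have bound : gam / 4 * eta T * \sum_(1 <= i < T.+1) s i <=
    F 1%N + C * a 1%N + G * (m `^ 3^-1 / k * (2 * delta ^+ 2 / b)) +
    K * (k ^+ 3 * ln (m + T%:R)).
  have := ler_wpM2l K0 sume; rewrite -/eta => hK.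
  by apply: (le_trans low); move: tele phi0 phi1 hK; lra.
have A0 : 0 < (m + T%:R) `^ 3^-1 by rewrite powR_gt0// ltr_wpDr.
have D0 : 0 < gam / 4 * eta T by rewrite mulr_gt0// divr_gt0.
rewrite -(ler_pM2l D0); apply: (le_trans bound).
rewrite le_eqVlt; apply/predU1P; left.
rewrite /eta /Defs.eta /C /K /G; set A := (m + T%:R) `^ 3^-1 in A0 *.
field; rewrite !gt_eqF//.
Qed.

(** * Error of the recursive estimates, for an abstract oracle [G] with mean [Gm] *)

Lemma integral_prob_cst d (T : measurableType d) {R : realType}
    (P : probability T R) (k : \bar R) : (\int[P]__ k = k)%E.
Proof.
transitivity (k * P setT)%E; first exact: integral_cst.
by rewrite probability_setT mule1.
Qed.

Section gradient_oracle.
Context {R : realType} {d1 d2 n : nat} {dXi : measure_display}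
  {Xi : measurableType dXi} (D : probability Xi R).
Variables (X : set 'rV[R]_d1) (Y : set 'rV[R]_d2) (L delta : R).
Variables (G : Xi -> 'rV[R]_d1 -> 'rV[R]_d2 -> 'rV[R]_n)
  (Gm : 'rV[R]_d1 -> 'rV[R]_d2 -> 'rV[R]_n).
Hypotheses (X_proj : projectable X) (Y_proj : projectable Y) (L_gt0 : 0 < L).
Hypothesis G_lip : forall z x x' y y', X x -> X x' -> Y y -> Y y' ->
  enorm (G z x y - G z x' y') ^+ 2
    <= L ^+ 2 * (enorm (x - x') ^+ 2 + enorm (y - y') ^+ 2).
Hypothesis Gm_lip : forall x x' y y', X x -> X x' -> Y y -> Y y' ->
  enorm (Gm x y - Gm x' y') ^+ 2
    <= L ^+ 2 * (enorm (x - x') ^+ 2 + enorm (y - y') ^+ 2).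
Hypothesis G_mean : forall x y c, X x -> Y y ->
  D.-integrable setT (fun z => (G z x y 0 c)%:E) /\
  \int[D]_z G z x y 0 c = Gm x y 0 c.
Hypothesis G_var : forall x y, X x -> Y y ->
  (\int[D]_z (enorm (G z x y - Gm x y) ^+ 2)%:E <= (delta ^+ 2)%:E)%E.

Lemma sqr_lip_le (u : 'rV[R]_n) (a b : R) c : 0 <= a -> 0 <= b ->
  enorm u ^+ 2 <= L ^+ 2 * (a ^+ 2 + b ^+ 2) ->
  `|u 0 c| <= L * ((a + b) + (a + b) ^+ 2).
Proof.
move=> a0 b0 h; apply: (le_trans (coord_le_enorm u c)).
have : enorm u <= L * (a + b).
  rewrite -(ler_pXn2r (n := 2))// ?nnegrE ?enorm_ge0 ?mulr_ge0 ?addr_ge0 ?(ltW L_gt0)//.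
  apply: (le_trans h); rewrite exprMn ler_wpM2l ?sqr_ge0// sqrrD.
  by rewrite -addrA [_ *+ 2 + _]addrC addrA lerDl mulrn_wge0// mulr_ge0.
move/le_trans; apply; rewrite ler_pM2l// lerDl sqr_ge0//.
Qed.

Lemma measurable_oracle_mean {d} {S : measurableType d}
    (Z : S -> 'rV[R]_d1) (W : S -> 'rV[R]_d2) c :
  (forall s, X (Z s)) -> (forall s, Y (W s)) ->
  (forall c, measurable_fun setT (fun s => Z s 0 c)) ->
  (forall c, measurable_fun setT (fun s => W s 0 c)) ->
  measurable_fun setT (fun s => Gm (Z s) (W s) 0 c).
Proof.
move=> XZ YW mZ mW.
apply: (measurable_caratheodory2 (g := fun _ x y => Gm x y 0 c) X_proj Y_proj) => //.
move=> s; exists L => x y Xx Yy /=; rewrite -row_subE.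
by apply: sqr_lip_le; rewrite ?enorm_ge0//; exact: Gm_lip.
Qed.

Lemma measurable_oracle {d} {S : measurableType d} (zeta : S -> Xi)
    (Z : S -> 'rV[R]_d1) (W : S -> 'rV[R]_d2) c :
  measurable_fun setT zeta -> (forall s, X (Z s)) -> (forall s, Y (W s)) ->
  (forall c, measurable_fun setT (fun s => Z s 0 c)) ->
  (forall c, measurable_fun setT (fun s => W s 0 c)) ->
  measurable_fun setT (fun s => G (zeta s) (Z s) (W s) 0 c).
Proof.
move=> mzeta XZ YW mZ mW.
apply: (measurable_caratheodory2 (g := fun s x y => G (zeta s) x y 0 c) X_proj Y_proj) => //.
  move=> x y Xx Yy; have [/measurable_int/measurable_EFinP mG _] := G_mean c Xx Yy.
  exact: (measurableT_comp mG mzeta).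
move=> s; exists L => x y Xx Yy /=; rewrite -row_subE.
by apply: sqr_lip_le; rewrite ?enorm_ge0//; exact: G_lip.
Qed.

Lemma measurable_oracle_batch {d} {S : measurableType d} b (zeta : 'I_b -> S -> Xi)
    (Z : S -> 'rV[R]_d1) (W : S -> 'rV[R]_d2) c :
  (forall i, measurable_fun setT (zeta i)) ->
  (forall s, X (Z s)) -> (forall s, Y (W s)) ->
  (forall c, measurable_fun setT (fun s => Z s 0 c)) ->
  (forall c, measurable_fun setT (fun s => W s 0 c)) ->
  measurable_fun setT (fun s => (b%:R^-1 *: \sum_i G (zeta i s) (Z s) (W s)) 0 c).
Proof.
move=> mzeta XZ YW mZ mW; under eq_fun do rewrite mxE summxE.
apply: measurable_funM => //; apply: measurable_sum => i.
exact: measurable_oracle.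
Qed.

Lemma measurable_oracle_update {d} {S : measurableType d} b (zeta : 'I_b -> S -> Xi)
    (Z Z' : S -> 'rV[R]_d1) (W W' : S -> 'rV[R]_d2) (V : S -> 'rV[R]_n) (r : R) c :
  (forall i, measurable_fun setT (zeta i)) ->
  (forall s, X (Z s)) -> (forall s, Y (W s)) ->
  (forall s, X (Z' s)) -> (forall s, Y (W' s)) ->
  (forall c, measurable_fun setT (fun s => Z s 0 c)) ->
  (forall c, measurable_fun setT (fun s => W s 0 c)) ->
  (forall c, measurable_fun setT (fun s => Z' s 0 c)) ->
  (forall c, measurable_fun setT (fun s => W' s 0 c)) ->
  (forall c, measurable_fun setT (fun s => V s 0 c)) ->
  measurable_fun setT (fun s => (b%:R^-1 *: (\sum_i G (zeta i s) (Z' s) (W' s)) +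
    r *: (V s - b%:R^-1 *: \sum_i G (zeta i s) (Z s) (W s))) 0 c).
Proof.
move=> mzeta XZ YW XZ' YW' mZ mW mZ' mW' mV.
have E s : (b%:R^-1 *: (\sum_i G (zeta i s) (Z' s) (W' s)) +
    r *: (V s - b%:R^-1 *: \sum_i G (zeta i s) (Z s) (W s))) 0 c =
  (b%:R^-1 *: \sum_i G (zeta i s) (Z' s) (W' s)) 0 c +
  r * (V s 0 c - (b%:R^-1 *: \sum_i G (zeta i s) (Z s) (W s)) 0 c).
  by move: (b%:R^-1 *: _) (b%:R^-1 *: _) => u1 u2; rewrite !mxE.
under eq_fun do rewrite E.
apply: measurable_funD; first exact: measurable_oracle_batch.
apply: measurable_funM => //; apply: measurable_funB => //.
exact: measurable_oracle_batch.
Qed.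

Context {dO : measure_display} {Omega : measurableType dO}
  (P : probability Omega R) {I : choiceType} (J : set I) (xi : I -> {RV P >-> Xi}).
Hypothesis xi_indep : mutually_independent P J (fun i => xi i : Omega -> Xi).
Hypothesis xi_distr : forall i A, J i -> measurable A ->
  distribution P (xi i) A = D A.

Lemma oracle_centered x y c : X x -> Y y ->
  D.-integrable setT (fun z => ((G z x y - Gm x y) 0 c)%:E) /\
  \int[D]_z (G z x y - Gm x y) 0 c = 0.
Proof.
move=> Xx Yy; have [iG mG] := G_mean c Xx Yy.
have iC : D.-integrable setT (fun _ => (Gm x y 0 c)%:E).
  by apply/finite_measure_integrable_cst.
split.
  under eq_fun do rewrite row_subE EFinB.
  exact: integrableB.
transitivity (\int[D]_z G z x y 0 c - \int[D]_z (Gm x y 0 c)).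
  rewrite -RintegralB//; apply: eq_Rintegral => z _; exact: row_subE.
by rewrite mG Rintegral_prob_cst subrr.
Qed.

Lemma measurable_oracle_at x y c : X x -> Y y ->
  measurable_fun setT (fun z => G z x y 0 c).
Proof. by move=> Xx Yy; have [/measurable_int/measurable_EFinP] := G_mean c Xx Yy. Qed.

(** The noise one fresh sample brings into one update. The centered increment between the two points
    has variance at most its second moment, which the Lipschitz bound controls. *)
Lemma oracle_increment_variance al x x' y y' :
  X x -> X x' -> Y y -> Y y' ->
  (\int[D]_z (enorm (al *: (G z x' y' - Gm x' y') + (1 - al) *:
     ((G z x' y' - Gm x' y') - (G z x y - Gm x y))) ^+ 2)%:E <=
   (2 * al ^+ 2 * delta ^+ 2 + 2 * (1 - al) ^+ 2 *
     (L ^+ 2 * (enorm (x' - x) ^+ 2 + enorm (y' - y) ^+ 2)))%:E)%E.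
Proof.
move=> Xx Xx' Yy Yy'.
pose B z := G z x' y' - Gm x' y'; pose V z := G z x' y' - G z x y.
pose M := Gm x' y' - Gm x y; pose r := L ^+ 2 * (enorm (x' - x) ^+ 2 + enorm (y' - y) ^+ 2).
have mB c : measurable_fun setT (fun z => B z 0 c).
  by under eq_fun do rewrite row_subE; apply: measurable_funB => //;
    exact: measurable_oracle_at.
have mV c : measurable_fun setT (fun z => V z 0 c).
  by under eq_fun do rewrite row_subE; apply: measurable_funB => //;
    exact: measurable_oracle_at.
have mVM c : measurable_fun setT (fun z => (V z - M) 0 c).
  by under eq_fun do rewrite row_subE; apply: measurable_funB.
have msB := measurable_sqr_enorm mB; have msVM := measurable_sqr_enorm mVM.
have r0 : 0 <= r by rewrite mulr_ge0 ?addr_ge0 ?sqr_ge0.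
have Vr z : enorm (V z) ^+ 2 <= r by exact: G_lip.
have VM : (\int[D]_z (enorm (V z - M) ^+ 2)%:E <= r%:E)%E.
  apply: (@le_trans _ _ (\int[D]_z (enorm (V z) ^+ 2)%:E)%E).
    apply: (@variance_le_sqr_enorm _ _ _ D _ V M (Num.sqrt r)) => //.
      move=> z; rewrite -(ler_pXn2r (n := 2))// ?nnegrE ?enorm_ge0 ?sqrtr_ge0//.
      by rewrite [leRHS]sqr_sqrtr//; exact: Vr.
    move=> c; have [i1 m1] := G_mean c Xx' Yy'; have [i2 m2] := G_mean c Xx Yy.
    transitivity (\int[D]_z G z x' y' 0 c - \int[D]_z G z x y 0 c).
      by rewrite -RintegralB//; apply: eq_Rintegral => z _; exact: row_subE.
    by rewrite m1 m2 row_subE.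
  rewrite -[leRHS](integral_prob_cst D); apply: ge0_le_integral => //.
  - by move=> z _; rewrite lee_fin sqr_ge0.
  - by apply/measurable_EFinP; exact: measurable_sqr_enorm.
  - by move=> z _; rewrite lee_fin.
have al0 : 0 <= 2 * al ^+ 2 by rewrite mulr_ge0 ?sqr_ge0.
have al1 : 0 <= 2 * (1 - al) ^+ 2 by rewrite mulr_ge0 ?sqr_ge0.
apply: (@le_trans _ _ (\int[D]_z ((2 * al ^+ 2)%:E * (enorm (B z) ^+ 2)%:E +
    (2 * (1 - al) ^+ 2)%:E * (enorm (V z - M) ^+ 2)%:E))%E).
  apply: ge0_le_integral => //.
  - by move=> z _; rewrite lee_fin sqr_ge0.
  - apply/measurable_EFinP; apply: measurable_sqr_enorm => c.
    have -> : (fun z => (al *: (G z x' y' - Gm x' y') + (1 - al) *: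
        (G z x' y' - Gm x' y' - (G z x y - Gm x y))) 0 c) =
      (fun z => al * B z 0 c + (1 - al) * (V z - M) 0 c).
      by apply/funext => z; rewrite /B /V /M !mxE; ring.
    by apply: measurable_funD; apply: measurable_funM.
  - by apply: emeasurable_funD; apply: emeasurable_funM => //;
      apply/measurable_EFinP.
  - move=> z _; rewrite -!EFinM -EFinD lee_fin.
    have -> : G z x' y' - Gm x' y' - (G z x y - Gm x y) = V z - M.
      by apply/rowP => c; rewrite /V /M !mxE; ring.
    apply: (le_trans (sqr_enormD_le _ _)); rewrite !enormZ !exprMn !real_normK ?num_real//.
    by rewrite !mulrA.
rewrite ge0_integralD//; last 4 first.
- by move=> z _; rewrite mule_ge0// lee_fin ?sqr_ge0.
- by apply: emeasurable_funM => //; apply/measurable_EFinP.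
- by move=> z _; rewrite mule_ge0// lee_fin ?sqr_ge0.
- by apply: emeasurable_funM => //; apply/measurable_EFinP.
rewrite !ge0_integralZl_EFin//; last 4 first.
- by move=> z _; rewrite lee_fin sqr_ge0.
- exact/measurable_EFinP.
- by move=> z _; rewrite lee_fin sqr_ge0.
- exact/measurable_EFinP.
rewrite EFinD (EFinM (2 * al ^+ 2)) (EFinM (2 * (1 - al) ^+ 2)).
apply: leeD; apply: lee_wpmul2l; rewrite ?lee_fin//.
exact: G_var.
Qed.

(** [history_batch_mean] with an empty history and no earlier error. *)
Lemma oracle_init b (t : 'I_b -> I) x y : (0 < b)%N -> injective t ->
  (forall i, J (t i)) -> X x -> Y y ->
  (\int[P]_w (enorm (Gm x y - b%:R^-1 *: \sum_i G (xi (t i) w) x y) ^+ 2)%:E <=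
   (delta ^+ 2 / b%:R)%:E)%E.
Proof.
move=> b0 t_inj Jt Xx Yy.
have E w : enorm (Gm x y - b%:R^-1 *: \sum_i G (xi (t i) w) x y) =
    enorm (0 + b%:R^-1 *: \sum_i (G (xi (t i) w) x y - Gm x y)).
  rewrite enormC add0r big_split/= sumr_const card_ord scalerDr mulNrn scalerN.
  by rewrite -[Gm x y *+ b]scaler_nat scalerA mulVf ?scale1r// pnatr_eq0 -lt0n.
under eq_integral do rewrite E.
apply: le_trans (history_batch_mean xi_indep xi_distr (s := [::]) (t := t)
  (A := fun _ => 0) (h := fun _ z => G z x y - Gm x y) _ _ _ _ _ _ _ _ _ _) _ => //.
- move=> c; have [/measurable_int/measurable_EFinP mG _] := oracle_centered c Xx Yy.
  exact: (measurableT_comp mG measurable_snd).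
- by move=> _ c; have [] := oracle_centered c Xx Yy.
- by move=> _ c; have [] := oracle_centered c Xx Yy.
under eq_integral do rewrite enorm0 expr0n/=.
rewrite integral0 add0e integral_prob_cst.
rewrite mulrC EFinM lee_pmul2l ?lte_fin ?invr_gt0 ?ltr0n//.
exact: G_var.
Qed.

(** Up to sign the new error is 1 - al times the old one, which the history [s] determines, plus a
    batch mean of centered terms. Evaluating the same fresh batch at both points is what makes these
    terms small when the iterates move little. *)
Lemma oracle_step b s (t : 'I_b -> I) (al : R) (x x' : Omega -> 'rV[R]_d1)
    (y y' : Omega -> 'rV[R]_d2) (v : Omega -> 'rV[R]_n) :
  (0 < b)%N -> injective t -> uniq s -> (forall i, t i \notin s) ->
  (forall i, J (t i)) -> [set` s] `<=` J -> 0 <= al <= 1 ->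
  (forall w, X (x w)) -> (forall w, X (x' w)) -> (forall w, Y (y w)) ->
  (forall w, Y (y' w)) ->
  (forall c, measurable_fun setT ((fun w => x w 0 c) : history xi s -> R)) ->
  (forall c, measurable_fun setT ((fun w => x' w 0 c) : history xi s -> R)) ->
  (forall c, measurable_fun setT ((fun w => y w 0 c) : history xi s -> R)) ->
  (forall c, measurable_fun setT ((fun w => y' w 0 c) : history xi s -> R)) ->
  (forall c, measurable_fun setT ((fun w => v w 0 c) : history xi s -> R)) ->
  (\int[P]_w (enorm (Gm (x' w) (y' w) - (b%:R^-1 *: \sum_i G (xi (t i) w) (x' w) (y' w)
      + (1 - al) *: (v w - b%:R^-1 *: \sum_i G (xi (t i) w) (x w) (y w)))) ^+ 2)%:E <=
   ((1 - al) ^+ 2)%:E * \int[P]_w (enorm (Gm (x w) (y w) - v w) ^+ 2)%:E +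
   b%:R^-1%:E * \int[P]_w (2 * al ^+ 2 * delta ^+ 2 + 2 * (1 - al) ^+ 2 *
     (L ^+ 2 * (enorm (x' w - x w) ^+ 2 + enorm (y' w - y w) ^+ 2)))%:E)%E.
Proof.
move=> b0 t_inj us ts Jt Js al01 Xx Xx' Yy Yy' mx mx' my my' mv.
pose B w z := G z (x' w) (y' w) - Gm (x' w) (y' w).
pose C w z := G z (x w) (y w) - Gm (x w) (y w).
pose h w z := al *: B w z + (1 - al) *: (B w z - C w z).
pose A w := (1 - al) *: (v w - Gm (x w) (y w)).
have bN0 : b%:R != 0 :> R by rewrite pnatr_eq0 -lt0n.
have meanB (u : 'I_b -> 'rV[R]_n) M :
    b%:R^-1 *: \sum_i (u i - M) = b%:R^-1 *: \sum_i u i - M.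
  rewrite big_split/= sumr_const card_ord scalerDr mulNrn scalerN.
  by rewrite -[M *+ b]scaler_nat scalerA mulVf ?scale1r.
have E w : enorm (Gm (x' w) (y' w) - (b%:R^-1 *: \sum_i G (xi (t i) w) (x' w) (y' w)
      + (1 - al) *: (v w - b%:R^-1 *: \sum_i G (xi (t i) w) (x w) (y w)))) =
    enorm (A w + b%:R^-1 *: \sum_i h w (xi (t i) w)).
  rewrite enormC; congr enorm.
  have -> : b%:R^-1 *: \sum_i h w (xi (t i) w) =
      b%:R^-1 *: (\sum_i B w (xi (t i) w)) -
      (1 - al) *: (b%:R^-1 *: (\sum_i C w (xi (t i) w))).
    rewrite scalerA mulrC -scalerA -scalerBr; congr (_ *: _).
    rewrite scaler_sumr -sumrB; apply: eq_bigr => i _.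
    by apply/rowP => c; rewrite /h !mxE; ring.
  rewrite /B /C !meanB /A; move: (b%:R^-1 *: _) (b%:R^-1 *: _) => u1 u2.
  by apply/rowP => c; rewrite !mxE; ring.
under eq_integral do rewrite E.
have mGm c : measurable_fun setT ((fun w => Gm (x w) (y w) 0 c) : history xi s -> R).
  exact: (@measurable_oracle_mean _ (history xi s)).
have mU (g : Omega -> R) : measurable_fun setT (g : history xi s -> R) ->
    measurable_fun setT (fun u : history xi s * Xi => g u.1).
  by move=> mg; exact: (measurableT_comp (f := (g : history xi s -> R))).
have mD c (X0 : Omega -> 'rV[R]_d1) (Y0 : Omega -> 'rV[R]_d2) :
    (forall w, X (X0 w)) -> (forall w, Y (Y0 w)) ->
    (forall c, measurable_fun setT ((fun w => X0 w 0 c) : history xi s -> R)) ->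
    (forall c, measurable_fun setT ((fun w => Y0 w 0 c) : history xi s -> R)) ->
    measurable_fun setT (fun u : history xi s * Xi =>
      (G u.2 (X0 u.1) (Y0 u.1) - Gm (X0 u.1) (Y0 u.1)) 0 c).
  move=> XX YY mX mY; under eq_fun do rewrite row_subE; apply: measurable_funB.
    apply: (measurable_oracle (zeta := snd) (Z := fun u : history xi s * Xi => X0 u.1)
      (W := fun u => Y0 u.1)) => // c'; [exact: (mU _ (mX c'))|exact: (mU _ (mY c'))].
  apply: (measurable_oracle_mean (Z := fun u : history xi s * Xi => X0 u.1)
    (W := fun u => Y0 u.1)) => // c'; [exact: (mU _ (mX c'))|exact: (mU _ (mY c'))].
have mB c : measurable_fun setT (fun u : history xi s * Xi => B u.1 u.2 0 c).
  exact: mD.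
have mC c : measurable_fun setT (fun u : history xi s * Xi => C u.1 u.2 0 c).
  exact: mD.
have hE w z c : h w z 0 c = al * B w z 0 c + (1 - al) * (B w z 0 c - C w z 0 c).
  by rewrite !mxE.
have AE w c : A w 0 c = (1 - al) * (v w 0 c - Gm (x w) (y w) 0 c) by rewrite !mxE.
apply: (le_trans (history_batch_mean xi_indep xi_distr (s := s) (t := t)
  (A := A) (h := h) _ _ _ _ _ _ _ _ _ _)) => //.
- move=> c; under eq_fun do rewrite AE.
  by apply: measurable_funM => //; apply: measurable_funB.
- move=> c; under eq_fun do rewrite hE.
  apply: measurable_funD; apply: measurable_funM => //; exact: measurable_funB.
- move=> w c; have [i1 m1] := oracle_centered c (Xx' w) (Yy' w).
  have [i2 m2] := oracle_centered c (Xx w) (Yy w).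
  have [i3 _] := integrable_lincomb4 al (1 - al) (- (1 - al)) 0 i1 i1 i2 i2.
  apply: eq_integrable i3 => // z _.
  by rewrite hE /B /C/=; congr (_%:E); ring.
- move=> w c; have [i1 m1] := oracle_centered c (Xx' w) (Yy' w).
  have [i2 m2] := oracle_centered c (Xx w) (Yy w).
  have [_] := integrable_lincomb4 al (1 - al) (- (1 - al)) 0 i1 i1 i2 i2.
  rewrite m1 m2 !mulr0 !addr0 => <-; apply: eq_Rintegral => z _.
  by rewrite hE /B /C/=; ring.
have mP (g : Omega -> R) : measurable_fun setT (g : history xi s -> R) ->
    measurable_fun setT g by move=> mg; exact: (@history_measurable_funW _ _ _ _ _ _ _ xi s).
apply: leeD.
  rewrite -ge0_integralZl_EFin ?sqr_ge0//; last 2 first.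
  - by move=> w _; rewrite lee_fin sqr_ge0.
  - apply/measurable_EFinP; apply: measurable_sqr_enorm => c; apply: mP.
    by under eq_fun do rewrite row_subE; exact: measurable_funB.
  rewrite le_eqVlt; apply/predU1P; left; apply: eq_integral => w _.
  by rewrite /A enormZ exprMn real_normK ?num_real// -EFinM (enormC (v w)).
apply: lee_wpmul2l; first by rewrite lee_fin invr_ge0.
apply: ge0_le_integral => //.
- by move=> w _; apply: integral_ge0 => z _; rewrite lee_fin sqr_ge0.
- apply: (@history_measurable_funW _ _ _ _ _ _ _ xi s).
  apply: (measurable_fun_fubini_tonelli_F (m2 := D)
    (fun u : history xi s * Xi => (enorm (h u.1 u.2) ^+ 2)%:E)).
    apply/measurable_EFinP; apply: measurable_sqr_enorm => c.
    under eq_fun do rewrite hE.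
    by apply: measurable_funD; apply: measurable_funM => //; exact: measurable_funB.
  by move=> u; rewrite lee_fin sqr_ge0.
- apply/measurable_EFinP; apply: measurable_funD => //; apply: measurable_funM => //.
  apply: measurable_funM => //.
  apply: measurable_funD; apply: measurable_sqr_enorm => c;
    under eq_fun do rewrite row_subE; apply: measurable_funB; exact: mP.
- by move=> w _; exact: oracle_increment_variance.
Qed.
End gradient_oracle.

(** * The Lyapunov argument in expectation *)

Section expected_lyapunov.
Context {d} {Om : measurableType d} {R : realType} (P : probability Om R).
Variables (F a e g p q : nat -> Om -> R) (F1 a1 : R) (T : nat).
Variables (b k m c1 c2 lam gam tau L delta : R).
Hypotheses (b0 : 0 < b) (l0 : 0 < lam) (g0 : 0 < gam) (t0 : 0 < tau) (L0 : 0 < L)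
  (k0 : 0 < k) (m2 : 2 <= m) (mk : k ^+ 3 <= m) (mc1 : (c1 * k) ^+ 3 <= m)
  (mc2 : (c2 * k) ^+ 3 <= m)
  (hc1 : 2 / (3 * k ^+ 3) + 9 * tau ^+ 2 / 4 <= c1)
  (hc2 : 2 / (3 * k ^+ 3) + 75 * L ^+ 2 / 2 <= c2)
  (hlam : lam <= 27 * b * tau / 16)
  (hgam : gam <= lam * tau / (2 * L)
    * Num.sqrt (2 * b / (8 * lam ^+ 2 + 75 * (L / tau) ^+ 2 * b))).
Hypotheses (Fpos : forall n o, (1 <= n <= T.+1)%N -> 0 <= F n o)
  (pos : forall n o, [/\ 0 <= a n o, 0 <= e n o & 0 <= g n o])
  (p0 : forall n o, 0 <= p n o) (q0 : forall n o, 0 <= q n o).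
Hypotheses (mF : forall n, (1 <= n <= T.+1)%N -> measurable_fun setT (F n))
  (ma : forall n, (1 <= n <= T.+1)%N -> measurable_fun setT (a n))
  (me : forall n, (1 <= n <= T.+1)%N -> measurable_fun setT (e n))
  (mg : forall n, (1 <= n <= T.+1)%N -> measurable_fun setT (g n))
  (mp : forall n, (1 <= n <= T)%N -> measurable_fun setT (p n))
  (mq : forall n, (1 <= n <= T)%N -> measurable_fun setT (q n)).
Hypotheses (F1E : forall o, F 1%N o = F1) (a1E : forall o, a 1%N o = a1)
  (e1 : (\int[P]_o (e 1%N o)%:E <= (delta ^+ 2 / b)%:E)%E)
  (g1 : (\int[P]_o (g 1%N o)%:E <= (delta ^+ 2 / b)%:E)%E).
Hypotheses
  (Fstep : forall n o, (1 <= n <= T)%N -> F n.+1 o <= F n o + Defs.eta k m n *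
     (2 * gam * L ^+ 2 * a n o + 2 * gam * e n o - p n o / (2 * gam)))
  (astep : forall n o, (1 <= n <= T)%N -> let eta := Defs.eta k m n in
     a n.+1 o <= (1 - eta * tau * lam / 4) * a n o - 3 * eta / 4 * q n o
          + 25 * eta * lam / (6 * tau) * g n o
          + 25 * (L / tau) ^+ 2 * eta / (6 * tau * lam) * p n o).
Let bnd c n o : R := 2 * (c * Defs.eta k m n ^+ 2) ^+ 2 * delta ^+ 2
  + 2 * (1 - c * Defs.eta k m n ^+ 2) ^+ 2
    * (L ^+ 2 * Defs.eta k m n ^+ 2 * (p n o + q n o)).
Hypotheses
  (estep : forall n, (1 <= n <= T)%N -> (\int[P]_o (e n.+1 o)%:E <=
     ((1 - c1 * Defs.eta k m n ^+ 2) ^+ 2)%:E * \int[P]_o (e n o)%:E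
     + b^-1%:E * \int[P]_o (bnd c1 n o)%:E)%E)
  (gstep : forall n, (1 <= n <= T)%N -> (\int[P]_o (g n.+1 o)%:E <=
     ((1 - c2 * Defs.eta k m n ^+ 2) ^+ 2)%:E * \int[P]_o (g n o)%:E
     + b^-1%:E * \int[P]_o (bnd c2 n o)%:E)%E).

Let Int (h : Om -> R) := P.-integrable setT (EFin \o h).

(** Since [F n.+1] and [a n.+1] are nonnegative, the step inequalities read backwards dominate [p n]
    and [q n] by integrable quantities. *)
Lemma expected_pq n : (1 <= n <= T)%N -> Int (F n) -> Int (a n) -> Int (e n) ->
  Int (g n) -> Int (p n) /\ Int (q n).
Proof.
move=> nT iF ia ie ig.
have eta0 : 0 < Defs.eta k m n := eta_gt0 k0 m2 n.
have n1T : (1 <= n.+1 <= T.+1)%N by case/andP: nT.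
have ip : Int (p n).
  have [i _] := integrable_lincomb4 (2 * gam / Defs.eta k m n) (4 * gam ^+ 2 * L ^+ 2)
    (4 * gam ^+ 2) 0 iF ia ie ie.
  apply: (integrable_dominated (mp nT) _ i) => o; rewrite p0/= mul0r addr0.
  have h := le_trans (Fpos o n1T) (Fstep o nT).
  have c0 : 0 <= 2 * gam / Defs.eta k m n.
    by rewrite divr_ge0 ?(ltW eta0)// mulr_ge0// ltW.
  rewrite -subr_ge0; apply: (le_trans (mulr_ge0 c0 h)).
  by rewrite le_eqVlt; apply/predU1P; left; field; rewrite !gt_eqF.
split=> //.
have [i _] := integrable_lincomb4 (4 / (3 * Defs.eta k m n) * `|1 - Defs.eta k m n * tau * lam / 4|)
  (4 / (3 * Defs.eta k m n) * (25 * Defs.eta k m n * lam / (6 * tau)))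
  (4 / (3 * Defs.eta k m n) * (25 * (L / tau) ^+ 2 * Defs.eta k m n / (6 * tau * lam)))
  0 ia ig ip ip.
apply: (integrable_dominated (mq nT) _ i) => o; rewrite q0/= mul0r addr0.
have [an1 _ _] := pos n.+1 o; have [an _ _] := pos n o.
have h := le_trans an1 (astep o nT).
have hn : (1 - Defs.eta k m n * tau * lam / 4) * a n o <=
   `|1 - Defs.eta k m n * tau * lam / 4| * a n o by rewrite ler_wpM2r// ler_norm.
have E4 : q n o = 4 / (3 * Defs.eta k m n) * (3 * Defs.eta k m n / 4 * q n o).
  by field; rewrite !gt_eqF.
have c0 : 0 < 4 / (3 * Defs.eta k m n) by rewrite divr_gt0// mulr_gt0.
rewrite [leLHS]E4 -[4 / _ * _ * a n o]mulrA -[4 / _ * _ * g n o]mulrA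
  -[4 / _ * _ * p n o]mulrA -!mulrDr ler_pM2l//.
by move: h hn; lra.
Qed.

Lemma integral_bnd c n : (1 <= n <= T)%N -> Int (p n) -> Int (q n) ->
  (\int[P]_o (bnd c n o)%:E = (2 * (c * Defs.eta k m n ^+ 2) ^+ 2 * delta ^+ 2
  + 2 * (1 - c * Defs.eta k m n ^+ 2) ^+ 2
    * (L ^+ 2 * Defs.eta k m n ^+ 2 * (\int[P]_o p n o + \int[P]_o q n o)))%:E)%E.
Proof.
move=> nT ip iq.
have i1 : Int (fun _ => 1) by apply/finite_measure_integrable_cst.
pose K := 2 * (1 - c * Defs.eta k m n ^+ 2) ^+ 2 * (L ^+ 2 * Defs.eta k m n ^+ 2).
have [i E] := integrable_lincomb4 (2 * (c * Defs.eta k m n ^+ 2) ^+ 2 * delta ^+ 2)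
  K K 0 i1 ip iq iq.
have iE : bnd c n = (fun o => 2 * (c * Defs.eta k m n ^+ 2) ^+ 2 * delta ^+ 2 * 1 +
  K * p n o + K * q n o + 0 * q n o).
  by apply/funext => o; rewrite /bnd /K; ring.
rewrite (Rintegral_EFin (h := bnd c n)); last by rewrite [bnd c n]iE.
by congr EFin; rewrite [bnd c n]iE E Rintegral_prob_cst /K; ring.
Qed.

(** [Y] may be unbounded, so integrability has to be carried along the run, starting from a
    deterministic point and a first batch of finite variance. *)
Lemma expected_integrable n : (n <= T)%N ->
  [/\ Int (F n.+1), Int (a n.+1), Int (e n.+1) & Int (g n.+1)].
Proof.
elim: n => [|n IH] nT.
  split.
  - rewrite (_ : F 1%N = fun _ => F1); last exact/funext.
    by apply/finite_measure_integrable_cst.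
  - rewrite (_ : a 1%N = fun _ => a1); last exact/funext.
    by apply/finite_measure_integrable_cst.
  - by apply: (ge0_integrable_fin (me _) _ e1) => // o; case: (pos 1%N o).
  - by apply: (ge0_integrable_fin (mg _) _ g1) => // o; case: (pos 1%N o).
have [iF ia ie ig] := IH (ltnW nT).
have nT' : (1 <= n.+1 <= T)%N by [].
have n1T : (1 <= n.+2 <= T.+1)%N by [].
have [ip iq] := expected_pq nT' iF ia ie ig.
split.
- have [i _] := integrable_lincomb4 1 (Defs.eta k m n.+1 * (2 * gam * L ^+ 2))
    (Defs.eta k m n.+1 * (2 * gam)) (- (Defs.eta k m n.+1 / (2 * gam))) iF ia ie ip.
  apply: (integrable_dominated (mF n1T) _ i) => o; rewrite Fpos//=.
  apply: (le_trans (Fstep o nT')); rewrite le_eqVlt; apply/predU1P; left; ring.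
- have [i _] := integrable_lincomb4 (1 - Defs.eta k m n.+1 * tau * lam / 4)
    (- (3 * Defs.eta k m n.+1 / 4)) (25 * Defs.eta k m n.+1 * lam / (6 * tau))
    (25 * (L / tau) ^+ 2 * Defs.eta k m n.+1 / (6 * tau * lam)) ia iq ig ip.
  apply: (integrable_dominated (ma n1T) _ i) => o; have [-> _ _]/= := pos n.+2 o.
  by apply: (le_trans (astep o nT')); rewrite le_eqVlt; apply/predU1P; left; ring.
- have := estep nT'; rewrite (Rintegral_EFin ie) (integral_bnd c1 nT' ip iq) -!EFinM -EFinD.
  by apply: (ge0_integrable_fin (me _)) => // o; case: (pos n.+2 o).
- have := gstep nT'; rewrite (Rintegral_EFin ig) (integral_bnd c2 nT' ip iq) -!EFinM -EFinD.
  by apply: (ge0_integrable_fin (mg _)) => // o; case: (pos n.+2 o).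
Qed.

(** All one-step inequalities are linear in the random quantities, so [lyapunov_sum] applies to
    their expectations. *)
Lemma expected_lyapunov :
  (forall n, (1 <= n <= T)%N -> [/\ Int (p n), Int (a n) & Int (e n)]) /\
  \sum_(1 <= n < T.+1) (\int[P]_o p n o / gam ^+ 2 + L ^+ 2 * \int[P]_o a n o
    + \int[P]_o e n o) <=
  4 * (F1 / (gam * k) + 9 * L ^+ 2 * a1 / (k * lam * tau)
    + 2 * m `^ 3^-1 * delta ^+ 2 / (b * tau ^+ 2 * k ^+ 2)
    + 2 * (c1 ^+ 2 + c2 ^+ 2) * delta ^+ 2 * k ^+ 2 / (b * tau ^+ 2) * ln (m + T%:R))
  * (m + T%:R) `^ 3^-1.
Proof.
have int n : (1 <= n <= T.+1)%N -> [/\ Int (F n), Int (a n), Int (e n) & Int (g n)].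
  by case: n => // n; exact: expected_integrable.
have intT n : (1 <= n <= T)%N -> [/\ Int (F n), Int (a n), Int (e n) & Int (g n)].
  by move=> /andP[n1 nT]; apply: int; rewrite n1 ltnW.
have intpq n : (1 <= n <= T)%N -> Int (p n) /\ Int (q n).
  by move=> nT; have [iF ia ie ig] := intT _ nT; exact: expected_pq.
split.
  by move=> n nT; have [iF ia ie ig] := intT _ nT; have [ip _] := intpq _ nT.
have F1I : \int[P]_o F 1%N o = F1.
  by rewrite -[RHS](Rintegral_prob_cst P); apply: eq_Rintegral => o _; rewrite F1E.
have a1I : \int[P]_o a 1%N o = a1.
  by rewrite -[RHS](Rintegral_prob_cst P); apply: eq_Rintegral => o _; rewrite a1E.
rewrite -F1I -a1I.
apply: (@lyapunov_sum R (fun n => \int[P]_o F n o) (fun n => \int[P]_o a n o)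
  (fun n => \int[P]_o e n o) (fun n => \int[P]_o g n o) (fun n => \int[P]_o p n o)
  (fun n => \int[P]_o q n o) T b k m c1 c2 lam gam tau L delta) => //.
- by move=> n nT; apply: Rintegral_ge0 => o _; exact: Fpos.
- by move=> n; split; apply: Rintegral_ge0 => o _; case: (pos n o).
- by move=> n; exact: Rintegral_ge0.
- by move=> n; exact: Rintegral_ge0.
- have [_ _ ie _] := int 1%N isT; rewrite -lee_fin -Rintegral_EFin//.
- have [_ _ _ ig] := int 1%N isT; rewrite -lee_fin -Rintegral_EFin//.
move=> n nT eta.
have nT1 : (1 <= n.+1 <= T.+1)%N by case/andP: nT.
have [iF ia ie ig] := intT _ nT; have [ip iq] := intpq _ nT.
have [iF' ia' ie' ig'] := int _ nT1.
split.
- apply: (@le_trans _ _ (1 * \int[P]_o F n o + (eta * (2 * gam * L ^+ 2)) * \int[P]_o a n o +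
    (eta * (2 * gam)) * \int[P]_o e n o + - (eta / (2 * gam)) * \int[P]_o p n o)).
    apply: Rintegral_le_lincomb4 => // o; apply: (le_trans (Fstep o nT)).
    by rewrite le_eqVlt; apply/predU1P; left; rewrite /eta; ring.
  by rewrite le_eqVlt; apply/predU1P; left; rewrite /eta; ring.
- apply: (@le_trans _ _ ((1 - eta * tau * lam / 4) * \int[P]_o a n o +
    - (3 * eta / 4) * \int[P]_o q n o + (25 * eta * lam / (6 * tau)) * \int[P]_o g n o +
    (25 * (L / tau) ^+ 2 * eta / (6 * tau * lam)) * \int[P]_o p n o)).
    apply: Rintegral_le_lincomb4 => // o; apply: (le_trans (astep o nT)).
    by rewrite le_eqVlt; apply/predU1P; left; rewrite /eta; ring.
  by rewrite le_eqVlt; apply/predU1P; left; ring.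
- have := estep nT; rewrite (Rintegral_EFin ie) (Rintegral_EFin ie').
  by rewrite (integral_bnd c1 nT ip iq) -!EFinM -EFinD lee_fin.
- have := gstep nT; rewrite (Rintegral_EFin ig) (Rintegral_EFin ig').
  by rewrite (integral_bnd c2 nT ip iq) -!EFinM -EFinD lee_fin.
Qed.
End expected_lyapunov.

(** * From the sum of squares to the rate *)

Lemma cube_root_sum_le {R : realType} (m t : R) : 0 < m -> 0 < t ->
  (m + t) `^ 3^-1 / t <= (m `^ 6^-1 / t `^ 2^-1 + 1 / t `^ 3^-1) ^+ 2.
Proof.
move=> m0 t0; set u := m `^ 6^-1; pose r := t `^ 6^-1.
have u0 : 0 < u by rewrite powR_gt0.
have r0 : 0 < r by rewrite powR_gt0.
have u6 : u ^+ 6 = m by rewrite -powR_mulrn ?ltW// -powRrM mulVf// powRr1// ltW.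
have r6 : r ^+ 6 = t by rewrite -powR_mulrn ?ltW// -powRrM mulVf// powRr1// ltW.
have r3 : t `^ 2^-1 = r ^+ 3.
  by rewrite -powR_mulrn ?ltW// -powRrM; congr (_ `^ _); field.
have r2 : t `^ 3^-1 = r ^+ 2.
  by rewrite -powR_mulrn ?ltW// -powRrM; congr (_ `^ _); field.
rewrite r3 r2; have -> : (m + t) `^ 3^-1 / t = (m + t) `^ 3^-1 / r ^+ 6 by rewrite r6.
have -> : (u / r ^+ 3 + 1 / r ^+ 2) ^+ 2 = (u + r) ^+ 2 / r ^+ 6.
  by field; rewrite gt_eqF.
rewrite ler_pM2r ?invr_gt0 ?exprn_gt0//.
have ur0 : 0 <= (u + r) ^+ 2 by exact: sqr_ge0.
(* Cubing reduces the claim to u^6 + r^6 <= (u + r)^6, with u and r the sixth roots of m and t. *)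
rewrite -(ler_pXn2r (n := 3))// ?nnegrE ?powR_ge0//.
rewrite cube_root_pow ?addr_ge0 ?(ltW m0) ?(ltW t0)// -u6 -r6 -exprM.
have -> : (u + r) ^+ 6 = u ^+ 6 + r ^+ 6 + (6 * u ^+ 5 * r + 15 * u ^+ 4 * r ^+ 2 +
  20 * u ^+ 3 * r ^+ 3 + 15 * u ^+ 2 * r ^+ 4 + 6 * u * r ^+ 5) by ring.
by rewrite lerDl !addr_ge0// !mulr_ge0 ?exprn_ge0 ?(ltW u0) ?(ltW r0).
Qed.

(** Jensen and Cauchy-Schwarz in one stroke: H <= c / 2 + H^2 / (2 c) for every c > 0. At c = sqrt
    (3 B / T) both halves average to at most c / 2. *)
Lemma average_le_sqrt {d} {Om : measurableType d} {R : realType}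
    (P : probability Om R) (H p a e : nat -> Om -> R) (T : nat) (al be B : R) :
  (1 <= T)%N -> 0 < B ->
  (forall n o, (1 <= n <= T)%N -> 0 <= H n o) ->
  (forall n, (1 <= n <= T)%N -> measurable_fun setT (H n)) ->
  (forall n o, (1 <= n <= T)%N -> H n o ^+ 2 <= 3 * (al * p n o + be * a n o + e n o)) ->
  (forall n, (1 <= n <= T)%N -> [/\ P.-integrable setT (EFin \o p n),
    P.-integrable setT (EFin \o a n) & P.-integrable setT (EFin \o e n)]) ->
  \sum_(1 <= n < T.+1) (al * \int[P]_o p n o + be * \int[P]_o a n o + \int[P]_o e n o) <= B ->
  (T%:R^-1%:E * \sum_(1 <= n < T.+1) \int[P]_o (H n o)%:E <= (Num.sqrt (3 * B / T%:R))%:E)%E.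
Proof.
move=> T1 B0 H0 mH HH int hB; set c := Num.sqrt _.
have T0 : 0 < T%:R :> R by rewrite ltr0n.
have c0 : 0 < c by rewrite sqrtr_gt0 divr_gt0// mulr_gt0.
have c2 : c ^+ 2 = 3 * B / T%:R by rewrite sqr_sqrtr// divr_ge0 ?mulr_ge0// ltW.
pose K := 3 / (2 * c); have K0 : 0 <= K by rewrite divr_ge0 ?mulr_ge0// ltW.
have le1 n : (1 <= n <= T)%N -> (\int[P]_o (H n o)%:E <= (c / 2 + K *
    (al * \int[P]_o p n o + be * \int[P]_o a n o + \int[P]_o e n o))%:E)%E.
  move=> nT; have [ip ia ie] := int n nT.
  have i1 : P.-integrable setT (EFin \o (fun _ : Om => 1 : R)).
    exact/finite_measure_integrable_cst.
  have [i E] := integrable_lincomb4 (c / 2) (K * al) (K * be) K i1 ip ia ie.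
  have Hle o : H n o <= c / 2 * 1 + K * al * p n o + K * be * a n o + K * e n o.
    have h1 : H n o <= c / 2 + (2 * c)^-1 * H n o ^+ 2.
      have -> : c / 2 + (2 * c)^-1 * H n o ^+ 2 = H n o + (2 * c)^-1 * (H n o - c) ^+ 2.
        by field; rewrite gt_eqF.
      by rewrite lerDl mulr_ge0 ?sqr_ge0// invr_ge0 mulr_ge0// ltW.
    apply: (le_trans h1); rewrite mulr1 -!addrA lerD2l.
    have c20 : 0 <= (2 * c)^-1 by rewrite invr_ge0 mulr_ge0// ltW.
    apply: (le_trans (ler_wpM2l c20 (HH n o nT))).
    by rewrite le_eqVlt; apply/predU1P; left; rewrite /K; field; rewrite gt_eqF.
  have iH : P.-integrable setT (EFin \o H n).
    by apply: (integrable_dominated (mH n nT) _ i) => o; rewrite H0//=.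
  rewrite (Rintegral_EFin iH) lee_fin.
  apply: (le_trans (Rintegral_le_lincomb4 iH i1 ip ia ie Hle)).
  by rewrite Rintegral_prob_cst le_eqVlt; apply/predU1P; left; ring.
apply: (@le_trans _ _ (T%:R^-1%:E * \sum_(1 <= n < T.+1) (c / 2 + K *
    (al * \int[P]_o p n o + be * \int[P]_o a n o + \int[P]_o e n o))%:E)%E).
  apply: lee_wpmul2l; first by rewrite lee_fin invr_ge0 ltW.
  by rewrite !big_nat; apply: lee_sum => n nT; exact: le1.
rewrite sumEFin -EFinM lee_fin big_split/= sumr_const_nat subn1/= -mulr_sumr.
rewrite mulrC ler_pdivrMr//.
have h := ler_wpM2l K0 hB.
have KB : K * B = c / 2 * T%:R.
  have BE : B = c ^+ 2 * T%:R / 3 by rewrite c2; field; rewrite gt_eqF.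
  by rewrite BE /K; field; rewrite gt_eqF.
apply: (le_trans (lerD (lexx _) h)); rewrite KB -[c / 2 *+ T]mulr_natr -mulrDl ler_pM2r//.
by rewrite -splitr.
Qed.

Lemma rate_le {R : realType} (M m : R) (T : nat) : (1 <= T)%N -> 0 < M -> 0 < m ->
  Num.sqrt (3 * (4 * M * (m + T%:R) `^ 3^-1) / T%:R) <=
  2 * Num.sqrt (3 * M) * m `^ 6^-1 / T%:R `^ 2^-1 + 2 * Num.sqrt (3 * M) / T%:R `^ 3^-1.
Proof.
move=> T1 M0 m0; have T0 : 0 < T%:R :> R by rewrite ltr0n.
set s := Num.sqrt (3 * M); set bd := leRHS.
have s0 : 0 <= s by exact: sqrtr_ge0.
have s2 : s ^+ 2 = 3 * M by rewrite sqr_sqrtr// mulr_ge0// ltW.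
have bdE : bd = 2 * s * (m `^ 6^-1 / T%:R `^ 2^-1 + 1 / T%:R `^ 3^-1).
  by rewrite /bd; ring.
have bd0 : 0 <= bd by rewrite addr_ge0// !mulr_ge0 ?invr_ge0 ?powR_ge0.
rewrite -[leRHS]ger0_norm// -sqrtr_sqr ler_wsqrtr// bdE exprMn exprMn s2.
have M12 : 0 <= 12 * M by rewrite mulr_ge0// ltW.
have h := ler_wpM2l M12 (cube_root_sum_le m0 T0).
by move: h; congr (_ <= _); ring.
Qed.

(** * Measurability of the operations of the algorithm *)

Lemma measurable_eproj {d} {S : measurableType d} {R : realType} {n : nat}
    (C : set 'rV[R]_n) (Z : S -> 'rV[R]_n) c : projectable C -> C !=set0 ->
  (forall c, measurable_fun setT (fun s => Z s 0 c)) ->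
  measurable_fun setT (fun s => eproj C (Z s) 0 c).
Proof.
move=> C_proj C0 mZ.
(* The second argument is a dummy vector of dimension 0. *)
apply: (@measurable_caratheodory2 _ _ _ n 0 setT setT (fun _ u _ => eproj C u 0 c)
  Z (fun _ => 0)) => //; try by right.
move=> s; exists 1 => u u' _ _ /=; rewrite -row_subE mul1r.
apply: (le_trans (coord_le_enorm _ c)); apply: (le_trans (eproj_nonexpansive C_proj C0 _ _)).
by rewrite -addrA lerDl addr_ge0 ?enorm_ge0 ?sqr_ge0.
Qed.

Lemma measurable_eproj_step {d} {S : measurableType d} {R : realType} {n : nat}
    (C : set 'rV[R]_n) (Z V : S -> 'rV[R]_n) (r e : R) c : projectable C -> C !=set0 ->
  (forall c, measurable_fun setT (fun s => Z s 0 c)) ->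
  (forall c, measurable_fun setT (fun s => V s 0 c)) ->
  measurable_fun setT (fun s => (Z s + e *: (eproj C (Z s + r *: V s) - Z s)) 0 c).
Proof.
move=> C_proj C0 mZ mV.
have E s : (Z s + e *: (eproj C (Z s + r *: V s) - Z s)) 0 c =
    Z s 0 c + e * (eproj C (Z s + r *: V s) 0 c - Z s 0 c) by rewrite !mxE.
under eq_fun do rewrite E.
apply: measurable_funD => //; apply: measurable_funM => //; apply: measurable_funB => //.
apply: measurable_eproj => // c'.
have E' s : (Z s + r *: V s) 0 c' = Z s 0 c' + r * V s 0 c' by rewrite !mxE.
under eq_fun do rewrite E'.
by apply: measurable_funD => //; apply: measurable_funM.
Qed.

Lemma measurable_enorm {d} {S : measurableType d} {R : realType} {n : nat}
    (Z : S -> 'rV[R]_n) : (forall c, measurable_fun setT (fun s => Z s 0 c)) ->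
  measurable_fun setT (fun s => enorm (Z s)).
Proof.
move=> mZ.
apply: (@measurable_caratheodory2 _ _ _ n 0 setT setT (fun _ u _ => enorm u)
  Z (fun _ => 0)) => //; try by right.
move=> s; exists 1 => u u' _ _ /=; rewrite mul1r; apply: (le_trans (enorm_dist _ _)).
by rewrite -addrA lerDl addr_ge0 ?enorm_ge0 ?sqr_ge0.
Qed.

(** Converts the two quadratic bounds on the value function, with [gg] the norm of its gradient,
    into the modulus of [measurable_caratheodory2]. *)
Lemma value_lip_arith {R : realFieldType} (L L2 gg u t0 dd a b : R) :
  0 <= L -> 0 <= L2 -> 0 <= gg -> 0 <= u -> 0 <= t0 ->
  a <= b + dd + (L + L2) / 2 * u ^+ 2 -> b + dd - L / 2 * u ^+ 2 <= a ->
  `|dd| <= gg * u ->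
  `|a - b| <= (gg + L + L2) * (u + t0 + (u + t0) ^+ 2).
Proof.
move=> L0 L20 g0 u0 t00 ub lb; rewrite !ler_norml => /andP[d1' d2'].
have h1 : gg * u <= (gg + L + L2) * (u + t0).
  by apply: ler_pM; rewrite ?addr_ge0//; [rewrite -addrA lerDl addr_ge0|rewrite lerDl].
have h2 : (L + L2) * u ^+ 2 <= (gg + L + L2) * (u + t0) ^+ 2.
  apply: ler_pM; rewrite ?sqr_ge0 ?addr_ge0//; first by rewrite -addrA lerDr.
  by rewrite ler_pXn2r ?nnegrE ?addr_ge0// lerDl.
have h3 : 0 <= L * u ^+ 2 by rewrite mulr_ge0 ?sqr_ge0.
have h4 : 0 <= L2 * u ^+ 2 by rewrite mulr_ge0 ?sqr_ge0.
by apply/andP; split; rewrite mulrDr; lra.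
Qed.

Section measurable_value_function.
Context {R : realType} {d1 d2 : nat}.
Variables (h : 'rV[R]_d1 -> 'rV[R]_d2 -> R) (X : set 'rV[R]_d1) (Y : set 'rV[R]_d2).
Variables (L tau : R).
Hypotheses (X_proj : projectable X) (Y_proj : projectable Y).
Hypotheses (Y_neq0 : Y !=set0).
Hypotheses (L_gt0 : 0 < L) (tau_gt0 : 0 < tau).
Hypothesis h_diff : forall x y, X x -> Y y ->
  differentiable (fun p => h p.1 p.2) (x, y).
Hypothesis h_lip : forall x x' y y', X x -> X x' -> Y y -> Y y' ->
  enorm (gradxy h x y - gradxy h x' y')
    <= L * enorm (row_mx x y - row_mx x' y').
Hypothesis h_sc : forall x y y', X x -> Y y -> Y y' ->
  h x y <= h x y' + dotp (grady h x y') (y - y') - tau / 2 * enorm (y - y') ^+ 2.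
Context {d} {S : measurableType d}.
Variable (Z : S -> 'rV[R]_d1).
Hypotheses (XZ : forall s, X (Z s))
  (mZ : forall c, measurable_fun setT (fun s => Z s 0 c)).

Lemma measurable_ystar c : measurable_fun setT (fun s => ystar Y h (Z s) 0 c).
Proof.
apply: (@measurable_caratheodory2 _ _ _ d1 0 X setT (fun _ x _ => ystar Y h x 0 c)
  Z (fun _ => 0)) => //; try by right.
move=> s; exists (L / tau) => x y Xx _ /=; rewrite -row_subE.
apply: (le_trans (coord_le_enorm _ c)).
apply: (le_trans (ystar_lip X_proj Y_proj Y_neq0 L_gt0 tau_gt0 h_diff h_lip h_sc Xx (XZ s))).
rewrite ler_wpM2l ?divr_ge0 ?(ltW L_gt0) ?(ltW tau_gt0)//.
by rewrite -addrA lerDl addr_ge0 ?enorm_ge0 ?sqr_ge0.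
Qed.

Lemma measurable_Fmax : measurable_fun setT (fun s => Fmax Y h (Z s)).
Proof.
apply: (@measurable_caratheodory2 _ _ _ d1 0 X setT (fun _ x _ => Fmax Y h x)
  Z (fun _ => 0)) => //; try by right.
move=> s; set g := gradx h (Z s) (ystar Y h (Z s)).
exists (enorm g + L + L ^+ 2 / tau) => x y Xx _ /=.
have ub := Fmax_ub X_proj Y_proj Y_neq0 L_gt0 tau_gt0 h_diff h_lip h_sc (XZ s) Xx.
have lb := Fmax_lb X_proj Y_proj Y_neq0 L_gt0 tau_gt0 h_diff h_lip h_sc (XZ s) Xx.
have dp := normr_dotp_le g (x - Z s).
have L2 : 0 <= L ^+ 2 / tau by rewrite divr_ge0 ?sqr_ge0// ltW.
move: ub lb dp; rewrite -/g.
move=> ub lb dp.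
by apply: value_lip_arith ub lb dp; rewrite ?enorm_ge0 ?sqrtr_ge0 ?(ltW L_gt0).
Qed.
End measurable_value_function.

(** * The trajectory of the algorithm *)

Section run.
Context {R : realType} {d1 d2 : nat} {dXi : measure_display}
  {Xi : measurableType dXi} {D : probability Xi R}
  {f : Xi -> 'rV[R]_d1 -> 'rV[R]_d2 -> R}
  {X : set 'rV[R]_d1} {Y : set 'rV[R]_d2} {U : set ('rV[R]_d1 * 'rV[R]_d2)}
  {delta Lf tau : R}
  {dO : measure_display} {Omega : measurableType dO} {P : probability Omega R}
  {b T : nat} {gam lam k m c1 c2 : R}
  {x1 : 'rV[R]_d1} {y1 : 'rV[R]_d2}
  {xi : nat -> 'I_b -> {RV P >-> Xi}}
  {x xt v : nat -> Omega -> 'rV[R]_d1} {y yt w : nat -> Omega -> 'rV[R]_d2}.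
Hypotheses (X_compact : compact X) (X_convex : convex_set X)
  (Y_set : (compact Y /\ convex_set Y) \/ Y = setT)
  (U_open : open U) (U_dom : X `*` Y `<=` U)
  (f_int : forall u, U u -> D.-integrable setT (fun z => (f z u.1 u.2)%:E))
  (f_diff : forall z u, U u -> differentiable (fun p => f z p.1 p.2) u)
  (fmean_diff : forall u, U u -> differentiable (fun p => fmean D f p.1 p.2) u)
  (delta_gt0 : 0 < delta)
  (C1x : forall u, U u ->
    ('E_D[fun z => (enorm (gradx (f z) u.1 u.2
                      - gradx (fmean D f) u.1 u.2) ^+ 2)%R]
      <= (delta ^+ 2)%:E)%E)
  (C1y : forall u, U u ->
    ('E_D[fun z => (enorm (grady (f z) u.1 u.2
                      - grady (fmean D f) u.1 u.2) ^+ 2)%R]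
      <= (delta ^+ 2)%:E)%E)
  (C2 : forall z x x' y y', X x -> X x' -> Y y -> Y y' ->
    enorm (gradxy (f z) x y - gradxy (f z) x' y')
      <= Lf * enorm (row_mx x y - row_mx x' y'))
  (tau_gt0 : 0 < tau)
  (C3 : forall x y y', X x -> Y y -> Y y' ->
    fmean D f x y <= fmean D f x y'
      + dotp (grady (fmean D f) x y') (y - y')
      - tau / 2 * enorm (y - y') ^+ 2)
  (C4 : has_lbound (Fmax Y (fmean D f) @` X))
  (b_ge1 : (1 <= b)%N) (T_ge1 : (1 <= T)%N)
  (x1_X : X x1) (y1_Y : Y y1)
  (xi_iid : iid_batches D T xi)
  (run : forall o : Omega, acc_mda f X Y gam lam k m c1 c2 T x1 y1
    (fun t i => xi t i o)
    (x ^~ o) (xt ^~ o) (v ^~ o) (y ^~ o) (yt ^~ o) (w ^~ o))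
  (k_gt0 : 0 < k)
  (c1_ge : 2 / (3 * k ^+ 3) + 9 * tau ^+ 2 / 4 <= c1)
  (c2_ge : 2 / (3 * k ^+ 3) + 75 * Lf ^+ 2 / 2 <= c2)
  (m_ge : Num.max 2 (Num.max (k ^+ 3)
            (Num.max ((c1 * k) ^+ 3) ((c2 * k) ^+ 3))) <= m)
  (lam_gt0 : 0 < lam)
  (lam_le : lam <= Num.min (1 / (6 * Lf)) (27 * b%:R * tau / 16))
  (gam_gt0 : 0 < gam)
  (gam_le : let kappa := Lf / tau in let Lg := Lf + Lf ^+ 2 / tau in
    gam <= Num.min
      (lam * tau / (2 * Lf)
         * Num.sqrt (2 * b%:R / (8 * lam ^+ 2 + 75 * kappa ^+ 2 * b%:R)))
      (m `^ 3^-1 / (2 * Lg * k))).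

Let fm := fmean D f.
Let F := Fmax Y fm.
Let Fstar := inf (F @` X).

(** [1 / (6 * Lf)] exceeds a positive [lam], which rules out a negative [Lf], and also [Lf = 0], as
    the inverse of 0 is 0. *)
Lemma run_Lf_gt0 : 0 < Lf.
Proof.
move: (lt_le_trans lam_gt0 lam_le); rewrite lt_min => /andP[+ _].
by rewrite div1r invr_gt0 pmulr_rgt0.
Qed.
Let Lf_gt0 := run_Lf_gt0.

Lemma run_lam_le : 6 * Lf * lam <= 1 /\ lam <= 27 * b%:R * tau / 16.
Proof.
move: lam_le; rewrite le_min => /andP[+ ->]; split=> //.
by rewrite mulrC -ler_pdivlMr// mulr_gt0.
Qed.

Lemma run_m_ge : [/\ 2 <= m, k ^+ 3 <= m, (c1 * k) ^+ 3 <= m & (c2 * k) ^+ 3 <= m].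
Proof. by move: m_ge; rewrite !ge_max => /and4P[]. Qed.

Lemma run_c_ge0 : 0 <= c1 /\ 0 <= c2.
Proof.
by split; [apply: le_trans c1_ge|apply: le_trans c2_ge];
  rewrite addr_ge0// divr_ge0 ?mulr_ge0 ?sqr_ge0 ?exprn_ge0// ltW.
Qed.

Let et n := Defs.eta k m n.

Lemma run_eta n : 0 < et n <= 1.
Proof.
have [m2 mk _ _] := run_m_ge.
by rewrite eta_gt0// eta_le1.
Qed.

Lemma run_momentum n : 0 <= c1 * et n ^+ 2 <= 1 /\ 0 <= c2 * et n ^+ 2 <= 1.
Proof.
have [m2 mk mc1 mc2] := run_m_ge; have [c10 c20] := run_c_ge0.
have /andP[/ltW e0 e1] := run_eta n.
have aux c : 0 <= c -> (c * k) ^+ 3 <= m -> 0 <= c * et n ^+ 2 <= 1.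
  move=> c0 ck; rewrite mulr_ge0 ?sqr_ge0//= expr2 mulrA.
  have ce := eta_mul_le1 k_gt0 m2 n c0 ck.
  by rewrite -[leRHS]mulr1; apply: ler_pM => //; rewrite mulr_ge0.
by split; apply: aux.
Qed.

Lemma run_gam_eta n : 2 * (Lf + Lf ^+ 2 / tau) * et n * gam <= 1.
Proof.
have [m2 _ _ _] := run_m_ge; have m0 : 0 < m := lt_le_trans (ltr0n _ 2) m2.
have Lg0 : 0 < Lf + Lf ^+ 2 / tau by rewrite addr_gt0// divr_gt0// exprn_gt0.
move: gam_le => /=; rewrite le_min => /andP[_].
rewrite ler_pdivlMr ?mulr_gt0// => h.
have := cube_root_ge m2 n; move/(le_trans h) => h2.
rewrite /et /Defs.eta; set A := (m + n%:R) `^ 3^-1 in h2 *.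
have A0 : 0 < A by rewrite powR_gt0// ltr_wpDr.
have -> : 2 * (Lf + Lf ^+ 2 / tau) * (k / A) * gam = (gam * (2 * (Lf + Lf ^+ 2 / tau) * k)) / A.
  by ring.
by rewrite ler_pdivrMr// mul1r.
Qed.

Lemma run_gam_sqrt : gam <= lam * tau / (2 * Lf)
  * Num.sqrt (2 * b%:R / (8 * lam ^+ 2 + 75 * (Lf / tau) ^+ 2 * b%:R)).
Proof. by move: gam_le => /=; rewrite le_min => /andP[]. Qed.

Let X_proj : projectable X. Proof. by left. Qed.
Let Y_proj : projectable Y. Proof. exact: Y_set. Qed.
Let X_neq0 : X !=set0. Proof. by exists x1. Qed.
Let Y_neq0 : Y !=set0. Proof. by exists y1. Qed.
Let UXY a c : X a -> Y c -> U (a, c). Proof. by move=> ? ?; exact: U_dom. Qed.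

Lemma run_fm_diff a c : X a -> Y c -> differentiable (fun p => fm p.1 p.2) (a, c).
Proof. by move=> Xa Yc; exact: fmean_diff (UXY Xa Yc). Qed.
Let fm_diff := run_fm_diff.

Lemma run_fm_lip a a' c c' : X a -> X a' -> Y c -> Y c' ->
  enorm (gradxy fm a c - gradxy fm a' c') <= Lf * enorm (row_mx a c - row_mx a' c').
Proof.
move=> Xa Xa' Yc Yc'.
apply: (fmean_grad_lip U_open f_int f_diff fmean_diff C1x C1y (UXY Xa Yc) (UXY Xa' Yc')).
by move=> z; exact: C2.
Qed.
Let fm_lip := run_fm_lip.

Let Gx z := gradx (f z).
Let Gy z := grady (f z).

Lemma run_Gx_lip z a a' c c' : X a -> X a' -> Y c -> Y c' ->
  enorm (Gx z a c - Gx z a' c') ^+ 2 <= Lf ^+ 2 * (enorm (a - a') ^+ 2 + enorm (c - c') ^+ 2).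
Proof.
move=> Xa Xa' Yc Yc'; apply: le_trans (sqr_grad_lip Lf_gt0 (C2 z) Xa Xa' Yc Yc').
by rewrite lerDl sqr_ge0.
Qed.

Lemma run_Gy_lip z a a' c c' : X a -> X a' -> Y c -> Y c' ->
  enorm (Gy z a c - Gy z a' c') ^+ 2 <= Lf ^+ 2 * (enorm (a - a') ^+ 2 + enorm (c - c') ^+ 2).
Proof.
move=> Xa Xa' Yc Yc'; apply: le_trans (sqr_grad_lip Lf_gt0 (C2 z) Xa Xa' Yc Yc').
by rewrite lerDr sqr_ge0.
Qed.

Lemma run_gx_lip a a' c c' : X a -> X a' -> Y c -> Y c' ->
  enorm (gradx fm a c - gradx fm a' c') ^+ 2
  <= Lf ^+ 2 * (enorm (a - a') ^+ 2 + enorm (c - c') ^+ 2).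
Proof.
move=> Xa Xa' Yc Yc'; apply: le_trans (sqr_grad_lip Lf_gt0 fm_lip Xa Xa' Yc Yc').
by rewrite lerDl sqr_ge0.
Qed.

Lemma run_gy_lip a a' c c' : X a -> X a' -> Y c -> Y c' ->
  enorm (grady fm a c - grady fm a' c') ^+ 2
  <= Lf ^+ 2 * (enorm (a - a') ^+ 2 + enorm (c - c') ^+ 2).
Proof.
move=> Xa Xa' Yc Yc'; apply: le_trans (sqr_grad_lip Lf_gt0 fm_lip Xa Xa' Yc Yc').
by rewrite lerDr sqr_ge0.
Qed.

Lemma run_Gx_mean a c i : X a -> Y c ->
  D.-integrable setT (fun z => (Gx z a c 0 i)%:E) /\ \int[D]_z Gx z a c 0 i = gradx fm a c 0 i.
Proof.
move=> Xa Yc.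
exact: (gradx_mean U_open f_int f_diff fmean_diff C1x C1y i (UXY Xa Yc)).
Qed.

Lemma run_Gy_mean a c i : X a -> Y c ->
  D.-integrable setT (fun z => (Gy z a c 0 i)%:E) /\ \int[D]_z Gy z a c 0 i = grady fm a c 0 i.
Proof.
move=> Xa Yc.
exact: (grady_mean U_open f_int f_diff fmean_diff C1x C1y i (UXY Xa Yc)).
Qed.

Lemma run_Gx_var a c : X a -> Y c ->
  (\int[D]_z (enorm (Gx z a c - gradx fm a c) ^+ 2)%:E <= (delta ^+ 2)%:E)%E.
Proof. by move=> Xa Yc; have := C1x (UXY Xa Yc); rewrite unlock. Qed.

Lemma run_Gy_var a c : X a -> Y c ->
  (\int[D]_z (enorm (Gy z a c - grady fm a c) ^+ 2)%:E <= (delta ^+ 2)%:E)%E.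
Proof. by move=> Xa Yc; have := C1y (UXY Xa Yc); rewrite unlock. Qed.

Lemma run_in n o : (1 <= n <= T.+1)%N -> X (x n o) /\ Y (y n o).
Proof.
elim: n => // -[_ _|n IH nT].
  by rewrite (mda_x1 (run o)) (mda_y1 (run o)).
have nT' : (1 <= n.+1 <= T)%N by [].
have [Xn Yn] := IH (leqW nT).
have /andP[/ltW e0 e1] := run_eta n.+1.
rewrite (mda_x (run o) nT') (mda_y (run o) nT').
split; apply: projectable_segment => //; rewrite ?e0 ?e1//.
  by rewrite (mda_xt (run o) nT'); exact: eproj_in.
by rewrite (mda_yt (run o) nT'); exact: eproj_in.
Qed.

Let xiI (j : nat * 'I_b) : {RV P >-> Xi} := xi j.1 j.2.
Let J := [set j : nat * 'I_b | (1 <= j.1 <= T.+1)%N].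
(** Indices of the samples in batches 1 to n: [history xiI (hs n)] is what is known before batch n +
    1 is drawn. *)
Let hs n : seq (nat * 'I_b) := [seq (s, i) | s <- iota 1 n, i <- enum 'I_b].

Lemma mem_hs n j : (j \in hs n) = (1 <= j.1 <= n)%N.
Proof.
case: j => s i; apply/allpairsP/idP => [[[s' i'] /= [+ _ [-> _]]]|/= h].
  by rewrite mem_iota add1n ltnS.
by exists (s, i); rewrite mem_iota add1n ltnS h mem_enum.
Qed.

Lemma uniq_hs n : uniq (hs n).
Proof. by apply: allpairs_uniq; rewrite ?iota_uniq ?enum_uniq// => -[? ?] [? ?]. Qed.

Lemma hs_sub n n' : (n <= n')%N -> {subset hs n <= hs n'}.
Proof. by move=> nn' j; rewrite !mem_hs => /andP[-> /leq_trans->]. Qed.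

Lemma xi_hs n i : measurable_fun setT (xi n.+1 i : history xiI (hs n.+1) -> Xi).
Proof. by apply: (@history_coord _ _ _ _ _ _ _ xiI _ (n.+1, i)); rewrite mem_hs/=. Qed.

(** The offset matters: the iterates of index n + 1 are computed before batch n + 1 is drawn,
    whereas the estimates of that index use it. This is what leaves the next batch independent of
    everything it multiplies. *)
Lemma run_measurable n : (n <= T)%N ->
  [/\ forall c, measurable_fun setT ((fun o => x n.+1 o 0 c) : history xiI (hs n) -> R),
      forall c, measurable_fun setT ((fun o => y n.+1 o 0 c) : history xiI (hs n) -> R),
      forall c, measurable_fun setT ((fun o => v n.+1 o 0 c) : history xiI (hs n.+1) -> R) &
      forall c, measurable_fun setT ((fun o => w n.+1 o 0 c) : history xiI (hs n.+1) -> R)].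
Proof.
elim: n => [|n IH] nT.
  split => c.
  - rewrite (_ : (fun o => x 1%N o 0 c) = fun _ => x1 0 c)//.
    by apply/funext => o; rewrite (mda_x1 (run o)).
  - rewrite (_ : (fun o => y 1%N o 0 c) = fun _ => y1 0 c)//.
    by apply/funext => o; rewrite (mda_y1 (run o)).
  - rewrite (_ : (fun o => v 1%N o 0 c) = fun o =>
      (b%:R^-1 *: \sum_i Gx (xi 1%N i o) x1 y1) 0 c); last first.
      by apply/funext => o; rewrite (mda_v1 (run o)).
    apply: (measurable_oracle_batch X_proj Y_proj Lf_gt0 run_Gx_lip run_Gx_mean
      (S := history xiI (hs 1)) (zeta := xi 1%N) (Z := fun _ => x1) (W := fun _ => y1)) => //.
    exact: xi_hs.
  - rewrite (_ : (fun o => w 1%N o 0 c) = fun o =>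
      (b%:R^-1 *: \sum_i Gy (xi 1%N i o) x1 y1) 0 c); last first.
      by apply/funext => o; rewrite (mda_w1 (run o)).
    apply: (measurable_oracle_batch X_proj Y_proj Lf_gt0 run_Gy_lip run_Gy_mean
      (S := history xiI (hs 1)) (zeta := xi 1%N) (Z := fun _ => x1) (W := fun _ => y1)) => //.
    exact: xi_hs.
have [mx my mv mw] := IH (ltnW nT).
have nT' : (1 <= n.+1 <= T)%N by [].
have l1 : (n <= n.+2)%N by rewrite leqW.
have l2 : (n.+1 <= n.+2)%N by [].
have XY0 o : X (x n.+1 o) /\ Y (y n.+1 o) by apply: run_in; exact: leqW.
have XY1 o : X (x n.+2 o) /\ Y (y n.+2 o) by exact: run_in.
have up i j (g : Omega -> R) : (i <= j)%N -> measurable_fun setT (g : history xiI (hs i) -> R) ->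
    measurable_fun setT (g : history xiI (hs j) -> R).
  by move=> ij; apply: history_measurable_fun_sub; exact: hs_sub.
have mx' c : measurable_fun setT ((fun o => x n.+2 o 0 c) : history xiI (hs n.+1) -> R).
  rewrite (_ : (fun o => x n.+2 o 0 c) = fun o => (x n.+1 o + et n.+1 *:
    (eproj X (x n.+1 o + (- gam) *: v n.+1 o) - x n.+1 o)) 0 c); last first.
    by apply/funext => o; rewrite (mda_x (run o) nT') (mda_xt (run o) nT') scaleNr.
  apply: (@measurable_eproj_step _ (history xiI (hs n.+1))) => // c'.
  exact: up (mx c').
have my' c : measurable_fun setT ((fun o => y n.+2 o 0 c) : history xiI (hs n.+1) -> R).
  rewrite (_ : (fun o => y n.+2 o 0 c) = fun o => (y n.+1 o + et n.+1 *:
    (eproj Y (y n.+1 o + lam *: w n.+1 o) - y n.+1 o)) 0 c); last first.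
    by apply/funext => o; rewrite (mda_y (run o) nT') (mda_yt (run o) nT').
  apply: (@measurable_eproj_step _ (history xiI (hs n.+1))) => // c'.
  exact: up (my c').
split => // c.
- rewrite (_ : (fun o => v n.+2 o 0 c) = fun o =>
      (b%:R^-1 *: (\sum_i Gx (xi n.+2 i o) (x n.+2 o) (y n.+2 o)) +
       (1 - c1 * et n.+1 ^+ 2) *: (v n.+1 o -
       b%:R^-1 *: (\sum_i Gx (xi n.+2 i o) (x n.+1 o) (y n.+1 o)))) 0 c); last first.
    by apply/funext => o; rewrite (mda_v (run o) nT').
  apply: (measurable_oracle_update X_proj Y_proj Lf_gt0 run_Gx_lip run_Gx_mean
      (S := history xiI (hs n.+2)) (zeta := xi n.+2)).
  + exact: xi_hs.
  + by move=> o; case: (XY0 o).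
  + by move=> o; case: (XY0 o).
  + by move=> o; case: (XY1 o).
  + by move=> o; case: (XY1 o).
  + by move=> c'; apply: up (mx c').
  + by move=> c'; apply: up (my c').
  + by move=> c'; apply: up (mx' c').
  + by move=> c'; apply: up (my' c').
  + by move=> c'; apply: up (mv c').
- rewrite (_ : (fun o => w n.+2 o 0 c) = fun o =>
      (b%:R^-1 *: (\sum_i Gy (xi n.+2 i o) (x n.+2 o) (y n.+2 o)) +
       (1 - c2 * et n.+1 ^+ 2) *: (w n.+1 o -
       b%:R^-1 *: (\sum_i Gy (xi n.+2 i o) (x n.+1 o) (y n.+1 o)))) 0 c); last first.
    by apply/funext => o; rewrite (mda_w (run o) nT').
  apply: (measurable_oracle_update X_proj Y_proj Lf_gt0 run_Gy_lip run_Gy_mean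
      (S := history xiI (hs n.+2)) (zeta := xi n.+2)).
  + exact: xi_hs.
  + by move=> o; case: (XY0 o).
  + by move=> o; case: (XY0 o).
  + by move=> o; case: (XY1 o).
  + by move=> o; case: (XY1 o).
  + by move=> c'; apply: up (mx c').
  + by move=> c'; apply: up (my c').
  + by move=> c'; apply: up (mx' c').
  + by move=> c'; apply: up (my' c').
  + by move=> c'; apply: up (mw c').
Qed.
Let hFE := fun n o => F (x n o) - Fstar.
Let hA := fun n o => enorm (y n o - ystar Y fm (x n o)) ^+ 2.
Let hE := fun n o => enorm (gradx fm (x n o) (y n o) - v n o) ^+ 2.
Let hG := fun n o => enorm (grady fm (x n o) (y n o) - w n o) ^+ 2.
Let hP := fun n o => enorm (xt n.+1 o - x n o) ^+ 2.
Let hQ := fun n o => enorm (yt n.+1 o - y n o) ^+ 2.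

Lemma run_measurableP n : (1 <= n <= T.+1)%N ->
  (forall c, measurable_fun setT (fun o => x n o 0 c)) /\
  (forall c, measurable_fun setT (fun o => y n o 0 c)).
Proof.
case: n => // n nT; have [mx my _ _] := run_measurable nT.
by split=> c; [apply: history_measurable_funW (mx c)|apply: history_measurable_funW (my c)].
Qed.

Lemma run_measurable_estimates n : (1 <= n <= T.+1)%N ->
  (forall c, measurable_fun setT (fun o => v n o 0 c)) /\
  (forall c, measurable_fun setT (fun o => w n o 0 c)).
Proof.
case: n => // n nT; have [_ _ mv mw] := run_measurable nT.
by split=> c; [apply: history_measurable_funW (mv c)|apply: history_measurable_funW (mw c)].
Qed.

Lemma run_measurable_proj n : (1 <= n <= T)%N ->
  (forall c, measurable_fun setT (fun o => xt n.+1 o 0 c)) /\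
  (forall c, measurable_fun setT (fun o => yt n.+1 o 0 c)).
Proof.
move=> nT; have nT1 : (1 <= n <= T.+1)%N by case/andP: nT => -> /leqW.
have [mx my] := run_measurableP nT1; have [mv mw] := run_measurable_estimates nT1.
split=> c.
- rewrite (_ : (fun o => xt n.+1 o 0 c) = fun o => eproj X (x n o - gam *: v n o) 0 c).
    apply: measurable_eproj => // c'; under eq_fun do rewrite row_subE mxE.
    by apply: measurable_funB => //; apply: measurable_funM.
  by apply/funext => o; rewrite (mda_xt (run o) nT).
- rewrite (_ : (fun o => yt n.+1 o 0 c) = fun o => eproj Y (y n o + lam *: w n o) 0 c).
    apply: measurable_eproj => // c'; under eq_fun do rewrite !mxE.
    by apply: measurable_funD => //; apply: measurable_funM.
  by apply/funext => o; rewrite (mda_yt (run o) nT).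
Qed.

Let mrow n (u u' : Omega -> 'rV[R]_n) :
  (forall c, measurable_fun setT (fun o => u o 0 c)) ->
  (forall c, measurable_fun setT (fun o => u' o 0 c)) ->
  forall c, measurable_fun setT (fun o => (u o - u' o) 0 c).
Proof. by move=> mu mu' c; under eq_fun do rewrite row_subE; exact: measurable_funB. Qed.

Lemma run_step_enorm n o : (1 <= n <= T)%N ->
  enorm (x n.+1 o - x n o) ^+ 2 = et n ^+ 2 * hP n o /\
  enorm (y n.+1 o - y n o) ^+ 2 = et n ^+ 2 * hQ n o.
Proof.
move=> nT; have aux d (u u' : 'rV[R]_d) e : u + e *: u' - u = e *: u'.
  by apply/rowP => c; rewrite !mxE; ring.
by rewrite (mda_x (run o) nT) (mda_y (run o) nT) !aux !enormZ;
  split; rewrite exprMn real_normK ?num_real.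
Qed.

Let xi_indep : mutually_independent P J (fun j => xiI j : Omega -> Xi).
Proof. by case: xi_iid. Qed.
Let xi_distr j A : J j -> measurable A -> distribution P (xiI j) A = D A.
Proof. by case: xi_iid => + _; apply. Qed.

Lemma run_init : (\int[P]_o (hE 1%N o)%:E <= (delta ^+ 2 / b%:R)%:E)%E /\
  (\int[P]_o (hG 1%N o)%:E <= (delta ^+ 2 / b%:R)%:E)%E.
Proof.
have inj : injective (fun i : 'I_b => (1%N, i)) by move=> i i' [->].
have Jt (i : 'I_b) : J (1%N, i) by rewrite /J/=.
split.
- under eq_integral do
    rewrite /hE (mda_x1 (run _)) (mda_y1 (run _)) (mda_v1 (run _)).
  exact: (oracle_init run_Gx_mean run_Gx_var xi_indep xi_distr b_ge1 inj Jt x1_X y1_Y).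
- under eq_integral do
    rewrite /hG (mda_x1 (run _)) (mda_y1 (run _)) (mda_w1 (run _)).
  exact: (oracle_init run_Gy_mean run_Gy_var xi_indep xi_distr b_ge1 inj Jt x1_X y1_Y).
Qed.

Let bnd c n o : R := 2 * (c * et n ^+ 2) ^+ 2 * delta ^+ 2
  + 2 * (1 - c * et n ^+ 2) ^+ 2 * (Lf ^+ 2 * et n ^+ 2 * (hP n o + hQ n o)).

(** [oracle_step] for each partial gradient. The batch of index n + 1 lies outside the history of
    the point, and [run_step_enorm] turns the displacements into eta^2 (p + q). *)
Lemma run_error n : (1 <= n <= T)%N ->
  (\int[P]_o (hE n.+1 o)%:E <= ((1 - c1 * et n ^+ 2) ^+ 2)%:E * \int[P]_o (hE n o)%:E
     + b%:R^-1%:E * \int[P]_o (bnd c1 n o)%:E)%E /\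
  (\int[P]_o (hG n.+1 o)%:E <= ((1 - c2 * et n ^+ 2) ^+ 2)%:E * \int[P]_o (hG n o)%:E
     + b%:R^-1%:E * \int[P]_o (bnd c2 n o)%:E)%E.
Proof.
case: n => // n nT; have nT' : (n <= T)%N by exact: ltnW.
have [mx my mv mw] := run_measurable nT'; have [mx' my' _ _] := run_measurable nT.
have [al1 al2] := run_momentum n.+1.
have XY0 o : X (x n.+1 o) /\ Y (y n.+1 o) by apply: run_in; exact: leqW.
have XY1 o : X (x n.+2 o) /\ Y (y n.+2 o) by exact: run_in.
have X0 o : X (x n.+1 o) by case: (XY0 o).
have Y0 o : Y (y n.+1 o) by case: (XY0 o).
have X1 o : X (x n.+2 o) by case: (XY1 o).
have Y1 o : Y (y n.+2 o) by case: (XY1 o).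
have up (g : Omega -> R) : measurable_fun setT (g : history xiI (hs n) -> R) ->
    measurable_fun setT (g : history xiI (hs n.+1) -> R).
  by apply: history_measurable_fun_sub; exact: hs_sub.
have inj : injective (fun i : 'I_b => (n.+2, i)) by move=> i i' [->].
have Jt (i : 'I_b) : J (n.+2, i) by rewrite /J/=.
have Js : [set` hs n.+1] `<=` J.
  by move=> j /=; rewrite mem_hs => /andP[j1 jn]; rewrite /J/= j1 (leq_trans jn)// ltnW.
have nin (i : 'I_b) : (n.+2, i) \notin hs n.+1 by rewrite mem_hs/= ltnn.
have bndE c o : bnd c n.+1 o = 2 * (c * et n.+1 ^+ 2) ^+ 2 * delta ^+ 2 +
    2 * (1 - c * et n.+1 ^+ 2) ^+ 2 * (Lf ^+ 2 *
      (enorm (x n.+2 o - x n.+1 o) ^+ 2 + enorm (y n.+2 o - y n.+1 o) ^+ 2)).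
  by have [-> ->] := run_step_enorm o (nT : (1 <= n.+1 <= T)%N); rewrite /bnd; ring.
split.
- under [X in (_ <= _ + _ * X)%E]eq_integral do rewrite bndE.
  under [X in (X <= _)%E]eq_integral do rewrite /hE (mda_v (run _) (nT : (1 <= n.+1 <= T)%N)).
  exact: (oracle_step X_proj Y_proj Lf_gt0 run_Gx_lip run_gx_lip run_Gx_mean run_Gx_var
    xi_indep xi_distr b_ge1 inj (uniq_hs _) nin Jt Js al1 X0 X1 Y0 Y1
    (fun c => up _ (mx c)) mx' (fun c => up _ (my c)) my' mv).
- under [X in (_ <= _ + _ * X)%E]eq_integral do rewrite bndE.
  under [X in (X <= _)%E]eq_integral do rewrite /hG (mda_w (run _) (nT : (1 <= n.+1 <= T)%N)).
  exact: (oracle_step X_proj Y_proj Lf_gt0 run_Gy_lip run_gy_lip run_Gy_mean run_Gy_var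
    xi_indep xi_distr b_ge1 inj (uniq_hs _) nin Jt Js al2 X0 X1 Y0 Y1
    (fun c => up _ (mx c)) mx' (fun c => up _ (my c)) my' mw).
Qed.

Lemma run_Fpos n o : (1 <= n <= T.+1)%N -> 0 <= hFE n o.
Proof.
move=> nT; rewrite subr_ge0; apply: ge_inf => //.
by exists (x n o) => //; case: (run_in o nT).
Qed.

Lemma run_Fstep n o : (1 <= n <= T)%N -> hFE n.+1 o <= hFE n o + et n *
  (2 * gam * Lf ^+ 2 * hA n o + 2 * gam * hE n o - hP n o / (2 * gam)).
Proof.
move=> nT; have nT1 : (1 <= n <= T.+1)%N by case/andP: nT => -> /leqW.
have [Xn Yn] := run_in o nT1; have /andP[/ltW e0 e1] := run_eta n.
have := x_step_descent X_proj Y_proj X_neq0 Y_neq0 Lf_gt0 tau_gt0 fm_diff fm_lip C3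
  Xn Yn gam_gt0 (_ : 0 <= et n <= 1) (run_gam_eta n) (mda_xt (run o) nT).
rewrite e0 e1 -(mda_x (run o) nT) => /(_ isT) h.
by rewrite /hFE addrAC lerD2r.
Qed.

Lemma run_astep n o : (1 <= n <= T)%N -> let eta := et n in
  hA n.+1 o <= (1 - eta * tau * lam / 4) * hA n o - 3 * eta / 4 * hQ n o
    + 25 * eta * lam / (6 * tau) * hG n o
    + 25 * (Lf / tau) ^+ 2 * eta / (6 * tau * lam) * hP n o.
Proof.
move=> nT; have nT1 : (1 <= n <= T.+1)%N by case/andP: nT => -> /leqW.
have [Xn Yn] := run_in o nT1; have [lam6 _] := run_lam_le.
have Xt : X (xt n.+1 o) by rewrite (mda_xt (run o) nT); exact: eproj_in.
have := y_step X_proj Y_proj Y_neq0 Lf_gt0 tau_gt0 fm_diff fm_lip C3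
  Xn Xt Yn lam_gt0 (run_eta n) lam6 (mda_yt (run o) nT).
by rewrite -(mda_x (run o) nT) -(mda_y (run o) nT).
Qed.
Let nT1 n : (1 <= n <= T)%N -> (1 <= n <= T.+1)%N.
Proof. by case/andP=> -> /leqW. Qed.

Let M := (F x1 - Fstar) / (gam * k)
    + 9 * Lf ^+ 2 * enorm (y1 - ystar Y fm x1) ^+ 2 / (k * lam * tau)
    + 2 * m `^ 3^-1 * delta ^+ 2 / (b%:R * tau ^+ 2 * k ^+ 2)
    + 2 * (c1 ^+ 2 + c2 ^+ 2) * delta ^+ 2 * k ^+ 2 / (b%:R * tau ^+ 2)
        * ln (m + T%:R).

Lemma run_lyapunov :
  (forall n, (1 <= n <= T)%N -> [/\ P.-integrable setT (EFin \o hP n),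
    P.-integrable setT (EFin \o hA n) & P.-integrable setT (EFin \o hE n)]) /\
  \sum_(1 <= n < T.+1) (\int[P]_o hP n o / gam ^+ 2 + Lf ^+ 2 * \int[P]_o hA n o
    + \int[P]_o hE n o) <= 4 * M * (m + T%:R) `^ 3^-1.
Proof.
have [m2 mk mc1 mc2] := run_m_ge; have [_ lam27] := run_lam_le.
have b0 : 0 < b%:R :> R by rewrite ltr0n.
have [e1 g1] := run_init.
have XY n o : (1 <= n <= T.+1)%N -> X (x n o) /\ Y (y n o) := @run_in n o.
have ms n (u : Omega -> 'rV[R]_n) : (forall c, measurable_fun setT (fun o => u o 0 c)) ->
    measurable_fun setT (fun o => enorm (u o) ^+ 2) := measurable_sqr_enorm (Z := u).
have mgrad n : (1 <= n <= T.+1)%N ->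
    (forall c, measurable_fun setT (fun o => gradx fm (x n o) (y n o) 0 c)) /\
    (forall c, measurable_fun setT (fun o => grady fm (x n o) (y n o) 0 c)).
  move=> nT; have [mx my] := run_measurableP nT.
  by split=> c; [apply: (measurable_oracle_mean X_proj Y_proj Lf_gt0 run_gx_lip)|
    apply: (measurable_oracle_mean X_proj Y_proj Lf_gt0 run_gy_lip)] => // o;
    case: (XY n o nT).
apply: (expected_lyapunov (P := P) (F := hFE) (a := hA) (e := hE) (g := hG) (p := hP)
  (q := hQ) (F1 := F x1 - Fstar) (a1 := enorm (y1 - ystar Y fm x1) ^+ 2)
  b0 lam_gt0 gam_gt0 tau_gt0 Lf_gt0 k_gt0 m2 mk mc1 mc2 c1_ge c2_ge lam27 run_gam_sqrt
  run_Fpos).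
- by move=> n o; split; exact: sqr_ge0.
- by move=> n o; exact: sqr_ge0.
- by move=> n o; exact: sqr_ge0.
- move=> n nT; have [mx my] := run_measurableP nT; apply: measurable_funB => //.
  apply: (measurable_Fmax X_proj Y_proj Y_neq0 Lf_gt0 tau_gt0 fm_diff fm_lip C3) => // o.
  by case: (XY n o nT).
- move=> n nT; have [mx my] := run_measurableP nT; apply: ms; apply: mrow => // c.
  apply: (measurable_ystar X_proj Y_proj Y_neq0 Lf_gt0 tau_gt0 fm_diff fm_lip C3) => // o.
  by case: (XY n o nT).
- move=> n nT; have [mv _] := run_measurable_estimates nT; have [mg _] := mgrad n nT.
  by apply: ms; apply: mrow.
- move=> n nT; have [_ mw] := run_measurable_estimates nT; have [_ mg] := mgrad n nT.
  by apply: ms; apply: mrow.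
- move=> n nT; have [mx _] := run_measurableP (nT1 nT); have [mt _] := run_measurable_proj nT.
  by apply: ms; apply: mrow.
- move=> n nT; have [_ my] := run_measurableP (nT1 nT); have [_ mt] := run_measurable_proj nT.
  by apply: ms; apply: mrow.
- by move=> o; rewrite /hFE (mda_x1 (run o)).
- by move=> o; rewrite /hA (mda_x1 (run o)) (mda_y1 (run o)).
- exact: e1.
- exact: g1.
- by move=> n o; exact: run_Fstep.
- by move=> n o; exact: run_astep.
- by move=> n nT; case: (run_error nT).
- by move=> n nT; case: (run_error nT).
Qed.

Let hH n o := Hmeasure fm Y gam Lf (x n o) (xt n.+1 o) (v n o) (y n o).

Lemma run_measurable_H n : (1 <= n <= T)%N -> measurable_fun setT (hH n).
Proof.
move=> nT; have nT' := nT1 nT.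
have XY o : X (x n o) /\ Y (y n o) := run_in o nT'.
have [mx my] := run_measurableP nT'; have [mv _] := run_measurable_estimates nT'.
have [mt _] := run_measurable_proj nT.
apply: measurable_funD; first apply: measurable_funD.
- by apply: measurable_funM => //; apply: measurable_enorm; apply: mrow.
- apply: measurable_enorm; apply: mrow => // c.
  by apply: (measurable_oracle_mean X_proj Y_proj Lf_gt0 run_gx_lip) => // o; case: (XY o).
- apply: measurable_funM => //; apply: measurable_enorm; apply: mrow => // c.
  apply: (measurable_ystar X_proj Y_proj Y_neq0 Lf_gt0 tau_gt0 fm_diff fm_lip C3) => // o.
  by case: (XY o).
Qed.

Lemma run_H_ge0 n o : 0 <= hH n o.
Proof.
by rewrite /hH /Hmeasure !addr_ge0// ?mulr_ge0 ?enorm_ge0 ?invr_ge0 ?(ltW gam_gt0) ?(ltW Lf_gt0).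
Qed.

Lemma run_H_sqr n o : hH n o ^+ 2 <= 3 * (gam ^- 2 * hP n o + Lf ^+ 2 * hA n o + hE n o).
Proof.
rewrite /hP /hA /hE /hH /Hmeasure.
move: (enorm (xt _ _ - _)) (enorm (gradx _ _ _ - _)) (enorm (y _ _ - _)) => p e a.
rewrite -exprVn -!exprMn; move: (gam^-1 * p) (Lf * a) => p' a'.
rewrite -subr_ge0.
have -> : 3 * (p' ^+ 2 + a' ^+ 2 + e ^+ 2) - (p' + e + a') ^+ 2 =
  (p' - e) ^+ 2 + (p' - a') ^+ 2 + (e - a') ^+ 2 by ring.
by rewrite !addr_ge0 ?sqr_ge0.
Qed.

Lemma run_avgG_le :
  (T%:R^-1%:E * \sum_(1 <= t < T.+1)
    'E_P[fun o => enorm (Gmap X (x t o) (grad_on X F (x t o)) gam)] <=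
   T%:R^-1%:E * \sum_(1 <= t < T.+1) 'E_P[hH t])%E.
Proof.
apply: lee_wpmul2l; first by rewrite lee_fin invr_ge0.
rewrite !big_nat; apply: lee_sum => n nT; rewrite unlock.
have nT' := nT1 nT; have [mx my] := run_measurableP nT'.
have XY o : X (x n o) /\ Y (y n o) := run_in o nT'.
apply: ge0_le_integral => //.
- by move=> o _; rewrite lee_fin enorm_ge0.
- apply/measurable_EFinP; apply: measurable_enorm => c.
  (* [grad_on] is a choice, with no reason to be measurable in the point; after projection it can be
     replaced by Danskin's gradient. *)
  rewrite (_ : (fun o => _) = fun o => gam^-1 * (x n o 0 c -
    eproj X (x n o - gam *: gradx fm (x n o) (ystar Y fm (x n o))) 0 c)); last first.
    apply/funext => o; have [Xn _] := XY o.
    have E := eproj_grad_on X_proj Y_proj X_neq0 Y_neq0 Lf_gt0 tau_gt0 fm_diff fm_lip C3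
      gam Xn.
    by rewrite /Gmap E !mxE.
  apply: measurable_funM => //; apply: measurable_funB => //.
  apply: measurable_eproj => // c'; under eq_fun do rewrite row_subE mxE.
  apply: measurable_funB => //; apply: measurable_funM => //.
  apply: (measurable_oracle_mean X_proj Y_proj Lf_gt0 run_gx_lip) => //.
  + by move=> o; case: (XY o).
  + move=> o; have [Xn _] := XY o.
    by have [] := ystarP Y_proj Y_neq0 tau_gt0 fm_diff C3 Xn.
  + move=> i; apply: (measurable_ystar X_proj Y_proj Y_neq0 Lf_gt0 tau_gt0 fm_diff fm_lip C3) => // o.
    by case: (XY o).
- by apply/measurable_EFinP; exact: run_measurable_H.
- move=> o _; rewrite lee_fin; have [Xn Yn] := XY o.
  exact: (Gmap_le_Hmeasure X_proj Y_proj X_neq0 Y_neq0 Lf_gt0 tau_gt0 fm_diff fm_lip C3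
    Xn Yn gam_gt0 (mda_xt (run o) nT)).
Qed.

(** Strict positivity comes from the third term, as delta > 0; it makes the weight c in
    [average_le_sqrt] positive. *)
Lemma run_M_gt0 : 0 < M.
Proof.
have [m2 _ _ _] := run_m_ge; have m0 : 0 < m := lt_le_trans (ltr0n _ 2) m2.
have [c10 c20] := run_c_ge0.
have b0 : 0 < b%:R :> R by rewrite ltr0n.
have F0 : 0 <= F x1 - Fstar by rewrite subr_ge0; apply: ge_inf => //; exists x1.
have ln0 : 0 <= ln (m + T%:R).
  by rewrite ln_ge0// (le_trans _ (_ : m <= _)) ?lerDl// (le_trans _ m2)// ler1n.
have btk : 0 < b%:R * tau ^+ 2 * k ^+ 2 by rewrite !mulr_gt0 ?exprn_gt0.
rewrite /M; apply: ltr_wpDr.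
  rewrite mulr_ge0// divr_ge0 ?mulr_ge0 ?addr_ge0 ?sqr_ge0//; exact: ltW.
apply: ltr_wpDl; last by rewrite divr_gt0// !mulr_gt0 ?powR_gt0 ?exprn_gt0.
apply: addr_ge0; first by rewrite divr_ge0// mulr_ge0// ltW.
by rewrite divr_ge0 ?mulr_ge0 ?enorm_ge0 ?(ltW Lf_gt0) ?(ltW k_gt0) ?(ltW lam_gt0) ?(ltW tau_gt0)//.
Qed.

Lemma run_avgH_le :
  (T%:R^-1%:E * \sum_(1 <= t < T.+1) 'E_P[hH t] <=
   (2 * Num.sqrt (3 * M) * m `^ 6^-1 / T%:R `^ 2^-1
    + 2 * Num.sqrt (3 * M) / T%:R `^ 3^-1)%:E)%E.
Proof.
have [m2 _ _ _] := run_m_ge; have m0 : 0 < m := lt_le_trans (ltr0n _ 2) m2.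
have [int hsum] := run_lyapunov; have M0 := run_M_gt0.
have B0 : 0 < 4 * M * (m + T%:R) `^ 3^-1.
  by rewrite mulr_gt0 ?mulr_gt0// powR_gt0// ltr_wpDr.
have := average_le_sqrt (P := P) (H := hH) (p := hP) (a := hA) (e := hE) (al := gam ^- 2)
  (be := Lf ^+ 2) T_ge1 B0 (fun n o _ => run_H_ge0 n o) run_measurable_H
  (fun n o _ => run_H_sqr n o) int.
have EH n : ('E_P[hH n] = \int[P]_o (hH n o)%:E)%E by rewrite unlock.
move=> h; under eq_bigr do rewrite EH.
apply: le_trans (h _) _; last by rewrite lee_fin; exact: rate_le.
apply: le_trans hsum; rewrite le_eqVlt; apply/predU1P; left.
by apply: eq_bigr => n _; rewrite [gam ^- 2 * _]mulrC.
Qed.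
End run.

Unset Implicit Arguments.

Theorem theorem9 (R : realType) (d1 d2 : nat)
  (dXi : measure_display) (Xi : measurableType dXi) (D : probability Xi R)
  (f : Xi -> 'rV[R]_d1 -> 'rV[R]_d2 -> R)
  (X : set 'rV[R]_d1) (Y : set 'rV[R]_d2) (U : set ('rV[R]_d1 * 'rV[R]_d2))
  (delta Lf tau : R)
  (dO : measure_display) (Omega : measurableType dO) (P : probability Omega R)
  (b T : nat) (gam lam k m c1 c2 : R)
  (x1 : 'rV[R]_d1) (y1 : 'rV[R]_d2)
  (xi : nat -> 'I_b -> {RV P >-> Xi})
  (x xt v : nat -> Omega -> 'rV[R]_d1) (y yt w : nat -> Omega -> 'rV[R]_d2)
  (* the constraint sets *)
  (X_compact : compact X) (X_convex : convex_set X)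
  (Y_set : (compact Y /\ convex_set Y) \/ Y = setT)
  (* U is the domain on which f is defined by an expectation *)
  (U_open : open U) (U_dom : X `*` Y `<=` U)
  (f_int : forall u, U u -> D.-integrable setT (fun z => (f z u.1 u.2)%:E))
  (f_diff : forall z u, U u -> differentiable (fun p => f z p.1 p.2) u)
  (fmean_diff : forall u, U u -> differentiable (fun p => fmean D f p.1 p.2) u)
  (* (C1) *)
  (delta_gt0 : 0 < delta)
  (C1x : forall u, U u ->
    ('E_D[fun z => (enorm (gradx (f z) u.1 u.2
                      - gradx (fmean D f) u.1 u.2) ^+ 2)%R]
      <= (delta ^+ 2)%:E)%E)
  (C1y : forall u, U u ->
    ('E_D[fun z => (enorm (grady (f z) u.1 u.2
                      - grady (fmean D f) u.1 u.2) ^+ 2)%R]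
      <= (delta ^+ 2)%:E)%E)
  (* (C2) *)
  (C2 : forall z x x' y y', X x -> X x' -> Y y -> Y y' ->
    enorm (gradxy (f z) x y - gradxy (f z) x' y')
      <= Lf * enorm (row_mx x y - row_mx x' y'))
  (* (C3) *)
  (tau_gt0 : 0 < tau)
  (C3 : forall x y y', X x -> Y y -> Y y' ->
    fmean D f x y <= fmean D f x y'
      + dotp (grady (fmean D f) x y') (y - y')
      - tau / 2 * enorm (y - y') ^+ 2)
  (* (C4) *)
  (C4 : has_lbound (Fmax Y (fmean D f) @` X))
  (* the algorithm *)
  (b_ge1 : (1 <= b)%N) (T_ge1 : (1 <= T)%N)
  (x1_X : X x1) (y1_Y : Y y1)
  (xi_iid : iid_batches D T xi)
  (run : forall o : Omega, acc_mda f X Y gam lam k m c1 c2 T x1 y1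
    (fun t i => xi t i o)
    (x ^~ o) (xt ^~ o) (v ^~ o) (y ^~ o) (yt ^~ o) (w ^~ o))
  (* the parameters *)
  (k_gt0 : 0 < k)
  (c1_ge : 2 / (3 * k ^+ 3) + 9 * tau ^+ 2 / 4 <= c1)
  (c2_ge : 2 / (3 * k ^+ 3) + 75 * Lf ^+ 2 / 2 <= c2)
  (m_ge : Num.max 2 (Num.max (k ^+ 3)
            (Num.max ((c1 * k) ^+ 3) ((c2 * k) ^+ 3))) <= m)
  (lam_gt0 : 0 < lam)
  (lam_le : lam <= Num.min (1 / (6 * Lf)) (27 * b%:R * tau / 16))
  (gam_gt0 : 0 < gam)
  (gam_le : let kappa := Lf / tau in let Lg := Lf + Lf ^+ 2 / tau in
    gam <= Num.min
      (lam * tau / (2 * Lf)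
         * Num.sqrt (2 * b%:R / (8 * lam ^+ 2 + 75 * kappa ^+ 2 * b%:R)))
      (m `^ 3^-1 / (2 * Lg * k))) :
  let F := Fmax Y (fmean D f) in
  let Fstar := inf (F @` X) in
  let Delta1 := enorm (y1 - ystar Y (fmean D f) x1) ^+ 2 in
  let M := (F x1 - Fstar) / (gam * k)
    + 9 * Lf ^+ 2 * Delta1 / (k * lam * tau)
    + 2 * m `^ 3^-1 * delta ^+ 2 / (b%:R * tau ^+ 2 * k ^+ 2)
    + 2 * (c1 ^+ 2 + c2 ^+ 2) * delta ^+ 2 * k ^+ 2 / (b%:R * tau ^+ 2)
        * ln (m + T%:R) in
  let avgG := ((T%:R^-1)%:E * \sum_(1 <= t < T.+1)
    'E_P[fun o => enorm (Gmap X (x t o) (grad_on X F (x t o)) gam)])%E in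
  let avgH := ((T%:R^-1)%:E * \sum_(1 <= t < T.+1)
    'E_P[fun o => Hmeasure (fmean D f) Y gam Lf
                    (x t o) (xt t.+1 o) (v t o) (y t o)])%E in
  let bound := 2 * Num.sqrt (3 * M) * m `^ 6^-1 / T%:R `^ 2^-1
    + 2 * Num.sqrt (3 * M) / T%:R `^ 3^-1 in
  (avgG <= avgH)%E /\ (avgH <= bound%:E)%E.
Proof.
move=> F Fstar Delta1 M avgG avgH bound; split.
  exact: (run_avgG_le X_compact X_convex Y_set U_open U_dom f_int f_diff fmean_diff
    C1x C1y C2 tau_gt0 C3 x1_X y1_Y run k_gt0 m_ge lam_gt0 lam_le gam_gt0).
exact: (run_avgH_le X_compact X_convex Y_set U_open U_dom f_int f_diff fmean_diff
  delta_gt0 C1x C1y C2 tau_gt0 C3 C4 b_ge1 T_ge1 x1_X y1_Y xi_iid run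
  k_gt0 c1_ge c2_ge m_ge lam_gt0 lam_le gam_gt0 gam_le).
Qed.
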